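(* Let $1 \leq d_0 \leq d$ be integers, let $\mathcal{X} = [0,1)^{d_0} \times \prod_{j=d_0+1}^d [m_j]$ with $m_{j} \in \mathbb{N} \cup \{\infty\}$, let $h = (h_1,\ldots,h_{d_0}) \in (0,\infty)^{d_0}$, $r = (r_1,\ldots,r_{d_0}) \in (0,1]^{d_0}$, $L > 0$ and $\alpha,\beta \in (0,1)$, and suppose that $P_{\mathbb{S}} \in \mathcal{P}_{\mathbb{S},r,L}$. Consider the test that rejects the null hypothesis $P_{\mathbb{S}} \in \mathcal{P}_{\mathbb{S}}^0$ if and only if $R_h(\widehat{P}_{\mathbb{S}}) \geq C_\alpha^*$. Then the probability of a Type I error for this test is at most $\alpha$; that is, if $P_{\mathbb{S}} \in \mathcal{P}_{\mathbb{S}}^0$, then $\mathbb{P}_{P_{\mathbb{S}}}\bigl(R_h(\widehat{P}_{\mathbb{S}}) \geq C_\alpha^*\bigr) \leq \alpha$. Moreover, if \[ R(P_{\mathbb{S}}) \geq L (|\mathbb{S}|-1)\sum_{j=1}^{d_0} h_j^{r_j} + C_\alpha^* + C_\beta^*, \] then the probability of a Type II error is at most $\beta$; that is, $\mathbb{P}_{P_{\mathbb{S}}}\bigl(R_h(\widehat{P}_{\mathbb{S}}) < C_\alpha^*\bigr) \leq \beta$.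
   Context: Notation: $[m] := \{1,\ldots,m\}$, $[\infty] := \mathbb{N}$, $a\wedge b := \min(a,b)$, $a\vee b := \max(a,b)$; $\mathcal{X}_j = [0,1)$ for $j \leq d_0$ and $\mathcal{X}_j = [m_j]$ (discrete) for $j > d_0$; $\mathcal{X}_S := \prod_{j\in S}\mathcal{X}_j$, $x_S := (x_j : j \in S)$; $\mathbb{S}$ is a non-empty collection of subsets of $[d]$. $\mathcal{P}_{\mathbb{S}}$ is the set of sequences $P_{\mathbb{S}} = (P_S : S \in \mathbb{S})$ with $P_S$ a probability distribution on $\mathcal{X}_S$, and $\mathcal{P}_{\mathbb{S}}^0$ is the subset of compatible sequences: those for which there is a distribution on $\mathcal{X}$ with marginal $P_S$ on $\mathcal{X}_S$ for every $S\in\mathbb{S}$. For $n_S \in \mathbb{N}$, we observe independent $(X_{S,i} : S \in \mathbb{S}, i \in [n_S])$ with $X_{S,i} \sim P_S$ (probability denoted $\mathbb{P}_{P_{\mathbb{S}}}$); $\widehat{P}_S$ is the empirical distribution of $X_{S,1},\ldots,X_{S,n_S}$, and $\widehat{P}_{\mathbb{S}} := (\widehat{P}_S : S \in \mathbb{S})$. Incompatibility index: $R(P_{\mathbb{S}},f_{\mathbb{S}}) := -\frac{1}{|\mathbb{S}|}\sum_{S\in\mathbb{S}}\int_{\mathcal{X}_S} f_S\,dP_S$, and $R(P_{\mathbb{S}}) := \sup_{f_{\mathbb{S}}\in\mathcal{G}_{\mathbb{S}}^+} R(P_{\mathbb{S}},f_{\mathbb{S}})$, where $\mathcal{G}_{\mathbb{S}}^+$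 is the set of sequences $f_{\mathbb{S}} = (f_S : S\in\mathbb{S})$ of bounded upper semi-continuous functions $f_S:\mathcal{X}_S\to[-1,\infty)$ with $\inf_{x\in\mathcal{X}}\sum_{S\in\mathbb{S}} f_S(x_S)\geq 0$. Discretised index: for $j\in[d_0]$ and $k_j \in [\lceil 1/h_j\rceil]$ let $I_{h_j,k_j} := [(k_j-1)h_j, (k_jh_j)\wedge 1)$. Let $\mathcal{G}_{\mathbb{S},h}^+$ be the set of sequences $(f_S:S\in\mathbb{S})$ of functions $f_S:\mathcal{X}_S\to[-1,\infty)$ that are constant on each set of the form $\prod_{j\in S\cap[d_0]} I_{h_j,k_j}\times\prod_{j\in S\cap([d]\setminus[d_0])}\{k_j\}$ and satisfy $\inf_{x\in\mathcal{X}}\sum_{S\in\mathbb{S}}f_S(x_S)\geq 0$; put $R_h(P_{\mathbb{S}}) := \sup_{f_{\mathbb{S}}\in\mathcal{G}_{\mathbb{S},h}^+}R(P_{\mathbb{S}},f_{\mathbb{S}})$. Smoothness class: for $d'\in\mathbb{N}$ and $r' \in(0,1]^{d'}$, $\mathcal{H}_{d'}(r',L)$ is the set of $p:[0,1)^{d'}\to\mathbb{R}$ with $|p(z)-p(z')|\leq L\sum_{j=1}^{d'}|z_j-z_j'|^{r'_j}$ for all $z,z'$. $\mathcal{P}_{\mathbb{S},r,L}$ is the set of $P_{\mathbb{S}} \in \mathcal{P}_{\mathbb{S}}$ such that each $P_S$ has a density $p_S$ with respect to the product of Lebesgue measure on $[0,1)^{S\cap[d_0]}$ and counting measure on $\prod_{j\in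 S\cap([d]\setminus[d_0])}[m_j]$, and for every value of $x_{S\cap([d]\setminus[d_0])}$ (of positive marginal mass) the conditional density $x_{S\cap[d_0]}\mapsto p_S(x_{S\cap[d_0]}\,|\,x_{S\cap([d]\setminus[d_0])})$ belongs to $\mathcal{H}_{|S\cap[d_0]|}\bigl((r_j)_{j\in S\cap[d_0]},L\bigr)$. Critical value: consider the discrete space $\mathcal{K}_h := \prod_{j=1}^{d_0}[\lceil 1/h_j\rceil]\times\prod_{j=d_0+1}^d[m_j]$, with $\mathcal{K}_{h,S}$ denoting the product of its factors with index in $S$. For $\alpha\in(0,1)$ let $C_\alpha^* := \min(C_\alpha, C_\alpha')$, where \[ C_\alpha := \frac12\sum_{S\in\mathbb{S}}\Bigl(\frac{|\mathcal{K}_{h,S}|-1}{n_S}\Bigr)^{1/2}+\Bigl\{\frac12\log(1/\alpha)\sum_{S\in\mathbb{S}}\frac1{n_S}\Bigr\}^{1/2}, \] \[ C_\alpha' := |\mathbb{S}| \max \Biggl\{ \frac{2 \log\bigl( \frac{2F|\mathbb{S}|}{\alpha} \vee 1\bigr)}{ \min_{S \in \mathbb{S}} n_S},\; 2^{2|\mathbb{S}|+7} \max_{\substack{S_1,S_2 \in \mathbb{S}:\\ S_1 \neq S_2,\, S_1 \cap S_2 \neq \emptyset}} \frac{|\mathcal{K}_{h,S_1 \cap S_2}|\log 2 + \log\bigl(\frac{2|\mathbb{S}|(|\mathbb{S}|-1)}{\alpha}\bigr)}{n_{S_1} \wedge n_{S_2}} \Biggr\}^{1/2}. \] Here $F$ is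 the number of essential facets of the following polyhedral set for the discrete space $\mathcal{K}_h$. Let $\mathcal{Q}^0$ and $\mathcal{Q}^{\mathrm{cons}}$ be the sets of compatible and of consistent sequences of probability mass functions $(q_S:S\in\mathbb{S})$, $q_S$ on $\mathcal{K}_{h,S}$ (consistent: whenever $S_1\cap S_2\neq\emptyset$ the marginals of $q_{S_1},q_{S_2}$ on $\mathcal{K}_{h,S_1\cap S_2}$ agree). The polyhedral set is the Minkowski sum $\{\lambda q:q\in\mathcal{Q}^0,\lambda\geq0\}+\{\lambda q:q\in\mathcal{Q}^{\mathrm{cons}},\lambda\in[0,1]\}$; its facets (relative to its affine hull) that are not given by a non-negativity condition $q_S(k_S)\geq0$ are called essential. If $\mathcal{K}_h$ is infinite we set $C_\alpha=C'_\alpha=+\infty$, and if no two distinct members of $\mathbb{S}$ intersect we set $C_\alpha'=+\infty$. *)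

(* Defs.v *)
From HB Require Import structures.
From mathcomp Require Import all_boot all_order all_algebra.
From mathcomp Require Import finmap.
From mathcomp Require Import all_classical all_reals all_analysis measurable_realfun.

Set Implicit Arguments.
Unset Strict Implicit.
Unset Printing Implicit Defensive.
Import Order.TTheory GRing.Theory Num.Theory.
Import numFieldNormedType.Exports.

Local Open Scope classical_set_scope.
Local Open Scope ring_scope.

Definition pts (R : realType) (I : Type) : Type := I -> R.

HB.instance Definition _ (R : realType) (I : Type) := Pointed.on (pts R I).
HB.instance Definition _ (R : realType) (I : Type) :=
  Topological.copy (pts R I) (prod_topology (fun _ : I => R)).

Definition cylinders (R : realType) (I : Type) : set (set (pts R I)) :=
  [set A | exists i B, measurable B /\ A = (fun x : pts R I => x i) @^-1` B].

HB.instance Definition _ (R : realType) (I : Type) :=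
  Measurable.copy (pts R I) (g_sigma_algebraType (@cylinders R I)).

Lemma measurable_coord (R : realType) (I : Type) (i : I) :
  measurable_fun [set: pts R I] (fun x : pts R I => x i).
Proof.
move=> _ B mB; rewrite setTI; apply: sub_sigma_algebra.
by exists i, B.
Qed.

Lemma measurable_fun_pts (R : realType) (I : Type) d (T : measurableType d)
    (f : T -> pts R I) :
  (forall i, measurable_fun [set: T] (fun t => f t i)) ->
  measurable_fun [set: T] f.
Proof.
move=> mf; apply: (@measurability _ _ _ _ _ _ (@cylinders R I)) => //.
move=> _ [_ [i [B [mB ->]] <-]].
exact: (mf i measurableT B mB).
Qed.

Section product.
Variables (R : realType) (I : finType).
Variable mu : I -> {sigma_finite_measure set R -> \bar R}.

Definition upd (x : pts R I) (i : I) (y : R) : pts R I :=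
  fun k => if k == i then y else x k.

Local Open Scope ereal_scope.

(* [iter_prod s x] is the product of the [mu i], [i] in [s], by iterated
   integration; the coordinates outside [s] are frozen at those of [x]. *)
Fixpoint iter_prod (s : seq I) (x : pts R I) (A : set (pts R I)) : \bar R :=
  if s is i :: s' then \int[mu i]_y iter_prod s' (upd x i y) A else \d_x A.

Definition prod_meas : set (pts R I) -> \bar R :=
  iter_prod (enum I) (fun=> 0%R).

Lemma iter_prod_ge0 s x A : 0 <= iter_prod s x A.
Proof.
elim: s x => [|i s ih] x /=; first by rewrite diracE lee_fin.
by apply: integral_ge0.
Qed.

Lemma measurable_upd i :
  measurable_fun [set: pts R I * R] (fun p => upd p.1 i p.2).
Proof.
apply: measurable_fun_pts => k; rewrite /upd; case: (k == i).
  exact: measurable_snd.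
exact: (measurableT_comp (measurable_coord k) measurable_fst).
Qed.


Lemma measurable_iter_prod s A : measurable A ->
  measurable_fun [set: pts R I] (fun x => iter_prod s x A).
Proof.
move=> mA; elim: s => [|i s ih] /=.
  by apply/measurable_EFinP; exact: measurable_indic.
apply: (@measurable_fun_fubini_tonelli_F _ _ _ _ _ (mu i)
  (fun p => iter_prod s (upd p.1 i p.2) A)).
  exact: (measurableT_comp ih (measurable_upd i)).
by move=> p; exact: iter_prod_ge0.
Qed.

Lemma measurable_upd2 i x : measurable_fun [set: R] (upd x i).
Proof.
by apply: measurable_fun_pts => k; rewrite /upd; case: (k == i).
Qed.

Lemma iter_prod0 s x : iter_prod s x set0 = 0.
Proof.
elim: s x => [|i s ih] x /=; first by rewrite measure0.
by under eq_integral do rewrite ih; rewrite integral0.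
Qed.

Lemma iter_prod_sigma_additive s x : semi_sigma_additive (iter_prod s x).
Proof.
move=> F mF tF mUF.
rewrite [X in _ --> X](_ : _ = \sum_(n <oo) iter_prod s x (F n)).
  apply/cvg_closeP; split; last by rewrite closeE.
  apply: (@is_cvg_nneseries R (fun n => iter_prod s x (F n)) xpredT 0%N).
  by move=> n _ _; exact: iter_prod_ge0.
elim: s x => [|i s ih] x /=.
  by apply/esym/cvg_lim => //; exact: measure_semi_sigma_additive.
rewrite -integral_nneseries//; first last.
- by move=> n y _; exact: iter_prod_ge0.
- move=> n.
  exact: (measurableT_comp (measurable_iter_prod s (mF n))
                           (measurable_upd2 i x)).
- by apply: eq_integral => y _; exact: ih.
Qed.

HB.instance Definition _ := isMeasure.Build _ _ _ prod_meas
  (iter_prod0 _ _) (iter_prod_ge0 _ _) (@iter_prod_sigma_additive _ _).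

Lemma iter_prod_box (B : I -> set R) s x :
  (forall i, measurable (B i)) -> uniq s ->
  (iter_prod s x [set z | forall i, B i (z i)] =
  \big[*%E/1]_(i <- s) mu i (B i) * (\1_[set z : pts R I| forall i, i \notin s -> B i (z i)] x)%:E)%E.
Proof.
move=> mB; elim: s x => [|i s ih] x /=.
  move=> _; rewrite big_nil mul1e diracE indicE; congr (_%:R%:E); congr nat_of_bool; apply/idP/idP; rewrite !inE /= => h j; [move=> _|]; exact: h.
case/andP => iS us; rewrite big_cons.
under eq_integral => y _ do rewrite ih//.
set a := (\1_(_) x).
transitivity (\int[mu i]_y ((\big[*%E/1%E]_(j <- s) mu j (B j) * a%:E) * (\1_(B i) y)%:E))%E.
  apply: eq_integral => y _; rewrite -muleA; congr (_ * _)%E.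
  rewrite -EFinM; congr (_%:E); rewrite /a !indicE -natrM mulnb; congr (_%:R).
  congr nat_of_bool; apply/idP/andP; rewrite !inE /=.
    move=> h; split; first by move=> j; rewrite inE negb_or => /andP[ji js]; have := h j js; rewrite /upd (negbTE ji).
    by have := h i iS; rewrite /upd eqxx.
  move=> [h1 h2] j js; rewrite /upd; case: eqP => [->//|/eqP ji].
  by apply: h1; rewrite inE negb_or ji.
have p0 : (0 <= \big[*%E/1%E]_(j <- s) mu j (B j))%E.
  by elim/big_ind: _ => // ? ? ? ?; exact: mule_ge0.
rewrite ge0_integralZl//.
- by rewrite integral_indic// setIT muleC muleA.
- by apply/measurable_EFinP; exact: measurable_indic.
- by apply: mule_ge0 => //; rewrite lee_fin /a indicE.
Qed.

Lemma prod_meas_box (B : I -> set R) : (forall i, measurable (B i)) ->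
  prod_meas [set z | forall i, B i (z i)] = \big[*%E/1]_i mu i (B i).
Proof.
move=> mB; rewrite /prod_meas iter_prod_box ?enum_uniq// big_enum_cond/=.
rewrite indicE mem_set ?mule1// => i.
by rewrite mem_enum.
Qed.

End product.

(* {1, ..., N}; the case N = infinity is [None]. *)
Definition upto (N : option nat) : set nat :=
  [set k | (1 <= k)%N && (if N is Some N' then (k <= N')%N else true)].

Section sample_space.
Variables (R : realType) (d0 d : nat) (m : 'I_d -> option nat).

(* Coordinates are numbered from 0, so that [j < d0] are the continuous ones;
   the discrete sets [m_j] are viewed inside R. *)
Definition coord_space (j : 'I_d) : set R :=
  if (j < d0)%N then [set` `[0, 1[] else [set k%:R | k in upto (m j)].

Lemma measurable_coord_space j : measurable (coord_space j).
Proof.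
rewrite /coord_space; case: ifP => _ //.
apply: countable_measurable; first by move=> x; exact: measurable_set1.
exact: sub_countable (card_image_le _ _) (countableP _).
Qed.

Definition coord_meas (j : 'I_d) : set R -> \bar R :=
  if (j < d0)%N then mrestr lebesgue_measure (measurable_coord_space j)
  else mrestr (@counting R R) (measurable_coord_space j).

Section instances.
Variable j : 'I_d.

Let coord_meas0 : coord_meas j set0 = 0%E.
Proof. by rewrite /coord_meas; case: ifP => _; exact: measure0. Qed.

Let coord_meas_ge0 A : (0 <= coord_meas j A)%E.
Proof. by rewrite /coord_meas; case: ifP => _; exact: measure_ge0. Qed.

Let coord_meas_sigma_additive : semi_sigma_additive (coord_meas j).
Proof.
rewrite /coord_meas; case: ifP => _.
  exact: (@measure_semi_sigma_additive _ _ _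
    (mrestr lebesgue_measure (measurable_coord_space j))).
exact: (@measure_semi_sigma_additive _ _ _
  (mrestr (@counting R R) (measurable_coord_space j))).
Qed.

HB.instance Definition _ := isMeasure.Build _ _ _ (coord_meas j)
  coord_meas0 coord_meas_ge0 coord_meas_sigma_additive.

Let coord_meas_sigma_finite : sigma_finite setT (coord_meas j).
Proof.
exists (fun n => [set` `]-oo, n%:R]]); last first.
  move=> n; split => //; rewrite /coord_meas.
  rewrite /mrestr /coord_space; case: (j < d0)%N.
    apply: (@le_lt_trans _ _ (lebesgue_measure [set` `[0, 1[])).
      apply: le_measure; rewrite ?inE//; exact: measurableI.
    by rewrite lebesgue_measure_itv/= lte01 -EFinB ltry.
  rewrite /counting asboolT ?ltry//.
  apply: (@sub_finite_set _ _ [set k%:R | k in `I_n.+1]); last first.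
    exact: finite_image.
  move=> t [/= tn [k _ kt]]; exists k => //=.
  by move: tn; rewrite -kt in_itv/= ler_nat.
apply/seteqP; split => // x _ /=.
exists (Num.bound `|x|) => //=; rewrite in_itv/=.
by rewrite (le_trans (ler_norm x))// ltW// archi_boundP.
Qed.

HB.instance Definition _ := @Measure_isSigmaFinite.Build _ _ _ (coord_meas j)
  coord_meas_sigma_finite.

End instances.

Definition idx (S : {set 'I_d}) : finType := {j : 'I_d | j \in S}.

Definition space (I : finType) (e : I -> 'I_d) : set (pts R I) :=
  [set x | forall i, coord_space (e i) (x i)].

Definition full_space : set (pts R 'I_d) := space id.

Definition space_of (S : {set 'I_d}) : set (pts R (idx S)) :=
  @space (idx S) val.

Definition proj_to (S : {set 'I_d}) (x : pts R 'I_d) : pts R (idx S) :=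
  fun i => x (val i).

(* Lebesgue measure on the continuous coordinates in [S] times counting measure
   on the discrete ones. *)
Definition ref_meas (S : {set 'I_d}) : {measure set (pts R (idx S)) -> \bar R} :=
  prod_meas (fun i : idx S => coord_meas (val i)).

(* Families are given for all [S]; only their values at [S \in SS] matter. *)
Definition dist_seq (SS : {set {set 'I_d}})
    (P : forall S, probability (pts R (idx S)) R) : Prop :=
  forall S, S \in SS -> P S (@space_of S) = 1%E.

Definition compatible (SS : {set {set 'I_d}})
    (P : forall S, probability (pts R (idx S)) R) : Prop :=
  exists Q : probability (pts R 'I_d) R, Q full_space = 1%E /\
    forall S, S \in SS -> forall A, measurable A ->
      Q (@proj_to S @^-1` A) = P S A.

Definition index_at (SS : {set {set 'I_d}})
    (P : forall S, {measure set (pts R (idx S)) -> \bar R})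
    (f : forall S, pts R (idx S) -> R) : \bar R :=
  (- ((#|SS|%:R^-1)%:E *
      \sum_(S in SS) \int[P S]_(x in @space_of S) (f S x)%:E))%E.

Definition nonneg_sum (SS : {set {set 'I_d}})
    (f : forall S, pts R (idx S) -> R) : Prop :=
  (0 <= ereal_inf [set (\sum_(S in SS) f S (proj_to x))%:E
                  | x in full_space])%E.

(* Upper semi-continuity on [space_of S] is lower semi-continuity of [- f]
   for the subspace topology. *)
Definition class_G (SS : {set {set 'I_d}})
    : set (forall S, pts R (idx S) -> R) :=
  [set f | (forall S, S \in SS ->
      [/\ forall x, space_of x -> - 1 <= f S x,
          exists M, forall x, space_of x -> f S x <= M
        & lower_semicontinuous
            (fun x : subspace (@space_of S) => (- f S x)%:E)])
    /\ nonneg_sum SS f].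

Definition incompat_index (SS : {set {set 'I_d}})
    (P : forall S, {measure set (pts R (idx S)) -> \bar R}) : \bar R :=
  ereal_sup [set index_at SS P f | f in class_G SS].

Definition nlevels (h : 'I_d -> R) (j : 'I_d) : option nat :=
  if (j < d0)%N then Some `|Num.ceil (h j)^-1|%N else m j.

Definition subinterval (hj : R) (k : nat) : set R :=
  [set x | (k%:R - 1) * hj <= x < Num.min (k%:R * hj) 1].

Definition cell (h : 'I_d -> R) (S : {set 'I_d}) (k : idx S -> nat)
    : set (pts R (idx S)) :=
  [set x | forall i : idx S,
    if (val i < d0)%N then subinterval (h (val i)) (k i) (x i)
    else x i = (k i)%:R].

Definition class_Gh (SS : {set {set 'I_d}}) (h : 'I_d -> R)
    : set (forall S, pts R (idx S) -> R) :=
  [set f | (forall S, S \in SS ->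
      (forall x, space_of x -> - 1 <= f S x) /\
      (forall k : idx S -> nat,
        (forall i, upto (nlevels h (val i)) (k i)) ->
        forall x y, cell h k x -> cell h k y -> f S x = f S y))
    /\ nonneg_sum SS f].

Definition incompat_index_h (SS : {set {set 'I_d}}) (h : 'I_d -> R)
    (P : forall S, {measure set (pts R (idx S)) -> \bar R}) : \bar R :=
  ereal_sup [set index_at SS P f | f in class_Gh SS h].

Definition holder (I : finType) (r : I -> R) (L : R) (p : pts R I -> R) : Prop :=
  forall z z', (forall i, 0 <= z i < 1) -> (forall i, 0 <= z' i < 1) ->
    `|p z - p z'| <= L * \sum_i `|z i - z' i| `^ r i.

Definition is_density (S : {set 'I_d}) (P : probability (pts R (idx S)) R)
    (p : pts R (idx S) -> R) : Prop :=
  [/\ measurable_fun (@space_of S) p, forall x, space_of x -> 0 <= p x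
    & forall A, measurable A -> A `<=` @space_of S ->
        P A = (\int[@ref_meas S]_(x in A) (p x)%:E)%E].

Definition cont_idx (S : {set 'I_d}) : finType :=
  {j : 'I_d | (j \in S) && (j < d0)%N}.

(* [x] with its continuous coordinates replaced by those of [z] *)
Definition glue (S : {set 'I_d}) (z : pts R (cont_idx S)) (x : pts R (idx S))
    : pts R (idx S) :=
  fun i => if insub (val i) is Some j then z j else x i.

Definition disc_fiber (S : {set 'I_d}) (x : pts R (idx S))
    : set (pts R (idx S)) :=
  [set y | space_of y /\
    forall i : idx S, (d0 <= val i)%N -> y i = x i].

Definition smooth_class (SS : {set {set 'I_d}}) (r : 'I_d -> R) (L : R)
    (P : forall S, probability (pts R (idx S)) R) : Prop :=
  dist_seq SS P /\
  forall S, S \in SS -> exists p, is_density (P S) p /\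
    forall x, space_of x -> (0 < P S (disc_fiber x))%E ->
      holder (fun j : cont_idx S => r (val j)) L
        (fun z => p (glue z x) / fine (P S (disc_fiber x))).

Definition indep_samples (SS : {set {set 'I_d}}) (n : {set 'I_d} -> nat)
    (P : forall S, probability (pts R (idx S)) R)
    dO (Omega : measurableType dO) (Pr : probability Omega R)
    (X : forall S, nat -> Omega -> pts R (idx S)) : Prop :=
  [/\ forall S i, S \in SS -> (i < n S)%N ->
        measurable_fun [set: Omega] (X S i) /\
        forall w, space_of (X S i w),
      forall S i, S \in SS -> (i < n S)%N -> forall A, measurable A ->
        Pr (X S i @^-1` A) = P S A
    & forall A : forall S, nat -> set (pts R (idx S)),
        (forall S i, measurable (A S i)) ->
        Pr (\bigcap_(S in [set` SS]) \bigcap_(i in `I_(n S))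
              X S i @^-1` A S i) =
        (\prod_(S in SS) \prod_(i < n S) Pr (X S i @^-1` A S i))%E].

Definition empirical (n : {set 'I_d} -> nat) (Omega : Type)
    (X : forall S, nat -> Omega -> pts R (idx S)) (w : Omega) (S : {set 'I_d})
    : {measure set (pts R (idx S)) -> \bar R} :=
  mscale ((n S)%:R^-1)%:nng (msum (fun i => \d_(X S i w)) (n S)).

End sample_space.

Section facets.
Variables (R : realType) (V : vectType R).

Definition affine_dim (A : set V) (n : nat) : Prop :=
  let has_indep k := exists (v0 : V) (v : k.-tuple V),
    [/\ A v0, forall i, A (tnth v i) & free [seq x - v0 | x <- v]] in
  has_indep n /\ ~ has_indep n.+1.

Definition face (A F : set V) : Prop :=
  exists (phi : 'Hom(V, R^o)) (b : R),
    (forall x, A x -> phi x <= b) /\ F = A `&` [set x | phi x = b].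

Definition facet (A F : set V) : Prop :=
  face A F /\ exists n, affine_dim A n.+1 /\ affine_dim F n.

End facets.

Section polyhedron.
Variables (R : realType) (d : nat) (N : 'I_d -> nat).
Variable SS : {set {set 'I_d}}.

Definition grid (I : finType) (e : I -> 'I_d) : finType :=
  {dffun forall i : I, 'I_(N (e i))}.

Definition grid_of (S : {set 'I_d}) : finType := @grid (idx S) val.

Definition agree (I J : finType) (e : I -> 'I_d) (e' : J -> 'I_d)
    (x : grid e) (y : grid e') : bool :=
  [forall i, forall j, (e i == e' j) ==> (x i == y j :> nat)].

(* the marginal of [q], when the coordinates of [e'] are among those of [e] *)
Definition marginal (I J : finType) (e : I -> 'I_d) (e' : J -> 'I_d)
    (q : grid e -> R) (y : grid e') : R :=
  \sum_(x | agree x y) q x.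

Definition pmf (T : finType) (q : T -> R) : Prop :=
  (forall x, 0 <= q x) /\ \sum_x q x = 1.

Definition member : finType := {S : {set 'I_d} | S \in SS}.

Definition mass_coord : finType := {S : member & grid_of (val S)}.

Definition mass_seq : vectType R := {ffun mass_coord -> R^o}.

Definition mass_at (q : mass_seq) (S : member) (k : grid_of (val S)) : R :=
  q (Tagged (fun S : member => grid_of (val S)) k).

Definition pmf_seq (q : mass_seq) : Prop :=
  forall S : member, pmf (mass_at q (S := S)).

Definition compatible_seqs : set mass_seq :=
  [set q | pmf_seq q /\ exists p : @grid 'I_d id -> R, pmf p /\
    forall (S : member) (k : grid_of (val S)), mass_at q k = marginal p k].

Definition consistent_seqs : set mass_seq :=
  [set q | pmf_seq q /\ forall S1 S2 : member,
    ~~ [disjoint val S1 & val S2] ->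
    forall k : grid_of (val S1 :&: val S2),
      marginal (mass_at q (S := S1)) k = marginal (mass_at q (S := S2)) k].

Definition polyhedral_set : set mass_seq :=
  [set v | exists q q' (a b : R),
    [/\ compatible_seqs q /\ 0 <= a, consistent_seqs q' /\ 0 <= b <= 1
      & v = a *: q + b *: q']].

Definition essential_facets : set (set mass_seq) :=
  [set F | facet polyhedral_set F /\
    ~ exists (S : member) (k : grid_of (val S)),
        F = polyhedral_set `&` [set q | mass_at q k = 0]].

Definition nb_essential_facets : nat := #|` fset_set essential_facets|.

End polyhedron.

Section critical_values.
Variables (R : realType) (d0 d : nat) (m : 'I_d -> option nat).
Variables (SS : {set {set 'I_d}}) (h : 'I_d -> R) (n : {set 'I_d} -> nat).

Let finite_grid : bool := [forall j, nlevels d0 m h j != None].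

Let N (j : 'I_d) : nat := odflt 0%N (nlevels d0 m h j).

Let card_grid (S : {set 'I_d}) : R := #|grid_of N S|%:R.

Definition crit1 (alpha : R) : R :=
  2^-1 * \sum_(S in SS) Num.sqrt ((card_grid S - 1) / (n S)%:R) +
  Num.sqrt (2^-1 * ln alpha^-1 * \sum_(S in SS) (n S)%:R^-1).

Definition overlap (S1 S2 : {set 'I_d}) : bool :=
  [&& S1 \in SS, S2 \in SS, S1 != S2 & ~~ [disjoint S1 & S2]].

(* [nmax] only serves as the start of the iterated minimum; the terms of the
   iterated maximum are positive. *)
Definition crit2 (alpha : R) : R :=
  let F : R := (nb_essential_facets R N SS)%:R in
  let s : R := #|SS|%:R in
  let nmax := \big[maxn/0%N]_(S in SS) n S in
  let nmin := \big[minn/nmax]_(S in SS) n S in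
  s * Num.sqrt (Num.max
    (2 * ln (Num.max (2 * F * s / alpha) 1) / nmin%:R)
    (2 ^+ (2 * #|SS| + 7) *
     \big[Num.max/0]_(p : {set 'I_d} * {set 'I_d} | overlap p.1 p.2)
       ((card_grid (p.1 :&: p.2) * ln 2 + ln (2 * s * (s - 1) / alpha))
        / (minn (n p.1) (n p.2))%:R))).

Definition crit (alpha : R) : \bar R :=
  if finite_grid then
    Order.min (crit1 alpha)%:E
      (if [exists p : {set 'I_d} * {set 'I_d}, overlap p.1 p.2]
       then (crit2 alpha)%:E else +oo%E)
  else +oo%E.

End critical_values.

(* Main.v *)
Require Import Defs.
From HB Require Import structures.
From mathcomp Require Import all_boot all_order all_algebra.
From mathcomp Require Import finmap.
From mathcomp Require Import all_classical all_reals all_analysis measurable_realfun.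
From mathcomp Require Import perm zify ring lra.

(** Let [s] be the number of members of [SS]. The functions admitted in
    [incompat_index_h] are constant on cells, so over a finite grid the
    discretised index of a family of laws is the index of its cell masses
    ([incompat_index_hE]). By linear programming duality, in the form of
    Fourier-Motzkin elimination ([finite_farkas]), the latter is a maximum of
    finitely many linear forms [discrete_index _ f], where the values of [f] lie
    in [[-1, s - 1]] ([finite_normalized_class]). So the test only sees which
    cells the observations hit, and these are independent, with the cell masses
    of [P] as laws ([sample_index_law]).

    An observation from [P S] changes the statistic by at most [1 / n S], and not
    at all if [S] meets no other member. Hence McDiarmid's inequality ([mcdiarmid])
    bounds the deviations of the statistic from its mean. By convexity this mean
    is at least the discretised index of [P], which settles the error of the
    second kind as soon as that index is at least the sum of the two critical
    values. If [P] is compatible, each critical value comes from an upper bound of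
    the mean.
    - The index of compatible masses is nonpositive, so the mean is at most half
      the expected total variation distance between empirical and true masses
      ([expectation_index_le_tv]).
    - The empirical masses can be moved onto a consistent family that has the true
      marginals on all intersections of members. Composing commuting averages does
      this at a cost governed by the sizes of these intersections
      ([norm1_correction], [expectation_correction]). On consistent families the
      index is a maximum over as many linear forms as there are essential facets
      ([facet_dual_class]), so that a maximal inequality costs the logarithm of
      their number ([expectation_index_max]).

    It remains to compare the index of [P] with its discretised index. The averages
    over the cells of a function in [class_G], taken with respect to uniform
    distributions, are admissible, because uniform distributions on cells project
    to uniform distributions on cells ([uniform_proj]). If the density of a law
    oscillates by at most [M] on a cell of volume [V], replacing a function with
    values in an interval of length [s] by its average changes its integral over
    the cell by at most [s / 2 * M * V] in the relevant direction
    ([mixture_sandwich]). By smoothness [M] is at most the mass of the fibre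
    through the cell times [L * \sum_j h j `^ r j], and as a fibre has volume one
    the sum over the cells is at most [s / 2 * L * \sum_j h j `^ r j]
    ([cell_average_bias]). Now [s / 2 <= s - 1] for [2 <= s], and for [s = 1]
    the index of [P] is nonpositive.

    Over an infinite grid the critical values are infinite, whereas indices are at
    most one ([incompat_index_le1]). *)

Set Implicit Arguments.
Unset Strict Implicit.
Unset Printing Implicit Defensive.
Import Order.TTheory GRing.Theory Num.Theory.
Import numFieldNormedType.Exports.

Local Open Scope classical_set_scope.
Local Open Scope ring_scope.

(** * Finite systems of linear inequalities *)

Section fourier_motzkin.
Variable R : realFieldType.

Lemma separating_value (I : finType) (lo up : pred I) (l u : I -> R) :
  (forall i k, lo i -> up k -> l i <= u k) ->
  exists x, (forall i, lo i -> l i <= x) /\ (forall k, up k -> x <= u k).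
Proof.
move=> lu; have [[i0 lo0]|nolo] := pselect (exists i, lo i).
  exists (l [arg max_(i > i0 | lo i) l i]%O); case: arg_maxP => // i loi imax.
  by split=> [j loj|k upk]; [exact: imax|exact: lu].
have [[k0 up0]|noup] := pselect (exists k, up k).
  exists (u [arg min_(k < k0 | up k) u k]%O); case: arg_minP => // k upk kmin.
  by split=> [i loi|j upj]; [case: nolo; exists i|exact: kmin].
by exists 0; split=> [i loi|k upk]; [case: nolo; exists i|case: noup; exists k].
Qed.

(** Elimination of one variable after the other; the point of this form of
    Farkas' lemma is that the list of multipliers does not depend on the right
    hand side, so that solvability amounts to finitely many linear conditions
    on [b]. *)
Lemma finite_farkas_ord n (I : finType) (A : I -> 'I_n -> R) :
  exists Y : seq {ffun I -> R},
    (forall y, y \in Y ->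
      (forall i, 0 <= y i) /\ forall j, \sum_i y i * A i j = 0) /\
    forall b : I -> R, (forall y, y \in Y -> 0 <= \sum_i y i * b i) ->
      exists x : 'I_n -> R, forall i, \sum_j A i j * x j <= b i.
Proof.
elim: n I A => [|n IHn] I A.
  exists [seq [ffun i => (i == i0)%:R] | i0 : I]; split.
    move=> y /mapP[i0 _ ->]; split=> [i|[]//].
    by rewrite ffunE ler0n.
  move=> b bP; exists (fun=> 0) => i; rewrite big_ord0.
  have /bP : [ffun j => (j == i)%:R] \in [seq [ffun i => (i == i0)%:R : R] | i0 : I].
    by apply/mapP; exists i; rewrite ?mem_enum.
  rewrite (bigD1 i)//= big1 ?addr0 ?ffunE ?eqxx ?mul1r// => j ji.
  by rewrite ffunE (negbTE ji) mul0r.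
pose a i := A i ord0.
(* the rows that do not contain the first variable, and the combinations of two
   rows in which it cancels *)
pose m (i' : (I + I * I)%type) : I -> R := match i' with
  | inl i => fun j => ((a i == 0) && (j == i))%:R
  | inr (i, k) => fun j => if (0 < a i) && (a k < 0)
      then (j == i)%:R * - a k + (j == k)%:R * a i else 0 end.
have dirac (F : I -> R) i : \sum_j (j == i)%:R * F j = F i.
  rewrite (bigD1 i)//= eqxx mul1r big1 ?addr0// => j /negbTE->.
  by rewrite mul0r.
have mE (F : I -> R) i' : \sum_j m i' j * F j = match i' with
  | inl i => (a i == 0)%:R * F i
  | inr (i, k) => if (0 < a i) && (a k < 0)
      then - a k * F i + a i * F k else 0 end.
  case: i' => [i|[i k]] /=.
    rewrite -(dirac F i) mulr_sumr; apply: eq_bigr => j _.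
    by rewrite mulrA -natrM mulnb.
  case: ifP => _; last by rewrite big1// => j _; rewrite mul0r.
  rewrite -(dirac F i) -(dirac F k) !mulr_sumr -big_split; apply: eq_bigr => j _.
  by rewrite /= mulrDl !mulrA [_ * - a k]mulrC [_ * a i]mulrC.
have m_ge0 i' j : 0 <= m i' j.
  case: i' => [i|[i k]] /=; first by rewrite ler0n.
  case: ifP => // /andP[i0 k0].
  by rewrite addr_ge0// mulr_ge0 ?ler0n// ?oppr_ge0 ltW.
have ma i' : \sum_j m i' j * a j = 0.
  rewrite mE; case: i' => [i|[i k]].
    by case: eqP => [->|]; rewrite ?mulr0 ?mul0r.
  by case: ifP => // _; rewrite mulrC mulrN addrC mulrC subrr.
have [Y' [Y'P sol']] := IHn _ (fun i' j => \sum_i m i' i * A i (lift ord0 j)).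
pose comb (y : {ffun I + I * I -> R}) := [ffun i => \sum_i' y i' * m i' i].
have combE y F : \sum_i comb y i * F i = \sum_i' y i' * \sum_i m i' i * F i.
  under eq_bigr do rewrite ffunE mulr_suml.
  rewrite exchange_big /=; apply: eq_bigr => i' _.
  by rewrite mulr_sumr; apply: eq_bigr => i _; rewrite mulrA.
exists [seq comb y | y <- Y']; split.
  move=> _ /mapP[y /Y'P[y0 yA] ->]; split=> [i|j].
    by rewrite ffunE sumr_ge0// => i' _; rewrite mulr_ge0.
  rewrite combE; have [j' ->|->] := unliftP ord0 j; first exact: yA.
  by rewrite big1// => i' _; rewrite ma mulr0.
move=> b bP.
have [|x xP] := sol' (fun i' => \sum_i m i' i * b i).
  by move=> y yY'; rewrite -combE bP//; apply/mapP; exists y.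
pose c i := b i - \sum_j A i (lift ord0 j) * x j.
have cP i' : 0 <= \sum_i m i' i * c i.
  under eq_bigr do rewrite mulrBr.
  rewrite sumrB subr_ge0 (le_trans _ (xP i'))//.
  under [leRHS]eq_bigr do rewrite mulr_suml.
  rewrite exchange_big/= ler_sum// => i _.
  by rewrite mulr_sumr ler_sum// => j _; rewrite mulrA.
have [|x0 [x0l x0u]] := @separating_value I (fun i => a i < 0) (fun i => 0 < a i)
    (fun i => c i / a i) (fun i => c i / a i).
  move=> k i k0 i0; have := cP (inr (i, k)); rewrite mE i0 k0 /= => h.
  rewrite ler_pdivlMr// mulrAC ler_ndivrMr//; lra.
exists (fun j => if unlift ord0 j is Some j' then x j' else x0) => i.
rewrite big_ord_recl unlift_none -/(a i).
under eq_bigr do rewrite liftK.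
rewrite -lerBrDr -/(c i); case: (ltgtP (a i) 0) => ai.
- by rewrite mulrC -ler_ndivrMr// x0l.
- by rewrite mulrC -ler_pdivlMr// x0u.
- by have := cP (inl i); rewrite mE ai eqxx mul1r mul0r.
Qed.

Lemma finite_farkas (I J : finType) (A : I -> J -> R) :
  exists Y : seq {ffun I -> R},
    (forall y, y \in Y ->
      (forall i, 0 <= y i) /\ forall j, \sum_i y i * A i j = 0) /\
    forall b : I -> R, (forall y, y \in Y -> 0 <= \sum_i y i * b i) ->
      exists x : J -> R, forall i, \sum_j A i j * x j <= b i.
Proof.
have [Y [YP sol]] := finite_farkas_ord (fun i (j : 'I_#|J|) => A i (enum_val j)).
exists Y; split=> [y /YP[y0 yA]|b /sol[x xP]].
  split=> // j; have := yA (enum_rank j).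
  by under eq_bigr do rewrite enum_rankK.
exists (fun j => x (enum_rank j)) => i; apply: le_trans (xP i).
rewrite (reindex (@enum_val J xpredT))/=; last first.
  by exists enum_rank => j _; rewrite ?enum_valK ?enum_rankK.
by under eq_bigr do rewrite enum_valK.
Qed.

End fourier_motzkin.

(** * Facets of a polyhedron given by finitely many inequalities *)

Section affine_dimension.
Variables (R : realType) (V : vectType R).
Implicit Types (A F : set V).

Definition affinely_independent_points A k : Prop :=
  exists (v0 : V) (v : k.-tuple V),
    [/\ A v0, forall i, A (tnth v i) & free [seq x - v0 | x <- v]].

Lemma affinely_independent_pointsS A k :
  affinely_independent_points A k.+1 -> affinely_independent_points A k.
Proof.
move=> [v0 [v [Av0 Av fr]]]; exists v0, [tuple of behead v]; split=> //.
  by move=> i; rewrite tnth_behead.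
by case: v {Av} fr => -[//|x s] /= _; rewrite free_cons => /andP[].
Qed.

Lemma affinely_independent_points_le A k l : (k <= l)%N ->
  affinely_independent_points A l -> affinely_independent_points A k.
Proof.
elim: l => [|l IHl]; first by rewrite leqn0 => /eqP->.
rewrite leq_eqVlt => /predU1P[->//|kl] /affinely_independent_pointsS.
exact: IHl.
Qed.

Lemma affine_dim_uniq A k l : affine_dim A k -> affine_dim A l -> k = l.
Proof.
move=> [Ak Ak1] [Al Al1]; apply/eqP; rewrite eqn_leq.
apply/andP; split; rewrite leqNgt; apply/negP => h.
  by apply: Al1; exact: affinely_independent_points_le h Ak.
by apply: Ak1; exact: affinely_independent_points_le h Al.
Qed.

(** Moving from [x0] a little way along each vector of a basis of [U] stays in
    [A], and differences of points of [A] stay in [U]. *)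
Lemma affine_dim_vspace A (x0 : V) (U : {vspace V}) : A x0 ->
  (forall x, A x -> x - x0 \in U) ->
  (forall u, u \in U -> exists2 e : R, 0 < e & A (x0 + e *: u)) ->
  affine_dim A (\dim U).
Proof.
move=> Ax0 AU UA; split.
  have /choice[e eP] : forall u : V, exists e : R, u \in U -> 0 < e /\ A (x0 + e *: u).
    move=> u; have [uU|] := boolP (u \in U); last by exists 0.
    by have [e ? ?] := UA u uU; exists e.
  exists x0, [tuple of [seq x0 + e x *: x | x <- vbasis U]]; split=> // [i|].
    rewrite tnth_map; case: (eP (tnth (vbasis U) i)) => //.
    exact/vbasis_mem/mem_tnth.
  have -> : [seq x - x0 | x <- [seq x0 + e x *: x | x <- vbasis U]] =
      [seq e x *: x | x <- vbasis U].
    by rewrite -map_comp; apply: eq_map => x /=; rewrite addrAC subrr add0r.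
  have bU := vbasisP U; have : free (vbasis U) by exact: basis_free bU.
  have : forall x, x \in tval (vbasis U) -> x \in U by move=> x; exact: vbasis_mem.
  elim: (tval (vbasis U)) => [//|x s IHs] sU.
  rewrite !map_cons /= !free_cons => /andP[xs frs].
  have e0 : e x != 0.
    have [|e0 _] := eP x; first exact: (sU _ (mem_head _ _)).
    by rewrite gt_eqF.
  rewrite IHs ?andbT//; last by move=> y ys; rewrite sU// in_cons ys orbT.
  apply: contra xs => /(memvZ (e x)^-1); rewrite scalerA mulVf// scale1r.
  apply: (elimT subvP); apply/span_subvP => _ /mapP[y ys ->].
  by rewrite memvZ// memv_span.
move=> [v0 [v [Av0 Av fr]]].
have : (<<[seq x - v0 | x <- v]>> <= U)%VS.
  apply/span_subvP => _ /mapP[y /tnthP[i ->] ->].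
  have -> : tnth v i - v0 = (tnth v i - x0) - (v0 - x0) by rewrite opprB addrA subrK.
  by rewrite rpredB ?AU.
by move=> /dimvS; rewrite (eqnP fr) size_map size_tuple ltnn.
Qed.

End affine_dimension.

Section polyhedron_facets.
Variables (R : realType) (V : vectType R) (W : {vspace V}) (I : finType).
Variables (psi : I -> 'Hom(V, R^o)) (b : I -> R).

Definition polyhedron : set V :=
  [set w | w \in W /\ forall i, psi i w <= b i].

Definition tight i : set V := polyhedron `&` [set w | psi i w = b i].

(** The length of the step is limited by the slack of the finitely many
    inequalities that are not tight. *)
Lemma polyhedron_open (J : pred I) x u : x \in W -> u \in W ->
  (forall i, ~~ J i -> psi i x < b i) ->
  (forall i, J i -> psi i x <= b i /\ psi i u = 0) ->
  exists2 e : R, 0 < e & polyhedron (x + e *: u).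
Proof.
move=> xW uW nJ Jx.
pose d i : R := if J i then 1 else (b i - psi i x) / (1 + `|psi i u|).
have d0 i : 0 < d i.
  rewrite /d; case: ifPn => // /nJ h.
  by rewrite divr_gt0 ?subr_gt0// ltr_pwDl.
exists (\big[Num.min/1]_i d i).
  by elim/big_ind: _ => // y z y0 z0; rewrite lt_min y0.
set e := \big[_/_]_i _.
have e0 : 0 <= e by rewrite /e; elim/big_ind: _ => // [y z y0 z0|i _];
  [rewrite le_min y0|exact: ltW].
split=> [|i]; first by rewrite rpredD ?memvZ.
rewrite linearD linearZ /=; case: (boolP (J i)) => Ji.
  by have [? ->] := Jx i Ji; rewrite scaler0 addr0.
rewrite -lerBrDl.
have ed : e <= d i by rewrite /e; apply: bigmin_le_cond.
apply: (@le_trans _ _ (e * (1 + `|psi i u|))).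
  by apply: ler_wpM2l => //; apply: le_trans (ler_norm _) _; rewrite lerDr.
by rewrite -ler_pdivlMr ?ltr_pwDl//; apply: le_trans ed _; rewrite /d (negbTE Ji).
Qed.

Variable w0 : V.
Hypothesis w0W : w0 \in W.
Hypothesis w0_interior : forall i, psi i w0 < b i.

Lemma polyhedron_interior x : x \in W -> (forall i, psi i x < b i) -> polyhedron x.
Proof. by move=> xW xb; split=> // i; exact: ltW. Qed.

Lemma affine_dim_polyhedron : affine_dim polyhedron (\dim W).
Proof.
apply: (@affine_dim_vspace _ _ _ w0); first exact: polyhedron_interior.
  by move=> x [xW _]; rewrite rpredB.
by move=> u uW; apply: (@polyhedron_open pred0).
Qed.

Lemma dim_hyperplane i x : x \in W -> psi i x = b i ->
  \dim W = (\dim (W :&: lker (psi i))).+1.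
Proof.
move=> xW xb; rewrite -(limg_ker_dim (psi i) W) -addn1; congr (_ + _)%N.
apply/eqP; rewrite eqn_leq; apply/andP; split.
  by have := dimvS (subvf (psi i @: W)); rewrite dimvf.
rewrite lt0n dimv_eq0; apply/eqP => psiW0.
have : psi i (x - w0) \in (psi i @: W)%VS by rewrite memv_img ?rpredB.
rewrite psiW0 memv0 linearB /= subr_eq0 xb => /eqP h.
by have := w0_interior i; rewrite -h ltxx.
Qed.

(** A point of the facet at which no inequality is tight would be interior, and
    a linear form that is maximal at an interior point is constant; hence some
    inequality is tight on all of the facet, and the dimensions agree. *)
Lemma facet_tight F : facet polyhedron F -> exists i, F = tight i.
Proof.
move=> [[phi [c [phic FE]]] [k [Ak Fk]]].
have dW : \dim W = k.+1 := affine_dim_uniq affine_dim_polyhedron Ak.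
have [[v0 [v [Fv0 Fv fr]]] Fk1] := Fk.
have FA x : F x -> polyhedron x by rewrite FE => -[].
have Fphi x : F x -> phi x = c by rewrite FE => -[].
have [i iP] : exists i, forall x, F x -> psi i x = b i.
  apply: contrapT => /forallNP noi.
  have /choice[y yP] : forall i, exists y, F y /\ psi i y < b i.
    move=> i; apply: contrapT => /forallNP h; apply: (noi i) => x Fx.
    apply/eqP; rewrite eq_le (FA _ Fx).2 /= leNgt; apply/negP => lt.
    by apply: (h x).
  pose N : R := #|I|.+1%:R; have N0 : 0 < N by rewrite ltr0n.
  pose z := N^-1 *: (v0 + \sum_i y i).
  have zW : z \in W.
    by rewrite memvZ// rpredD ?rpred_sum// ?(FA _ Fv0).1// => j _; exact: (FA _ (yP j).1).1.
  have zb j : psi j z < b j.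
    rewrite linearZ /= linearD linear_sum /= /GRing.scale /= ltr_pdivrMl//.
    rewrite /N -natr1 mulrDl mul1r addrC ltr_leD ?ltrD2r//; last exact: (FA _ Fv0).2.
    have -> : #|I|%:R * b j = \sum_(i : I) b j by rewrite sumr_const mulr_natl.
    rewrite (bigD1 j)//= [ltRHS](bigD1 j)//= ltr_leD ?(yP j).2//.
    by rewrite ler_sum// => l _; exact: (FA _ (yP l).1).2.
  have phiz : phi z = c.
    rewrite linearZ /= linearD linear_sum /= /GRing.scale /= Fphi//.
    rewrite (eq_bigr (fun=> c)) => [|l _]; last exact: Fphi (yP l).1.
    by rewrite sumr_const -mulrS -[_ *+ _]mulr_natl mulKf// gt_eqF.
  clearbody z; have phi_le0 u : u \in W -> phi u <= 0.
    move=> uW; have [|//|//|//|e e0] := @polyhedron_open pred0 z u; first exact: zW.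
    move=> /phic; rewrite linearD linearZ /= phiz gerDl => h.
    by rewrite -(pmulr_rle0 _ e0).
  have phi0 u : u \in W -> phi u = 0.
    move=> uW; apply/eqP; rewrite eq_le phi_le0//= -oppr_le0 -linearN phi_le0//.
    by rewrite rpredN.
  suff EA : F = polyhedron by move: Fk1; rewrite EA; apply; case: Ak.
  apply/seteqP; split=> // x Ax; rewrite FE; split=> //=.
  have := phi0 (x - v0); rewrite linearB /= (Fphi _ Fv0) => /(_ _)/eqP.
  by rewrite subr_eq0 => h; apply/eqP/h; rewrite rpredB ?Ax.1 ?(FA _ Fv0).1.
exists i; apply/seteqP; split=> [x Fx|x [Ax xb]]; first by split; [exact: FA|exact: iP].
rewrite FE; split=> //=.
set vs := [seq y - v0 | y <- v] in fr.
have sU : (<<vs>> <= W :&: lker (psi i))%VS.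
  apply/span_subvP => _ /mapP[y /tnthP[l ->] ->].
  rewrite memv_cap rpredB ?(FA _ Fv0).1 ?(FA _ (Fv l)).1//=.
  by rewrite memv_ker linearB /= !iP// subrr.
have : x - v0 \in <<vs>>%VS.
  have /eqP-> : (<<vs>> == W :&: lker (psi i))%VS.
    rewrite eqEdim sU (eqnP fr) size_map size_tuple /=.
    by have := dim_hyperplane (FA _ Fv0).1 (iP _ Fv0); rewrite dW => -[->].
  rewrite memv_cap rpredB ?Ax.1 ?(FA _ Fv0).1//=.
  by rewrite memv_ker linearB /= xb iP// subrr.
move=> xs; have : x - v0 \in lker phi.
  move: xs; apply: (elimT subvP); apply/span_subvP => _ /mapP[y /tnthP[l ->] ->].
  by rewrite memv_ker linearB /= !Fphi// subrr.
by rewrite memv_ker linearB /= (Fphi v0)// subr_eq0 => /eqP.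
Qed.

(** On the segment from an interior point to a point that violates only the
    inequality [i], the point where [i] becomes tight satisfies all the other
    inequalities strictly. *)
Lemma irredundant_facet i z : z \in W -> b i < psi i z ->
  (forall j, j != i -> psi j z <= b j) ->
  (exists2 y, tight i y & forall j, j != i -> psi j y < b j) /\
  facet polyhedron (tight i).
Proof.
move=> zW zi zj; have w0i := w0_interior i.
pose t := (b i - psi i w0) / (psi i z - psi i w0).
have dz : 0 < psi i z - psi i w0 by rewrite subr_gt0 (lt_trans w0i).
have t0 : 0 < t by rewrite divr_gt0// subr_gt0.
have t1 : t < 1 by rewrite ltr_pdivrMr// mul1r ltrD2r.
pose y := w0 + t *: (z - w0).
have yW : y \in W by rewrite rpredD// memvZ// rpredB.
have yi : psi i y = b i.
  rewrite /y linearD linearZ linearB /= /GRing.scale /= /t mulrAC mulfK ?gt_eqF//.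
  by rewrite addrC subrK.
have yj j : j != i -> psi j y < b j.
  move=> ji; rewrite /y linearD linearZ linearB /= /GRing.scale /=.
  have := zj j ji; have := w0_interior j.
  set p := psi j w0; set q := psi j z => pb qb.
  have -> : p + t * (q - p) = (1 - t) * p + t * q by ring.
  have -> : b j = (1 - t) * b j + t * b j by ring.
  by rewrite ltr_leD// ?ltr_pM2l ?subr_gt0// ler_pM2l.
have yA : polyhedron y.
  by split=> // j; have [->|/yj/ltW//] := eqVneq j i; rewrite yi.
split; first by exists y; first by split.
split; first by exists (psi i), (b i); split=> // x [_ ->].
exists (\dim (W :&: lker (psi i))); split.
  by rewrite -(dim_hyperplane yW yi); exact: affine_dim_polyhedron.
apply: (@affine_dim_vspace _ _ _ y) => //.
  move=> x [[xW _] xi]; rewrite memv_cap rpredB//=.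
  by rewrite memv_ker linearB /= xi yi subrr.
move=> u; rewrite memv_cap memv_ker => /andP[uW /eqP ui].
have [//|_ /eqP->|e e0 Ae] := @polyhedron_open (pred1 i) y u yW uW.
  by rewrite yi.
by exists e => //; split=> //=; rewrite linearD linearZ /= ui scaler0 addr0.
Qed.

End polyhedron_facets.

(** * Concentration on finite product spaces *)

Section hoeffding_lemma.
Variable R : realType.

Lemma is_derive_ge0_le (f df : R -> R) (u : R) : 0 <= u ->
  (forall x : R, is_derive x 1 f (df x)) -> (forall x, 0 <= x -> 0 <= df x) ->
  f 0 <= f u.
Proof.
move=> u0 fdf df0; have [|c cu] := MVT_segment u0 (fun x _ => fdf x).
  apply: continuous_subspaceT => x; apply: differentiable_continuous.
  exact/derivable1_diffP/ex_derive.
rewrite subr0 -subr_ge0 => ->; rewrite mulr_ge0// df0//.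
by move: cu; rewrite in_itv /= => /andP[].
Qed.

(** The function [u^2/8 + th u - ln (1 - th + th e^u)] and its derivative
    vanish at [0], and its second derivative is [1/4 - w (1 - w) >= 0] where
    [w = th e^u / (1 - th + th e^u)]. *)
Lemma bernoulli_mgf (th u : R) : 0 <= th <= 1 -> 0 <= u ->
  1 - th + th * expR u <= expR (th * u + u ^+ 2 / 8).
Proof.
move=> /andP[th0 th1] u0.
pose D (x : R) : R := 1 - th + th * expR x.
have D0 x : 0 < D x.
  rewrite /D; have [->|thn] := eqVneq th 1; first by rewrite subrr add0r mul1r expR_gt0.
  by rewrite ltr_pwDl ?subr_gt0 ?lt_neqAle ?thn// mulr_ge0 ?expR_ge0.
have dD (x : R) : is_derive x 1 D (th * expR x).
  have -> : D = cst (1 - th) + th \*: expR by apply/funext.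
  have := is_deriveD (is_derive_cst (1 - th) x 1) (is_deriveZ th (is_derive_expR x)).
  by rewrite add0r.
have w_le (x : R) : 0 <= x -> th * expR x / D x <= th + x / 4.
  move=> x0; rewrite -subr_ge0.
  pose v (y : R) : R := th + y / 4 - 1 + (1 - th) / D y.
  have vE y : th + y / 4 - th * expR y / D y = v y.
    have Dn : D y != 0 by rewrite gt_eqF.
    apply: (mulIf Dn).
    rewrite /v !(mulrDl, mulrBl) !mulNr !divfK//; rewrite /D; lra.
  rewrite vE; have v0 : v 0 = 0.
    by rewrite -vE /D expR0 mulr1 subrK divr1 mul0r addr0 subrr.
  suff: v 0 <= v x by rewrite v0.
  apply: (@is_derive_ge0_le v
      (fun y : R => 4^-1 - (1 - th) * (th * expR y) / D y ^+ 2) x x0) => y.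
    have -> : v = cst (th - 1) + 4^-1 \*: id + (1 - th) \*: (fun y => (D y)^-1).
      apply/funext => z; rewrite /v !fctE /GRing.scale /= [z / 4]mulrC; congr (_ + _).
      by rewrite addrAC.
    have dDV : is_derive y 1 (fun y => (D y)^-1) (- (D y) ^- 2 *: (th * expR y)).
      by apply: is_deriveV; rewrite gt_eqF.
    have := is_deriveD (is_deriveD (is_derive_cst (th - 1) y 1)
      (is_deriveZ 4^-1 (is_derive_id y 1))) (is_deriveZ (1 - th) dDV).
    move=> /is_derive_eq; apply; rewrite add0r /GRing.scale /= mulr1; congr (_ + _).
    by rewrite mulNr mulrN mulrAC mulrA.
  move=> _; rewrite subr_ge0 ler_pdivrMr ?exprn_gt0//.
  rewrite /D; have := sqr_ge0 (1 - th - th * expR y).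
  set e := th * _; rewrite !expr2; lra.
pose h (x : R) : R := x ^+ 2 / 8 + th * x - ln (D x).
have h0 : h 0 = 0.
  by rewrite /h /D expR0 mulr1 subrK ln1 mulr0 expr2 !mul0r addr0 subrr.
have : h 0 <= h u.
  apply: (@is_derive_ge0_le h (fun x : R => x / 4 + th - th * expR x / D x) u u0).
    move=> x.
    have -> : h = (8^-1 \*: (id * id) + th \*: id) - (@ln R \o D).
      apply/funext => z; rewrite /h !fctE /GRing.scale /= expr2.
      by congr (_ + _ - _); rewrite mulrC.
    have dln : is_derive x 1 (@ln R \o D) ((D x)^-1 * (th * expR x)).
      by apply: is_derive1_comp; exact: is_derive1_ln.
    have dx := is_derive_id x (1 : R^o).
    have := is_deriveB (is_deriveD (is_deriveZ 8^-1 (is_deriveM dx dx))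
      (is_deriveZ th dx)) dln.
    move=> /is_derive_eq; apply; rewrite /GRing.scale /= !mulr1.
    by congr (_ + _ - _); [field|rewrite mulrC].
  by move=> x x0; rewrite subr_ge0 addrC w_le.
rewrite h0 /h subr_ge0 -ler_expR lnK ?posrE ?D0// => /le_trans; apply.
by rewrite addrC.
Qed.

(** The graph of [expR] lies above its tangent at [p * a + q * b]. *)
Lemma expR_convex (p q a b : R) : 0 <= p -> 0 <= q -> p + q = 1 ->
  expR (p * a + q * b) <= p * expR a + q * expR b.
Proof.
move=> p0 q0 pq1; set x := p * a + q * b.
have tangent y : expR x * (1 + (y - x)) <= expR y.
  by rewrite -ler_pdivlMl ?expR_gt0// -expRN -expRD [- x + y]addrC expR_ge1Dx.
apply: le_trans (lerD (ler_wpM2l p0 (tangent a)) (ler_wpM2l q0 (tangent b))).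
rewrite le_eqVlt; apply/orP; left; apply/eqP.
have -> : p = 1 - q by rewrite -pq1 addrK.
by rewrite /x -[in p * a](addrK q p) pq1; ring.
Qed.

(** Replacing [expR] by its chord over the range of [g] leaves a variable with
    two values, to which [bernoulli_mgf] applies. *)
Lemma hoeffding_mgf (T : finType) (p g : T -> R) (D : pred T) (a c l : R) :
  (forall t, 0 <= p t) -> \sum_t p t = 1 -> (forall t, ~~ D t -> p t = 0) ->
  (forall t, D t -> a <= g t <= a + c) -> 0 <= l ->
  \sum_t p t * expR (l * g t)
    <= expR (l * (\sum_t p t * g t) + l ^+ 2 * c ^+ 2 / 8).
Proof.
move=> p0 p1 pD gac l0; set m := \sum_t p t * g t.
have c0 : 0 <= c.
  have [[t Dt]|noD] := pselect (exists t, D t).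
    by have /andP[ag ga] := gac t Dt; have := le_trans ag ga; rewrite lerDl.
  have : \sum_t p t = 0.
    by rewrite big1// => t _; apply: pD; apply/negP => Dt; apply: noD; exists t.
  by rewrite p1 => /eqP; rewrite oner_eq0.
have le_sum (u v : T -> R) : (forall t, D t -> u t <= v t) ->
    \sum_t p t * u t <= \sum_t p t * v t.
  move=> uv; rewrite ler_sum// => t _; have [Dt|/pD->] := boolP (D t).
    by rewrite ler_wpM2l ?p0 ?uv.
  by rewrite !mul0r.
have sum_cst (x : R) : \sum_t p t * x = x by rewrite -mulr_suml p1 mul1r.
have am : a <= m by rewrite -[a]sum_cst le_sum// => t /gac/andP[].
have mac : m <= a + c by rewrite -[leRHS]sum_cst le_sum// => t /gac/andP[].
have [c00|cn0] := eqVneq c 0.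
  have gm t : D t -> g t = m.
    move=> /gac; rewrite c00 addr0 => /andP[h1 h2]; apply/eqP.
    by rewrite eq_le (le_trans h2)//= (le_trans _ h1)// (le_trans mac)// c00 addr0.
  rewrite c00 expr0n /= mulr0 mul0r addr0 -[leRHS]sum_cst.
  by rewrite le_sum// => t /gm->.
have cp : 0 < c by rewrite lt_neqAle eq_sym cn0.
pose th := (m - a) / c.
have th01 : 0 <= th <= 1.
  by rewrite /th divr_ge0 ?subr_ge0//= ler_pdivrMr// mul1r lerBlDl.
have chord t : D t -> expR (l * g t) <=
    (1 - (g t - a) / c) * expR (l * a) + (g t - a) / c * expR (l * (a + c)).
  move=> /gac/andP[h1 h2]; set q := (g t - a) / c.
  have q0 : 0 <= q by rewrite divr_ge0 ?subr_ge0.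
  have q1 : 0 <= 1 - q by rewrite subr_ge0 ler_pdivrMr// mul1r lerBlDl.
  have -> : l * g t = (1 - q) * (l * a) + q * (l * (a + c)).
    have -> : g t = a + q * c by rewrite /q divfK// addrC subrK.
    by ring.
  by apply: expR_convex => //; rewrite subrK.
apply: le_trans (le_sum _ _ chord) _.
have -> : \sum_t p t * ((1 - (g t - a) / c) * expR (l * a) +
      (g t - a) / c * expR (l * (a + c)))
    = (1 - th) * expR (l * a) + th * expR (l * (a + c)).
  have lin (v : T -> R) x : \sum_t p t * (v t * x) = (\sum_t p t * v t) * x.
    by rewrite mulr_suml; apply: eq_bigr => t _; rewrite mulrA.
  have thE : \sum_t p t * ((g t - a) / c) = th.
    rewrite (lin (fun t => g t - a)) /th; congr (_ / _).
    under eq_bigr do rewrite mulrBr.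
    by rewrite sumrB sum_cst.
  under eq_bigr do rewrite mulrDr.
  rewrite big_split /= (lin _ (expR (l * a))) (lin _ (expR (l * (a + c)))) thE.
  congr (_ * _ + _).
  under eq_bigr do rewrite mulrBr mulr1.
  by rewrite sumrB p1 thE.
have -> : (1 - th) * expR (l * a) + th * expR (l * (a + c)) =
    expR (l * a) * (1 - th + th * expR (l * c)) by rewrite mulrDr expRD; ring.
apply: le_trans (ler_wpM2l (expR_ge0 _) (bernoulli_mgf th01 (mulr_ge0 l0 c0))) _.
rewrite -expRD ler_expR exprMn.
have -> : m = a + th * c by rewrite /th divfK// addrC subrK.
by rewrite le_eqVlt; apply/orP; left; apply/eqP; ring.
Qed.

End hoeffding_lemma.

Section product_expectation.
Variables (R : realType) (J T : finType) (pi : J -> T -> R).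
Implicit Types (y : {ffun J -> T}) (F G : {ffun J -> T} -> R).

Definition update y j t : {ffun J -> T} := [ffun k => if k == j then t else y k].

(** The mean over the coordinates in [s], the others being frozen at those of
    [y]: a conditional expectation. *)
Fixpoint iterated_mean (s : seq J) F y : R :=
  if s is j :: s' then \sum_t pi j t * iterated_mean s' F (update y j t) else F y.

Definition expectation F : R := \sum_(y : {ffun J -> T}) (\prod_j pi j (y j)) * F y.

Lemma iterated_meanE s F y0 : uniq s -> iterated_mean s F y0 =
  \sum_(y : {ffun J -> T}) (\prod_(j <- s) pi j (y j)) * [forall k, (k \in s) || (y k == y0 k)]%:R * F y.
Proof.
elim: s y0 => [|j s IHs] y0 /=.
  move=> _; rewrite (bigD1 y0)//= big_nil (_ : [forall k, _] = true) ?mul1r; last first.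
    by apply/forallP => k; rewrite eqxx.
  rewrite big1 ?addr0// => y /eqP yy0.
  rewrite (_ : [forall k, _] = false) ?mulr0 ?mul0r//.
  by apply/negP => /forallP h; apply: yy0; apply/ffunP => k; exact/eqP/(h k).
move=> /andP[js us].
under eq_bigr do rewrite IHs// mulr_sumr.
rewrite exchange_big/=; apply: eq_bigr => y _.
rewrite (bigD1 (y j))//= [X in _ + X]big1 ?addr0.
  rewrite big_cons !mulrA; congr (_ * _%:R * _); congr nat_of_bool.
  apply/eq_forallb => k; rewrite in_cons ffunE; case: (eqVneq k j) => [->|//].
  by rewrite eqxx orbT.
move=> t tj; rewrite (_ : [forall k, _] = false) ?mulr0 ?mul0r ?mulr0//.
apply/negP => /forallP/(_ j); rewrite (negbTE js) ffunE eqxx /=.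
by rewrite eq_sym (negbTE tj).
Qed.

Lemma expectationE F y0 : expectation F = iterated_mean (enum J) F y0.
Proof.
rewrite iterated_meanE ?enum_uniq//; apply: eq_bigr => y _.
rewrite big_enum /= (_ : [forall k, _] = true) ?mulr1//.
by apply/forallP => k; rewrite mem_enum.
Qed.

Hypothesis pi_ge0 : forall j t, 0 <= pi j t.
Hypothesis pi_sum1 : forall j, \sum_t pi j t = 1.

Lemma sum_pi_cst j (x : R) : \sum_t pi j t * x = x.
Proof. by rewrite -mulr_suml pi_sum1 mul1r. Qed.

Lemma expectation_cst x : expectation (fun=> x) = x.
Proof.
rewrite /expectation -mulr_suml -(bigA_distr_bigA (fun j t => pi j t)) /=.
by rewrite big1 ?mul1r.
Qed.

Lemma expectationD F G : expectation (fun y => F y + G y) = expectation F + expectation G.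
Proof. by rewrite -big_split; apply: eq_bigr => y _; rewrite mulrDr. Qed.

Lemma expectationZ a F : expectation (fun y => a * F y) = a * expectation F.
Proof. by rewrite mulr_sumr; apply: eq_bigr => y _; rewrite mulrCA. Qed.

Lemma expectationN F : expectation (fun y => - F y) = - expectation F.
Proof. by rewrite -sumrN; apply: eq_bigr => y _; rewrite mulrN. Qed.

Lemma expectation_sum (I : Type) (r : seq I) (Q : pred I) (F : I -> {ffun J -> T} -> R) :
  expectation (fun y => \sum_(i <- r | Q i) F i y) = \sum_(i <- r | Q i) expectation (F i).
Proof.
by rewrite exchange_big /=; apply: eq_bigr => y _; rewrite mulr_sumr.
Qed.

Lemma prod_pi_ge0 y : 0 <= \prod_j pi j (y j).
Proof. exact: prodr_ge0. Qed.

Lemma le_expectation F G : (forall y, F y <= G y) -> expectation F <= expectation G.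
Proof. by move=> FG; apply: ler_sum => y _; rewrite ler_wpM2l ?prod_pi_ge0. Qed.

Lemma expectation_ge0 F : (forall y, 0 <= F y) -> 0 <= expectation F.
Proof. by move=> F0; apply: sumr_ge0 => y _; rewrite mulr_ge0 ?prod_pi_ge0. Qed.

Lemma expectation_coord j (g : T -> R) :
  expectation (fun y => g (y j)) = \sum_t pi j t * g t.
Proof.
transitivity (\sum_(y : {ffun J -> T}) \prod_k (pi k (y k) * (if k == j then g (y k) else 1))).
  apply: eq_bigr => y _; rewrite big_split /=; congr (_ * _).
  by rewrite -big_mkcond big_pred1_eq.
rewrite -(bigA_distr_bigA (fun k t => pi k t * (if k == j then g t else 1))) /=.
rewrite (bigD1 j)//= eqxx [X in _ * X]big1 ?mulr1// => k kj.
by rewrite (negbTE kj) sum_pi_cst.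
Qed.

Lemma expectation_le_sqrt F v : expectation (fun y => F y ^+ 2) <= v ->
  expectation F <= Num.sqrt v.
Proof.
move=> Fv; apply: le_trans (ler_norm _) _; rewrite -sqrtr_sqr ler_wsqrtr//.
apply: le_trans Fv; rewrite -subr_ge0; set m := expectation F.
have -> : expectation (fun y => F y ^+ 2) - m ^+ 2 =
    expectation (fun y => (F y - m) ^+ 2).
  have -> : expectation (fun y => (F y - m) ^+ 2) =
      expectation (fun y => (F y ^+ 2 + (- 2 * m) * F y) + m ^+ 2).
    by apply: eq_bigr => y _; congr (_ * _); ring.
  by rewrite !expectationD expectationZ expectation_cst -/m; ring.
by apply: expectation_ge0 => y; exact: sqr_ge0.
Qed.

(** Centred functions of different coordinates are orthogonal. *)
Lemma expectation_sqr_sum (a : J -> T -> R) :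
  (forall j, \sum_t pi j t * a j t = 0) ->
  expectation (fun y => (\sum_j a j (y j)) ^+ 2) = \sum_j \sum_t pi j t * a j t ^+ 2.
Proof.
move=> a0.
have cross j k : j != k -> expectation (fun y => a j (y j) * a k (y k)) = 0.
  move=> jk; transitivity (\sum_(y : {ffun J -> T}) \prod_i (pi i (y i) *
      (if i == j then a i (y i) else if i == k then a i (y i) else 1))).
    apply: eq_bigr => y _; rewrite big_split /=; congr (_ * _).
    rewrite (bigD1 j)//= eqxx; congr (_ * _); rewrite (bigD1 k)/=; last by rewrite eq_sym.
    rewrite eq_sym (negbTE jk) eqxx big1 ?mulr1// => i /andP[/negbTE-> /negbTE->].
    by [].
  rewrite -(bigA_distr_bigA (fun i t => pi i t *
    (if i == j then a i t else if i == k then a i t else 1))) /=.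
  by rewrite (bigD1 j)//= eqxx a0; exact: mul0r.
transitivity (\sum_j \sum_k expectation (fun y => a j (y j) * a k (y k))).
  under [RHS]eq_bigr do rewrite exchange_big /=.
  rewrite exchange_big /=; apply: eq_bigr => y _.
  rewrite expr2 mulr_suml mulr_sumr; apply: eq_bigr => j _.
  by rewrite !mulr_sumr.
apply: eq_bigr => j _; rewrite (bigD1 j)//= [X in _ + X]big1 ?addr0.
  by rewrite -expectation_coord; apply: eq_bigr => y _; rewrite expr2.
by move=> k kj; rewrite cross// eq_sym.
Qed.

Variable D : J -> pred T.
Hypothesis pi_supp : forall j t, ~~ D j t -> pi j t = 0.

Definition bounded_differences F (c : J -> R) :=
  forall y j t t', D j t -> D j t' -> F (update y j t) - F (update y j t') <= c j.

Lemma le_expectation_supp F G :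
  (forall y, (forall j, D j (y j)) -> F y <= G y) -> expectation F <= expectation G.
Proof.
move=> FG; apply: ler_sum => y _; have [Dy|] := boolP [forall j, D j (y j)].
  by rewrite ler_wpM2l ?prod_pi_ge0// FG//; exact/forallP.
by rewrite negb_forall => /existsP[j /pi_supp pj]; rewrite (bigD1 j)//= pj !mul0r.
Qed.

Lemma updateC y j k t u : j != k ->
  update (update y j t) k u = update (update y k u) j t.
Proof.
move=> jk; apply/ffunP => i; rewrite !ffunE; case: eqVneq => [->|//].
by rewrite eq_sym (negbTE jk).
Qed.

Lemma iterated_mean_differences s F c : bounded_differences F c ->
  forall y j t t', j \notin s -> D j t -> D j t' ->
  iterated_mean s F (update y j t) - iterated_mean s F (update y j t') <= c j.
Proof.
move=> Fc; elim: s => [|k s IHs] y j t t'; first by move=> _; exact: Fc.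
rewrite in_cons negb_or => /andP[jk js] Dt Dt' /=.
rewrite -sumrB -[leRHS](sum_pi_cst k) ler_sum// => u _.
by rewrite -mulrBr ler_wpM2l// !(updateC _ _ _ jk) IHs.
Qed.

(** Integrating out one coordinate multiplies the moment generating function by
    the factor of [hoeffding_mgf], since conditional means inherit the bounded
    differences. *)
Lemma mcdiarmid_mgf F c l y : bounded_differences F c -> 0 <= l ->
  forall s, uniq s ->
  iterated_mean s (fun z => expR (l * F z)) y
    <= expR (l * iterated_mean s F y + l ^+ 2 * (\sum_(j <- s) c j ^+ 2) / 8).
Proof.
move=> Fc l0 s; elim: s y => [|j s IHs] y /=.
  by rewrite big_nil mulr0 mul0r addr0.
move=> /andP[js us]; set g := fun t => iterated_mean s F (update y j t).
pose K := l ^+ 2 * (\sum_(k <- s) c k ^+ 2) / 8.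
apply: (@le_trans _ _ (\sum_t pi j t * expR (l * g t) * expR K)).
  by apply: ler_sum => t _; rewrite -mulrA -expRD ler_wpM2l ?IHs.
have [[t0 Dt0]|noD] := pselect (exists t, D j t); last first.
  have : \sum_t pi j t = 0.
    by rewrite big1// => t _; apply: pi_supp; apply/negP => Dt; apply: noD; exists t.
  by rewrite pi_sum1 => /eqP; rewrite oner_eq0.
pose tm := [arg min_(t < t0 | D j t) g t]%O.
have [Dtm tm_min] : D j tm /\ forall t, D j t -> g tm <= g t.
  by rewrite /tm; case: arg_minP => // i Di imin; split.
rewrite -mulr_suml.
have gD t : D j t -> g tm <= g t <= g tm + c j.
  by move=> Dt; rewrite tm_min//= -lerBlDl (iterated_mean_differences Fc).
apply: le_trans (ler_wpM2r (expR_ge0 _)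
  (hoeffding_mgf (pi_ge0 j) (pi_sum1 j) (@pi_supp j) gD l0)) _.
rewrite -expRD ler_expR big_cons -addrA lerD2l /K.
by rewrite le_eqVlt; apply/orP; left; apply/eqP; ring.
Qed.

Lemma expectation_mgf F c l V : bounded_differences F c -> 0 <= l ->
  \sum_j c j ^+ 2 <= V ->
  expectation (fun y => expR (l * (F y - expectation F))) <= expR (l ^+ 2 * V / 8).
Proof.
move=> Fc l0 cV.
have [y0|noy] := pselect (exists y : {ffun J -> T}, True); last first.
  rewrite /expectation big1 ?expR_ge0// => y _.
  by case: noy; exists y.
case: y0 => y0 _; set m := expectation F.
have -> : expectation (fun y => expR (l * (F y - m)))
    = expR (- (l * m)) * expectation (fun y => expR (l * F y)).
  by rewrite -expectationZ; apply: eq_bigr => y _; rewrite -expRD; congr (_ * expR _); ring.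
rewrite -ler_pdivlMl ?expR_gt0// -expRN opprK -expRD.
rewrite (expectationE _ y0) {1}/m (expectationE F y0).
apply: le_trans (mcdiarmid_mgf y0 Fc l0 (enum_uniq J)) _.
rewrite ler_expR lerD2l ler_pM2r ?invr_gt0// ler_wpM2l ?sqr_ge0//.
by rewrite big_enum.
Qed.

(** Markov's inequality for [expR (l * F)]; the exponent [l ^+ 2 * V / 8 - l * t]
    is minimal at [l = 4 * t / V]. *)
Lemma mcdiarmid F c V t : bounded_differences F c -> 0 < V ->
  \sum_j c j ^+ 2 <= V -> 0 <= t ->
  expectation (fun y => (expectation F + t <= F y)%R%:R) <= expR (- (2 * t ^+ 2 / V)).
Proof.
move=> Fc V0 cV t0; pose l := 4 * t / V.
have l0 : 0 <= l by rewrite divr_ge0 ?mulr_ge0// ltW.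
have mgf := expectation_mgf Fc l0 cV.
apply: (@le_trans _ _ (expR (- (l * t)) * expR (l ^+ 2 * V / 8))); last first.
  rewrite -expRD ler_expR le_eqVlt; apply/orP; left; apply/eqP; rewrite /l.
  by field; rewrite gt_eqF.
apply: le_trans (ler_wpM2l (expR_ge0 _) mgf).
rewrite -expectationZ; apply: le_expectation => y.
rewrite -expRD; case: (leP _ (F y)) => [h|_]; last exact: expR_ge0.
rewrite -[leLHS]expR0 ler_expR addrC subr_ge0 ler_wpM2l//.
by rewrite lerBrDl.
Qed.

End product_expectation.

(** * Averages over the fibres of a product space *)

Section sums.
Variable R : realFieldType.

Lemma sqr_sum_le (I : finType) (Q : pred I) (a : I -> R) :
  (\sum_(i | Q i) a i) ^+ 2 <= #|Q|%:R * \sum_(i | Q i) a i ^+ 2.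
Proof.
have -> : #|Q|%:R * \sum_(i | Q i) a i ^+ 2 =
    \sum_(i | Q i) \sum_(j | Q j) 2^-1 * (a i ^+ 2 + a j ^+ 2).
  under [RHS]eq_bigr do rewrite -mulr_sumr big_split /= sumr_const.
  rewrite -mulr_sumr big_split /= sumr_const sumrMnl.
  by set S := \sum_(i | _) _; rewrite -[S *+ _]mulr_natl; lra.
rewrite expr2 mulr_suml ler_sum// => i _; rewrite mulr_sumr ler_sum// => j _.
by have := sqr_ge0 (a i - a j); rewrite !expr2; lra.
Qed.

End sums.

Section fibre_averages.
Variables (R : realType) (I : finType) (n : I -> nat).
Let K : finType := {dffun forall i : I, 'I_(n i)}.
Implicit Types (A B : pred I) (x y z : K) (a b : K -> R).

Definition agree_on A x y : bool := [forall i, A i ==> (x i == y i)].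

Lemma agree_onP A x y : reflect (forall i, A i -> x i = y i) (agree_on A x y).
Proof. by apply: (iffP forall_inP) => h i /h/eqP. Qed.

Lemma agree_on_sym A x y : agree_on A x y = agree_on A y x.
Proof. by apply/eq_forallb => i; rewrite eq_sym. Qed.

Lemma agree_on_refl A x : agree_on A x x.
Proof. exact/agree_onP. Qed.

Lemma agree_on_trans A : transitive (agree_on A).
Proof.
by move=> y x z /agree_onP xy /agree_onP yz; apply/agree_onP => i Ai; rewrite xy ?yz.
Qed.

Lemma agree_on_left A x y z : agree_on A x y -> agree_on A x z = agree_on A y z.
Proof.
move=> xy; apply/idP/idP; last exact: agree_on_trans xy.
by rewrite agree_on_sym in xy; exact: agree_on_trans xy.
Qed.

Definition fibre_card A x : nat := #|[pred y | agree_on A x y]|.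

Lemma fibre_card_gt0 A x : (0 < fibre_card A x)%N.
Proof. by apply/card_gt0P; exists x; rewrite inE agree_on_refl. Qed.

(** An involution that exchanges the points agreeing with [x] on [A] and those
    agreeing with [y] on [A], for all [A] at once; hence fibres have the same
    size, and averages commute. *)
Definition swap x y z : K := [ffun i => tperm (x i) (y i) (z i)].

Lemma swapK x y : involutive (swap x y).
Proof. by move=> z; apply/ffunP => i; rewrite !ffunE tpermK. Qed.

Lemma agree_on_swapl A x y z : agree_on A x (swap x y z) = agree_on A y z.
Proof.
apply/eq_forallb => i; case: (A i) => //=; rewrite ffunE.
by apply/eqP/eqP => [xi|<-]; [rewrite -[z i](tpermK (x i) (y i)) -xi tpermL|rewrite tpermR].
Qed.

Lemma agree_on_swapr A x y z : agree_on A y (swap x y z) = agree_on A x z.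
Proof.
apply/eq_forallb => i; case: (A i) => //=; rewrite ffunE.
by apply/eqP/eqP => [yi|<-]; [rewrite -[z i](tpermK (x i) (y i)) -yi tpermR|rewrite tpermL].
Qed.

Lemma fibre_cardE A x y : fibre_card A x = fibre_card A y.
Proof.
rewrite /fibre_card -!sum1_card (reindex_inj (inv_inj (swapK x y))).
by apply: eq_bigl => z; rewrite !inE agree_on_swapl.
Qed.

Definition average A a x : R :=
  (fibre_card A x)%:R^-1 * \sum_(y | agree_on A x y) a y.

Lemma fibre_card_neq0 A x : (fibre_card A x)%:R != 0 :> R.
Proof. by rewrite pnatr_eq0 -lt0n fibre_card_gt0. Qed.

Lemma eq_average A a b : a =1 b -> average A a =1 average A b.
Proof. by move=> ab x; congr (_ * _); apply: eq_bigr. Qed.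

Lemma averageB A a b x : average A (fun y => a y - b y) x = average A a x - average A b x.
Proof. by rewrite /average sumrB mulrBr. Qed.

Lemma averageD A a b x : average A (fun y => a y + b y) x = average A a x + average A b x.
Proof. by rewrite /average big_split mulrDr. Qed.

Lemma average_agree A a x y : agree_on A x y -> average A a x = average A a y.
Proof.
move=> xy; rewrite /average (fibre_cardE A x y); congr (_ * _).
by apply: eq_bigl => z; exact: agree_on_left.
Qed.

Lemma sum_average A a x :
  \sum_(y | agree_on A x y) average A a y = \sum_(y | agree_on A x y) a y.
Proof.
rewrite (eq_bigr (fun=> average A a x)) => [|y xy]; last exact/esym/average_agree.
by rewrite sumr_const -mulr_natl mulrA mulfV ?mul1r ?fibre_card_neq0.
Qed.

Lemma average_idem A a x : average A (average A a) x = average A a x.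
Proof. by rewrite {1}/average sum_average. Qed.

(** The kernels of both compositions count the points which agree with one
    argument on [A] and with the other on [B]; the swap exchanges the roles. *)
Lemma averageC A B a x : average A (average B a) x = average B (average A a) x.
Proof.
have kernel A' B' : average A' (average B' a) x =
    (fibre_card A' x)%:R^-1 * (fibre_card B' x)%:R^-1 *
    \sum_z a z * #|[pred y | agree_on A' x y && agree_on B' z y]|%:R.
  rewrite /average -mulrA; congr (_ * _); rewrite mulr_sumr.
  under eq_bigr => y _ do rewrite (fibre_cardE B' y x) mulr_sumr big_mkcond /=.
  rewrite exchange_big /=; apply: eq_bigr => z _.
  rewrite -big_mkcondr /= sumr_const mulrA -[LHS]mulr_natr; congr (_ * _%:R).
  by apply: eq_card => y; rewrite !unfold_in /= [agree_on B' y z]agree_on_sym.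
rewrite !kernel; congr (_ * _); first exact: mulrC.
apply: eq_bigr => z _; congr (_ * _%:R).
rewrite -!sum1_card (reindex_inj (inv_inj (swapK x z))).
by apply: eq_bigl => y; rewrite !inE agree_on_swapl agree_on_swapr andbC.
Qed.

Lemma average_selfadjoint A a b : \sum_x average A a x * b x = \sum_x a x * average A b x.
Proof.
rewrite /average; under eq_bigr do rewrite mulr_sumr mulr_suml big_mkcond /=.
rewrite exchange_big /=; apply: eq_bigr => y _.
rewrite -big_mkcond /= !mulr_sumr; apply: eq_big => [x|x xy]; first exact: agree_on_sym.
by rewrite (fibre_cardE A x y); ring.
Qed.

Lemma average_sqr A a : \sum_x a x * average A a x = \sum_x average A a x ^+ 2.
Proof.
by under [RHS]eq_bigr do rewrite expr2; rewrite average_selfadjoint;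
  apply: eq_bigr => x _; rewrite average_idem.
Qed.

(** The part of [a] with vanishing marginals on all the members of [s]. *)
Definition residual (s : seq (pred I)) a : K -> R :=
  foldr (fun A b x => b x - average A b x) a s.

Lemma average_residual A s a x : average A (residual s a) x = residual s (average A a) x.
Proof.
elim: s x => //= B s IHs x; rewrite averageB averageC IHs; congr (_ - _).
by apply: eq_average => y; exact: IHs.
Qed.

Lemma average_residual0 A s a x : A \in s -> average A (residual s a) x = 0.
Proof.
elim: s x => //= B s IHs x; rewrite in_cons => /predU1P[->|As].
  by rewrite averageB average_idem subrr.
rewrite averageB averageC IHs// (eq_average B (fun y => IHs y As)).
by rewrite /average big1 ?mulr0 ?subrr.
Qed.

Lemma residual_contraction s a : \sum_x residual s a x ^+ 2 <= \sum_x a x ^+ 2.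
Proof.
elim: s => //= A s IHs; apply: le_trans IHs; set w := residual s a.
have -> : \sum_x (w x - average A w x) ^+ 2 =
    \sum_x w x ^+ 2 - \sum_x average A w x ^+ 2.
  transitivity (\sum_x (w x ^+ 2 - 2 * (w x * average A w x) + average A w x ^+ 2)).
    by apply: eq_bigr => x _; ring.
  by rewrite big_split /= sumrB -mulr_sumr average_sqr; ring.
by rewrite gerBl sumr_ge0// => x _; exact: sqr_ge0.
Qed.

(** Subtracting the residual keeps the marginals on the members of [s], but
    leaves a function that is controlled by these marginals alone. *)
Definition correction s a x : R := a x - residual s a x.

Lemma average_correction A s a x : A \in s -> average A (correction s a) x = average A a x.
Proof. by move=> As; rewrite averageB average_residual0// subr0. Qed.

(** One average after the other is removed. As the previous removals do not
    increase the Euclidean norm and commute with the average, the Cauchy-Schwarz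
    inequality bounds each removed part by an average of [a] itself. *)
Lemma norm1_correction s a : \sum_x `|correction s a x| <=
  \sum_(A <- s) Num.sqrt (#|K|%:R * \sum_x average A a x ^+ 2).
Proof.
elim: s => [|A s IHs].
  by rewrite big_nil big1// => x _; rewrite /correction /= subrr normr0.
rewrite big_cons; set w := residual s a.
apply: (@le_trans _ _ (\sum_x `|average A w x| + \sum_x `|correction s a x|)).
  rewrite -big_split ler_sum// => x _ /=.
  rewrite (_ : correction _ _ _ = average A w x + correction s a x) ?ler_normD//.
  by rewrite /correction /= opprB addrCA.
rewrite lerD//; apply: (@le_trans _ _ (Num.sqrt ((\sum_x `|average A w x|) ^+ 2))).
  by rewrite sqrtr_sqr ler_norm.
rewrite ler_wsqrtr//; apply: le_trans (sqr_sum_le _ _) _.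
rewrite ler_wpM2l ?ler0n//.
under eq_bigr do rewrite real_normK ?num_real// average_residual.
exact: residual_contraction.
Qed.

End fibre_averages.

(** * The incompatibility index on a finite grid *)

Section discrete_index.
Variables (R : realType) (d : nat) (N : 'I_d -> nat) (SS : {set {set 'I_d}}).
Hypothesis N_gt0 : forall j, (0 < N j)%N.
Hypothesis SS_gt0 : (0 < #|SS|)%N.

Notation K := (grid N (@id 'I_d)).
Notation T := (mass_coord N SS).
Notation s := (#|SS|%:R : R).
Notation point S k := (Tagged (fun S0 : member SS => grid_of N (val S0)) (i := S) k).
Implicit Types (q w f : T -> R) (p : K -> R).

Definition restrict (S : {set 'I_d}) (x : K) : grid_of N S :=
  [ffun i : idx S => x (val i)].

Definition coord (x : K) (S : member SS) : T := point S (restrict (val S) x).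

Definition marginal_at p (t : T) : R := \sum_(x | coord x (tag t) == t) p x.

Definition mass w (S : member SS) : R := \sum_(k : grid_of N (val S)) w (point S k).

Definition discrete_index w f : R := - (s^-1 * \sum_t w t * f t).

Definition admissible f : Prop :=
  (forall t, - 1 <= f t) /\ forall x : K, 0 <= \sum_S f (coord x S).

Lemma s_gt0 : 0 < s. Proof. by rewrite ltr0n. Qed.

Lemma card_member : #|member SS| = #|SS|.
Proof. by rewrite card_sig. Qed.

Lemma sum_mass_coord (F : T -> R) :
  \sum_t F t = \sum_(S : member SS) \sum_(k : grid_of N (val S)) F (point S k).
Proof.
rewrite (@sig_big_dep _ _ _ (member SS) (fun S => grid_of N (val S)) xpredT
  (fun _ => xpredT) (fun S k => F (point S k))) /=.
by apply: eq_bigr => -[].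
Qed.

Lemma sum_coord (F : T -> R) (x : K) :
  \sum_(t | coord x (tag t) == t) F t = \sum_S F (coord x S).
Proof.
rewrite big_mkcond sum_mass_coord; apply: eq_bigr => S _ /=.
rewrite (bigD1 (restrict (val S) x))//= eqxx big1 ?addr0// => k kx.
by rewrite ifF//; apply: contraNF kx => /eqP h; rewrite (eq_from_Tagged h).
Qed.

Lemma sum_marginal_at p f : \sum_t marginal_at p t * f t =
  \sum_x p x * \sum_S f (coord x S).
Proof.
under eq_bigr do rewrite /marginal_at mulr_suml big_mkcond /=.
rewrite exchange_big /=; apply: eq_bigr => x _.
by rewrite -big_mkcond -mulr_sumr sum_coord.
Qed.

Lemma mass_marginal_at p S : mass (marginal_at p) S = \sum_x p x.
Proof.
rewrite /mass /marginal_at; under eq_bigr do rewrite big_mkcond /=.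
rewrite exchange_big /=; apply: eq_bigr => x _.
rewrite -big_mkcond (bigD1 (restrict (val S) x))//= big1_seq ?addr0//.
move=> k /andP[/andP[/eqP h kx] _]; case/eqP: kx.
by rewrite (eq_from_Tagged h).
Qed.

Lemma sum_mass w (m : R) : (forall S, mass w S = m) -> \sum_t w t = s * m.
Proof.
move=> wm; rewrite sum_mass_coord (eq_bigr (fun=> m)) => [|S _]; last exact: wm.
by rewrite sumr_const card_member mulr_natl.
Qed.

(** Linear programming duality: mass [m] can be extracted from [w] in a
    compatible way as soon as finitely many [f] allow it. *)
Lemma finite_dual_class : exists Phi : seq {ffun T -> R},
  (forall f : {ffun T -> R}, f \in Phi -> admissible f) /\
  forall w (m : R), (forall t, 0 <= w t) ->
    (forall f : {ffun T -> R}, f \in Phi -> m * s <= \sum_t w t * (1 + f t)) ->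
    exists p : K -> R, [/\ forall x, 0 <= p x,
      forall t, marginal_at p t <= w t & m <= \sum_x p x].
Proof.
pose A (i : (K + T + unit)%type) (x : K) : R := match i with
  | inl (inl z) => - (x == z)%:R
  | inl (inr t) => (coord x (tag t) == t)%:R
  | inr _ => - 1 end.
have [Y [YP sol]] := finite_farkas A.
pose g (y : {ffun (K + T + unit) -> R}) : R := y (inr tt).
(* a multiplier with a positive last coordinate, divided by it, is an admissible
   function up to a shift by one *)
pose fn (y : {ffun (K + T + unit) -> R}) : {ffun T -> R} :=
  [ffun t => s * y (inl (inr t)) / g y - 1].
have split3 (F : (K + T + unit)%type -> R) :
    \sum_i F i = \sum_z F (inl (inl z)) + \sum_t F (inl (inr t)) + F (inr tt).
  rewrite big_sumType /= big_sumType /=; congr (_ + _).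
  by rewrite (bigD1 tt)//= big1 ?addr0// => -[].
exists [seq fn y | y <- Y & 0 < g y]; split.
  move=> _ /mapP[y + ->]; rewrite mem_filter => /andP[gy /YP[y0 yA]]; split=> [t|x].
    by rewrite ffunE lerBrDr addNr divr_ge0 ?mulr_ge0// ltW// s_gt0.
  under eq_bigr do rewrite ffunE.
  rewrite sumrB sumr_const card_member subr_ge0 -mulr_suml -mulr_sumr.
  rewrite ler_pdivlMr// -[X in X * _ <= _]/s ler_pM2l ?s_gt0//.
  have := yA x; rewrite split3 /= -(sum_coord (fun t => y (inl (inr t)))).
  rewrite [X in _ + X + _](_ : _ = \sum_(t | coord x (tag t) == t) y (inl (inr t))); last first.
    by rewrite [RHS]big_mkcond; apply: eq_bigr => t _; case: ifP; rewrite ?mulr1 ?mulr0.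
  have : 0 <= \sum_z y (inl (inl z)) * (x == z)%:R.
    by rewrite sumr_ge0// => z _; rewrite mulr_ge0// ler0n.
  under [X in _ -> X + _ + _ = _ -> _]eq_bigr do rewrite mulrN.
  by rewrite sumrN /g; lra.
move=> w m w0 wm.
have [y yY|p pP] := sol (fun i => match i with
    inl (inl _) => 0 | inl (inr t) => w t | inr _ => - m end).
  have [y0 _] := YP y yY; rewrite split3 big1 ?add0r => [|z _]; last exact: mulr0.
  have [gy|gy] := ltP 0 (g y); last first.
    have -> : y (inr tt) = 0 by apply/eqP; rewrite eq_le y0 andbT.
    by rewrite mul0r addr0 sumr_ge0// => t _; rewrite mulr_ge0.
  have /wm : fn y \in [seq fn y | y <- Y & 0 < g y].
    by apply/mapP; exists y => //; rewrite mem_filter gy.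
  rewrite (eq_bigr (fun t => s / g y * (y (inl (inr t)) * w t))) => [|t _]; last first.
    by rewrite ffunE; lra.
  rewrite -mulr_sumr mulrAC ler_pdivlMr// mulrAC [_ * s]mulrC ler_pM2l ?s_gt0//.
  by rewrite mulrN subr_ge0 mulrC.
exists p; split=> [x|t|].
- have := pP (inl (inl x)); rewrite /= (bigD1 x)//= eqxx big1 ?addr0.
    by rewrite mulN1r oppr_le0.
  by move=> z /negbTE zx; rewrite zx oppr0 mul0r.
- apply: le_trans (pP (inl (inr t))); rewrite /marginal_at big_mkcond ler_sum// => x _.
  by rewrite /=; case: ifP => _; rewrite ?mul1r ?mul0r.
- have := pP (inr tt); rewrite /= -mulr_sumr mulN1r lerN2.
  by [].
Qed.

(** Weak duality: the compatible part [p] of [w] has a nonpositive index, and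
    what remains contributes at most its mass because [f] is at least [- 1]. *)
Lemma discrete_index_decomp w p f (m : R) : admissible f ->
  (forall S, mass w S = m) -> (forall x, 0 <= p x) ->
  (forall t, marginal_at p t <= w t) ->
  discrete_index w f <= m - \sum_x p x.
Proof.
move=> [f1 f0] wm p0 pw; rewrite /discrete_index lerNl -ler_pdivrMl ?invr_gt0 ?s_gt0// invrK.
have : - (s * m - s * \sum_x p x) <= \sum_t (w t - marginal_at p t) * f t.
  rewrite -(sum_mass wm) -(sum_mass (mass_marginal_at p)) -sumrB -sumrN ler_sum// => t _.
  by rewrite -mulrN1 ler_wpM2l// subr_ge0.
rewrite (eq_bigr (fun t => w t * f t - marginal_at p t * f t)) => [|t _]; last exact: mulrBl.
rewrite sumrB sum_marginal_at.
have : 0 <= \sum_x p x * \sum_S f (coord x S) by rewrite sumr_ge0// => x _; rewrite mulr_ge0.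
by lra.
Qed.

End discrete_index.

(** If one term exceeds the bound, the bound itself outweighs all the others. *)
Lemma truncated_sum_ge0 (R : realType) (I : finType) (a : I -> R) :
  (forall i, - 1 <= a i) -> 0 <= \sum_i a i ->
  0 <= \sum_i Num.min (a i) (#|I|%:R - 1).
Proof.
move=> a1 a0.
have [le|[i ai]] : (forall i, a i <= #|I|%:R - 1) \/ exists i, #|I|%:R - 1 < a i.
  apply: contrapT => /not_orP[nle nex]; apply: nle => i.
  by rewrite leNgt; apply/negP => lt; apply: nex; exists i.
- by under eq_bigr => i _ do rewrite (min_l (le i)).
rewrite (bigD1 i)//= (min_r (ltW ai)) -lerBlDl sub0r.
have I0 : (0 < #|I|)%N by apply/card_gt0P; exists i.
apply: (@le_trans _ _ (\sum_(j | j != i) - 1)).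
  by rewrite sumr_const cardC1 mulNrn lerN2 -subn1 natrB.
by apply: ler_sum => j _; rewrite le_min a1 lerBrDr addNr ler0n.
Qed.

Section admissible_normalization.
Variables (R : realType) (d : nat) (N : 'I_d -> nat) (SS : {set {set 'I_d}}).
Hypothesis N_gt0 : forall j, (0 < N j)%N.
Hypothesis SS_gt0 : (0 < #|SS|)%N.

Notation K := (grid N (@id 'I_d)).
Notation T := (mass_coord N SS).
Notation s := (#|SS|%:R : R).
Notation point S k := (Tagged (fun S0 : member SS => grid_of N (val S0)) (i := S) k).

Definition grid_value (j : 'I_d) (v : nat) : 'I_(N j) :=
  Ordinal (ltn_pmod v (N_gt0 j)).

Lemma grid_valueK j (i : 'I_(N j)) : grid_value j i = i.
Proof. by apply: val_inj; rewrite /= modn_small. Qed.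

Definition extension (S : {set 'I_d}) (k : grid_of N S) : K :=
  [ffun j => grid_value j (if insub j : option (idx S) is Some i then k i : nat else 0%N)].

Lemma extensionK (S : {set 'I_d}) (k : grid_of N S) : restrict S (extension k) = k.
Proof. by apply/ffunP => i; rewrite !ffunE valK grid_valueK. Qed.

Lemma grid_inhabited : K.
Proof. exact: [ffun j => grid_value j 0]. Qed.

Definition lone (S : {set 'I_d}) : bool :=
  [forall S' : {set 'I_d}, (S' \in SS) && (S' != S) ==> [disjoint S' & S]].

(** A member of [SS] that meets no other member does not constrain the others,
    so that [f] may be replaced there by its minimum; and where [f] exceeds
    [s - 1], the value [s - 1] already outweighs those of the other members. *)
Lemma admissible_normalize (f : T -> R) : admissible f ->
  exists g : {ffun T -> R}, [/\ admissible g, forall t, g t <= f t,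
    forall t, g t <= s - 1 &
    forall S : member SS, lone (val S) -> forall k k', g (point S k) = g (point S k')].
Proof.
move=> [f1 f0].
pose kmin (S : member SS) : grid_of N (val S) :=
  [arg min_(k < restrict (val S) grid_inhabited) f (point S k)]%O.
have kminP S k : f (point S (kmin S)) <= f (point S k).
  by rewrite /kmin; case: arg_minP => // k0 _ k0min; exact: k0min.
pose h t := if lone (val (tag t)) then f (point (tag t) (kmin (tag t))) else f t.
have hf t : h t <= f t by rewrite /h; case: ifP => // _; case: t => S k; exact: kminP.
have h1 t : - 1 <= h t by rewrite /h; case: ifP.
have h0 x : 0 <= \sum_S h (coord x S).
  pose x' : K := [ffun j => grid_value j
    (if [pick S : member SS | lone (val S) && (j \in val S)] is Some U then
      if insub j : option (idx (val U)) is Some i then kmin U i : nat else 0%N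
     else x j)].
  apply: le_trans (f0 x') _; apply: ler_sum => S _; rewrite /h /=.
  case: ifPn => lS.
    rewrite (_ : coord x' S = point S (kmin S))//; congr (point S _).
    apply/ffunP => i; rewrite !ffunE; case: pickP => [S' /andP[lS' iS']|/(_ S)]; last first.
      by rewrite lS (valP i).
    suff -> : S' = S by rewrite valK grid_valueK.
    apply/eqP/negPn/negP => neq; move/forallP/(_ (val S')): lS.
    rewrite (valP S') /= val_eqE neq /= => /pred0P/(_ (val i)) /=.
    by rewrite iS' (valP i).
  rewrite (_ : coord x' S = coord x S)//; congr (point S _).
  apply/ffunP => i; rewrite !ffunE; case: pickP => [S' /andP[lS' iS']|_]; last first.
    by rewrite grid_valueK.
  have [eS|neq] := eqVneq S' S; first by rewrite eS (negbTE lS) in lS'.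
  move/forallP/(_ (val S)): lS'; rewrite (valP S) /= val_eqE eq_sym neq /=.
  by move=> /pred0P/(_ (val i)) /=; rewrite iS' (valP i).
exists [ffun t => Num.min (h t) (s - 1)]; split.
- split=> [t|x]; first by rewrite ffunE le_min h1 lerBrDr addNr ler0n.
  under eq_bigr => S _ do rewrite ffunE.
  rewrite -card_member; apply: truncated_sum_ge0 => [S|]; [exact: h1|exact: h0].
- by move=> t; rewrite ffunE ge_min hf.
- by move=> t; rewrite ffunE ge_min lexx orbT.
- by move=> S lS k k'; rewrite !ffunE /h /= lS.
Qed.

End admissible_normalization.

(** * Consistent families and the essential facets *)

Section linear_forms.
Variables (R : realType) (T : finType).

Definition weighted_sum (a : T -> R) (v : {ffun T -> R^o}) : R^o := \sum_t v t * a t.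

Lemma weighted_sum_is_linear a : linear (weighted_sum a).
Proof.
move=> l u v; rewrite /weighted_sum scaler_sumr -big_split; apply: eq_bigr => t _.
by rewrite !ffunE mulrDl -scalerAl.
Qed.

HB.instance Definition _ a :=
  GRing.isLinear.Build R {ffun T -> R^o} R^o _ (weighted_sum a) (weighted_sum_is_linear a).

(** A subspace of maximal dimension among those contained in [A]. *)
Lemma vspace_of_closed_set (V : vectType R) (A : set V) : A 0 ->
  (forall l u v, A u -> A v -> A (l *: u + v)) ->
  exists W : {vspace V}, forall v, v \in W <-> A v.
Proof.
move=> A0 Al; pose Q k := `[< exists W : {vspace V}, (forall v, v \in W -> A v) /\ \dim W = k >].
have Q0 : exists k, Q k.
  by exists 0%N; apply/asboolP; exists 0%VS; rewrite dimv0; split=> // v; rewrite memv0 => /eqP->.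
have Qb k : Q k -> (k <= \dim {:V})%N.
  by move=> /asboolP[W [_ <-]]; exact/dimvS/subvf.
have [k /asboolP[W [WA dW]] kmax] := ex_maxnP Q0 Qb.
exists W => v; split; [exact: WA|move=> Av; apply: contrapT => /negP vW].
suff /kmax : Q (\dim (W + <[v]>)).
  rewrite -dW => le; move/negP: vW; apply.
  have /eqP-> : (W == W + <[v]>)%VS by rewrite eqEdim addvSl.
  exact: (subvP (addvSr W <[v]>)) (memv_line v).
apply/asboolP; exists (W + <[v]>)%VS; split=> // _ /memv_addP[u uW [_ /vlineP[l ->] ->]].
by rewrite addrC; apply: Al => //; exact: WA.
Qed.

End linear_forms.

Section facets_of_the_discrete_index.
Variables (R : realType) (d : nat) (N : 'I_d -> nat) (SS : {set {set 'I_d}}).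
Hypothesis N_gt0 : forall j, (0 < N j)%N.
Hypothesis SS_gt0 : (0 < #|SS|)%N.

Notation K := (grid N (@id 'I_d)).
Notation T := (mass_coord N SS).
Notation s := (#|SS|%:R : R).
Notation point S k := (Tagged (fun S0 : member SS => grid_of N (val S0)) (i := S) k).
Implicit Types (v w f : T -> R) (p : K -> R).

Definition consistent w : Prop :=
  (forall S1 S2 : member SS, ~~ [disjoint val S1 & val S2] ->
    forall k : grid_of N (val S1 :&: val S2),
      marginal (fun x : grid_of N (val S1) => w (point S1 x)) k =
      marginal (fun x : grid_of N (val S2) => w (point S2 x)) k) /\
  forall S1 S2 : member SS, mass w S1 = mass w S2.

Lemma agree_restrict (S : {set 'I_d}) (x : K) (k : grid_of N S) :
  agree x k = (restrict S x == k).
Proof.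
apply/idP/eqP => [/forallP h|<-].
  apply/ffunP => i; rewrite ffunE; apply/val_inj/eqP.
  by have /forallP/(_ i) := h (val i); rewrite eqxx.
by apply/'forall_forallP => i j; apply/implyP => /eqP->; rewrite ffunE.
Qed.

Lemma agree_restrict_sub (S S' : {set 'I_d}) (x : K) (k : grid_of N S') :
  S' \subset S -> agree (restrict S x) k = agree x k.
Proof.
move=> /fintype.subsetP S'S; apply/idP/idP => /'forall_forallP h.
  apply/'forall_forallP => i j; apply/implyP => /eqP ij.
  have iS : i \in S by rewrite ij S'S ?(valP j).
  by have := h (Sub i iS) j; rewrite /= ffunE /= ij eqxx.
by apply/'forall_forallP => i j; rewrite ffunE; exact: h.
Qed.

Lemma marginal_marginal_at p (S : member SS) (S' : {set 'I_d}) (k : grid_of N S') :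
  S' \subset val S ->
  marginal (fun x : grid_of N (val S) => marginal_at p (point S x)) k =
  \sum_(x | agree x k) p x.
Proof.
move=> S'S; rewrite /marginal /marginal_at.
under eq_bigr do rewrite big_mkcond /=.
rewrite exchange_big /= [RHS]big_mkcond /=; apply: eq_bigr => x _.
rewrite -big_mkcondr /= -(agree_restrict_sub x k S'S); case: ifPn => [xk|nxk].
  rewrite (big_pred1 (restrict (val S) x))// => k1; rewrite /= andbC.
  apply/andP/eqP => [[/eqP h _]|->]; first by rewrite (eq_from_Tagged h).
  by rewrite eqxx.
rewrite big_pred0// => k1; apply/negP => /andP[k1k /eqP h].
by rewrite (eq_from_Tagged h) k1k in nxk.
Qed.

Lemma consistent_marginal_at p : consistent (marginal_at p).
Proof.
split=> [S1 S2 _ k|S1 S2]; last by rewrite !mass_marginal_at.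
by rewrite !marginal_marginal_at ?subsetIl ?subsetIr.
Qed.

Lemma consistent_linear l v w : consistent v -> consistent w ->
  consistent (fun t => l * v t + w t).
Proof.
move=> [vm vM] [wm wM]; split=> [S1 S2 S12 k|S1 S2].
  rewrite /marginal !big_split /= -!mulr_sumr.
  by congr (_ * _ + _); [exact: vm|exact: wm].
by rewrite /mass !big_split /= -!mulr_sumr; congr (_ * _ + _); [exact: vM|exact: wM].
Qed.

Lemma eq_consistent v w : v =1 w -> consistent v -> consistent w.
Proof. by move=> /funext->. Qed.

Lemma mass_of_consistent w : consistent w -> exists m, forall S, mass w S = m.
Proof.
move=> [_ wM]; have /card_gt0P[S0 S0SS] := SS_gt0.
by exists (mass w (Sub S0 S0SS)) => S; exact: wM.
Qed.

Lemma mass_ge0 w S : (forall t, 0 <= w t) -> 0 <= mass w S.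
Proof. by move=> w0; exact: sumr_ge0. Qed.

Lemma mass0_eq0 w : (forall t, 0 <= w t) -> (forall S, mass w S = 0) -> forall t, w t = 0.
Proof.
move=> w0 wm [S k]; have /eqP := wm S; rewrite /mass psumr_eq0// => /allP/(_ k).
by rewrite mem_index_enum => /(_ isT)/eqP.
Qed.

Lemma discrete_indexZ l w f : discrete_index (fun t => l * w t) f = l * discrete_index w f.
Proof.
rewrite /discrete_index; under eq_bigr do rewrite -mulrA.
by rewrite -mulr_sumr; ring.
Qed.

Lemma discrete_indexD v w f :
  discrete_index (fun t => v t + w t) f = discrete_index v f + discrete_index w f.
Proof.
rewrite /discrete_index; under eq_bigr do rewrite mulrDl.
by rewrite big_split /= mulrDr opprD.
Qed.

Lemma discrete_index_marginal_at_le0 p f : admissible f -> (forall x, 0 <= p x) ->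
  discrete_index (marginal_at p) f <= 0.
Proof.
move=> fa p0; have := discrete_index_decomp SS_gt0 fa (mass_marginal_at p) p0 (fun t => lexx _).
by rewrite subrr.
Qed.

Lemma discrete_index_le_mass w f (m : R) : admissible f -> (forall t, 0 <= w t) ->
  (forall S, mass w S = m) -> discrete_index w f <= m.
Proof.
move=> fa w0 wm; have := discrete_index_decomp SS_gt0 fa wm (fun=> lexx 0).
rewrite big1// subr0; apply => t.
by rewrite /marginal_at big1.
Qed.

Lemma consistent_seqsE (q : mass_seq R N SS) : consistent_seqs q <->
  [/\ consistent q, forall t, 0 <= q t & forall S, mass q S = 1].
Proof.
split=> [[qp qm]|[[qm _] q0 q1]].
  split=> [|[S k]|S]; last by case: (qp S).
    by split=> // S1 S2; case: (qp S1) => _; case: (qp S2) => _; rewrite /mass => -> ->.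
  by case: (qp S) => h _; exact: h.
by split=> // S; split=> [k|]; [exact: q0|exact: q1].
Qed.

Lemma compatible_seqsE (q : mass_seq R N SS) : compatible_seqs q <->
  exists p, [/\ forall x, 0 <= p x, \sum_x p x = 1 & q =1 marginal_at p].
Proof.
have mE p S (k : grid_of N (val S)) : marginal p k = marginal_at p (point S k).
  rewrite /marginal /marginal_at; apply: eq_bigl => x; rewrite agree_restrict.
  by apply/eqP/eqP => [<-//|h]; exact: eq_from_Tagged h.
split=> [[qp [p [[p0 p1] qE]]]|[p [p0 p1 qE]]].
  exists p; split=> // -[S k]; by rewrite -mE -qE.
split; last by exists p; split=> // S k; rewrite mE -qE.
move=> S; split=> [k|]; first by rewrite /mass_at qE sumr_ge0.
rewrite -p1 -(mass_marginal_at p S); apply: eq_bigr => k _.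
by rewrite -qE.
Qed.

Lemma compatible_consistent (q : mass_seq R N SS) : compatible_seqs q -> consistent_seqs q.
Proof.
move=> /compatible_seqsE[p [p0 p1 qE]]; apply/consistent_seqsE.
have -> : (q : T -> R) = marginal_at p by apply/funext.
split; [exact: consistent_marginal_at|by move=> t; exact: sumr_ge0|].
by move=> S; rewrite mass_marginal_at.
Qed.

(* a representative of total mass one when the mass to be normalised is zero *)
Let uniform : K -> R := fun=> #|K|%:R^-1.

Let uniform_gt0 x : 0 < uniform x.
Proof. by rewrite invr_gt0 ltr0n; apply/card_gt0P; exists x. Qed.

Let uniform_sum1 : \sum_x uniform x = 1.
Proof.
rewrite /uniform sumr_const -[_ *+ _]mulr_natr mulVf// pnatr_eq0 -lt0n.
by apply/card_gt0P; exists (grid_inhabited N_gt0).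
Qed.

Let marginal_uniform_gt0 (t : T) : 0 < marginal_at uniform t.
Proof.
case: t => S k; rewrite /marginal_at (bigD1 (extension N_gt0 k))/=; last first.
  by rewrite /coord extensionK.
by rewrite ltr_pwDl// sumr_ge0// => x _; exact: ltW.
Qed.

Lemma compatible_seq_of p : (forall x, 0 <= p x) ->
  exists2 q : mass_seq R N SS, compatible_seqs q &
    forall t, marginal_at p t = (\sum_x p x) * q t.
Proof.
move=> p0; have [a0|an0] := eqVneq (\sum_x p x) 0.
  exists [ffun t => marginal_at uniform t].
    apply/compatible_seqsE; exists uniform; split=> [x||t]; rewrite ?ffunE//.
    exact: ltW.
  move=> t; rewrite a0 mul0r; apply: big1 => x _.
  by move/eqP: a0; rewrite psumr_eq0// => /allP/(_ x); rewrite mem_index_enum => /(_ isT)/eqP.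
set a := \sum_x p x; have a0 : 0 <= a by exact: sumr_ge0.
exists [ffun t => marginal_at (fun x => a^-1 * p x) t].
  apply/compatible_seqsE; exists (fun x => a^-1 * p x); split=> [x||t]; rewrite ?ffunE//.
    by rewrite mulr_ge0// invr_ge0.
  by rewrite -mulr_sumr mulVf.
by move=> t; rewrite ffunE /marginal_at -mulr_sumr mulrA mulfV ?mul1r.
Qed.

Lemma consistent_seq_of w (m : R) : consistent w -> (forall t, 0 <= w t) ->
  (forall S, mass w S = m) ->
  exists2 q : mass_seq R N SS, consistent_seqs q & forall t, w t = m * q t.
Proof.
move=> wc w0 wm; have [m0|mn0] := eqVneq m 0.
  have [q /compatible_consistent qc _] := compatible_seq_of (fun x => ltW (uniform_gt0 x)).
  by exists q => // t; rewrite m0 mul0r mass0_eq0// => S; rewrite wm.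
have [S0 _] : exists S : member SS, True.
  by have /card_gt0P[S0 S0SS] := SS_gt0; exists (Sub S0 S0SS).
have m0 : 0 <= m by rewrite -(wm S0) mass_ge0.
exists [ffun t => m^-1 * w t]; last by move=> t; rewrite ffunE mulrA mulfV ?mul1r.
apply/consistent_seqsE; split=> [|t|S].
- have : consistent (fun t => m^-1 * w t + marginal_at (fun=> 0) t).
    by apply: consistent_linear => //; exact: consistent_marginal_at.
  by apply: eq_consistent => t; rewrite ffunE /marginal_at big1 ?addr0.
- by rewrite ffunE mulr_ge0// invr_ge0.
- rewrite /mass; under eq_bigr do rewrite ffunE.
  by rewrite -mulr_sumr -[X in _ * X]/(mass w S) wm mulVf.
Qed.

Lemma sum_weighted w f (m : R) : (forall S, mass w S = m) ->
  \sum_t w t * (1 + f t) = s * (m - discrete_index w f).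
Proof.
move=> wm; under eq_bigr do rewrite mulrDr mulr1.
rewrite big_split /= (sum_mass wm) /discrete_index opprK mulrDr mulrA mulfV ?mul1r//.
by rewrite gt_eqF// ltr0n.
Qed.

(** The index is at most one on [polyhedral_set] because it is nonpositive on
    compatible families and at most the mass in general. Conversely, duality
    splits off a compatible family that leaves a consistent one of mass at most
    one. *)
Lemma polyhedral_setE (Phi : seq {ffun T -> R}) :
  (forall f : {ffun T -> R}, f \in Phi -> admissible f) ->
  (forall w (m : R), (forall t, 0 <= w t) ->
    (forall f : {ffun T -> R}, f \in Phi -> m * s <= \sum_t w t * (1 + f t)) ->
    exists p : K -> R, [/\ forall x, 0 <= p x,
      forall t, marginal_at p t <= w t & m <= \sum_x p x]) ->
  forall v : mass_seq R N SS, polyhedral_set v <->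
    [/\ consistent v, forall t, 0 <= v t &
      forall f : {ffun T -> R}, f \in Phi -> discrete_index v f <= 1].
Proof.
move=> PhiA dual v; split.
  move=> [q [q' [a [b [[qc a0] [q'c /andP[b0 b1]] vE]]]]].
  have vt t : v t = a * q t + b * q' t by rewrite vE !ffunE.
  have /consistent_seqsE[qC qge0 q1] := compatible_consistent qc.
  have /consistent_seqsE[q'C q'ge0 q'1] := q'c.
  have bq'C : consistent (fun t => b * q' t + marginal_at (fun=> 0) t).
    by apply: consistent_linear => //; exact: consistent_marginal_at.
  split=> [|t|f /PhiA fA].
  - apply: eq_consistent (consistent_linear a qC bq'C) => t.
    by rewrite vt /marginal_at big1 ?addr0.
  - by rewrite vt addr_ge0// mulr_ge0.
  - rewrite (_ : (v : T -> R) = fun t => a * q t + b * q' t); last exact/funext.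
    rewrite discrete_indexD !discrete_indexZ.
    have [p [p0 _ qE]] := (compatible_seqsE q).1 qc.
    have q_le0 : discrete_index q f <= 0.
      by rewrite (_ : (q : T -> R) = marginal_at p) ?discrete_index_marginal_at_le0//; exact/funext.
    have := discrete_index_le_mass fA q'ge0 q'1 => q'le1.
    rewrite -[leRHS]add0r lerD//; first by rewrite mulr_ge0_le0.
    by apply: (le_trans (ler_wpM2l b0 q'le1)); rewrite mulr1.
move=> [vC v0 vPhi]; have [m vm] := mass_of_consistent vC.
have [|p [p0 pv mp]] := dual v (m - 1) v0.
  move=> f fPhi; rewrite (sum_weighted _ vm) mulrC ler_pM2l ?ltr0n//.
  by rewrite lerD2l lerN2 vPhi.
have [q qc qE] := compatible_seq_of p0.
pose u t := v t - marginal_at p t.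
have uC : consistent u.
  apply: eq_consistent (consistent_linear (- 1) (consistent_marginal_at p) vC) => t.
  by rewrite /u mulN1r addrC.
have u0 t : 0 <= u t by rewrite subr_ge0.
have um S : mass u S = m - \sum_x p x by rewrite -(vm S) -(mass_marginal_at p S) -sumrB.
have [q' q'c q'E] := consistent_seq_of uC u0 um.
exists q, q', (\sum_x p x), (m - \sum_x p x); split.
- by split=> //; exact: sumr_ge0.
- split=> //; have [S0 _] : exists S : member SS, True.
    by have /card_gt0P[S0 S0SS] := SS_gt0; exists (Sub S0 S0SS).
  by rewrite -{1}(um S0) mass_ge0//= lerBlDr -lerBlDl.
- by apply/ffunP => t; rewrite !ffunE -[_ *: q t]qE -[_ *: q' t]q'E /u addrC subrK.
Qed.

End facets_of_the_discrete_index.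

Section facet_dual_class.
Variables (R : realType) (d : nat) (N : 'I_d -> nat) (SS : {set {set 'I_d}}).
Hypothesis N_gt0 : forall j, (0 < N j)%N.
Hypothesis SS_gt0 : (0 < #|SS|)%N.

Notation K := (grid N (@id 'I_d)).
Notation T := (mass_coord N SS).
Notation s := (#|SS|%:R : R).
Notation V := (mass_seq R N SS).
Implicit Types (w f : T -> R).

(** For consistent families the index is a maximum over as many admissible
    functions as there are essential facets: among the inequalities
    [discrete_index v f <= 1] of a finite description of the polyhedral set,
    those of an irredundant subfamily define distinct facets, and these facets
    contain points all of whose coordinates are positive. *)
Lemma facet_dual_class : exists Phi : seq {ffun T -> R},
  [/\ (size Phi <= nb_essential_facets R N SS)%N,
    forall f : {ffun T -> R}, f \in Phi -> admissible f &
    forall w f (c : R), consistent w -> (forall t, 0 <= w t) -> admissible f -> 0 <= c ->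
      (forall g : {ffun T -> R}, g \in Phi -> discrete_index w g <= c) ->
      discrete_index w f <= c].
Proof.
have [Phi0 [Phi0A dual]] := finite_dual_class R N SS_gt0.
pose m := size Phi0; pose ph (i : 'I_m) : {ffun T -> R} := nth [ffun=> 0] Phi0 i.
have phA i : admissible (ph i) by apply: Phi0A; rewrite mem_nth.
have phE (f : {ffun T -> R}) : f \in Phi0 -> exists i, f = ph i.
  by move=> fP; exists (Ordinal (etrans (index_mem f Phi0) fP)); rewrite /ph /= nth_index.
have [W WP] : exists W : {vspace V}, forall v : V, v \in W <-> consistent v.
  apply: vspace_of_closed_set => [|l u v uC vC].
    have := @consistent_marginal_at R _ N SS (fun=> 0).
    by apply: eq_consistent => t; rewrite ffunE /marginal_at big1.
  by apply: eq_consistent (consistent_linear l uC vC) => t; rewrite !ffunE.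
(* an irredundant subfamily is a minimal set of inequalities implying the rest *)
pose soundP (J : {set 'I_m}) := forall v : V, consistent v -> (forall t, 0 <= v t) ->
  (forall i, i \in J -> discrete_index v (ph i) <= 1) ->
  forall i, discrete_index v (ph i) <= 1.
pose sound J := `[< soundP J >].
have [J /minsetP[/asboolP Jsound Jmin]] : {J | minset sound J}.
  suff /minset_exists[J JP _] : sound finset.setT by exists J.
  by apply/asboolP => v _ _ h i; apply: h; rewrite inE.
pose I : finType := (T + {i : 'I_m | i \in J})%type.
pose a (i : I) : T -> R := match i with
  | inl t => fun u => - (u == t)%:R | inr i => fun u => - s^-1 * ph (val i) u end.
pose psi i : 'Hom(V, R^o) := linfun (weighted_sum (a i)).
pose b (i : I) : R := if i is inl _ then 0 else 1.
have psi_l (v : V) t : psi (inl t) v = - v t.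
  rewrite lfunE /= /weighted_sum (bigD1 t)//= eqxx big1 ?addr0 ?mulrN1// => u /negbTE->.
  by rewrite oppr0 mulr0.
have psi_r (v : V) i : psi (inr i) v = discrete_index v (ph (val i)).
  rewrite lfunE /= /weighted_sum /discrete_index mulr_sumr -sumrN.
  by apply: eq_bigr => t _; rewrite mulrCA mulNr.
have AE (v : V) : polyhedral_set v <-> polyhedron W psi b v.
  rewrite (polyhedral_setE N_gt0 SS_gt0 Phi0A dual) /polyhedron /=; split.
    move=> [vC v0 vP]; split; first exact/WP.
    move=> [t|i]; first by rewrite psi_l oppr_le0.
    by rewrite psi_r vP// mem_nth.
  move=> [/WP vC vP].
  have v0 t : 0 <= v t by have := vP (inl t); rewrite psi_l oppr_le0.
  split=> // f /phE[i ->]; apply: Jsound => // j jJ.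
  by have := vP (inr (Sub j jJ)); rewrite psi_r.
have {}AE : @polyhedral_set R d N SS = polyhedron W psi b.
  by apply/funext => v; apply/propext; exact: AE.
pose u0 : V := [ffun t => marginal_at (fun=> #|K|%:R^-1) t].
have K0 : 0 < #|K|%:R^-1 :> R.
  by rewrite invr_gt0 ltr0n; apply/card_gt0P; exists (grid_inhabited N_gt0).
have u0W : u0 \in W.
  by apply/WP; apply: eq_consistent (@consistent_marginal_at R _ N SS (fun=> #|K|%:R^-1)) => t;
    rewrite ffunE.
have u0_int i : psi i u0 < b i.
  case: i => [[S k]|i].
    rewrite psi_l oppr_lt0 ffunE /marginal_at (bigD1 (extension N_gt0 k))/=.
      by rewrite ltr_pwDl// sumr_ge0// => x _; exact: ltW.
    by rewrite /coord extensionK.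
  rewrite psi_r /=; apply: (@le_lt_trans _ _ 0) => //.
  rewrite (_ : (u0 : T -> R) = marginal_at (fun=> #|K|%:R^-1)); last first.
    by apply/funext => t; rewrite ffunE.
  by apply: discrete_index_marginal_at_le0 => // x; exact: ltW.
have irr (i : {i : 'I_m | i \in J}) :
    (exists2 y, tight W psi b (inr i) y & forall j, j != inr i -> psi j y < b j) /\
    facet (polyhedron W psi b) (tight W psi b (inr i)).
  have : ~ soundP (J :\ val i).
    by move=> /asboolP/(Jmin _)/(_ (subD1set _ _))/setP/(_ (val i)); rewrite !inE eqxx (valP i).
  move=> /existsNP[z /not_implyP[zC /not_implyP[z0 /not_implyP[zJ /existsNP[l zl]]]]].
  apply: (@irredundant_facet _ _ _ _ _ _ _ u0W u0_int _ z).
  - exact/WP.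
  - rewrite psi_r /= ltNge; apply/negP => zi; apply: zl; apply: Jsound => // j jJ.
    by have [->//|ji] := eqVneq j (val i); apply: zJ; rewrite !inE ji.
  - move=> [t _|j ji]; first by rewrite psi_l oppr_le0.
    rewrite psi_r; apply: zJ; rewrite !inE (valP j) andbT.
    by apply: contra ji => /eqP/val_inj->.
have essential i : @essential_facets R d N SS (tight W psi b (inr i)).
  rewrite /essential_facets /= AE; split; first by case: (irr i).
  move=> [S [k FE]]; have [[y yF yj] _] := irr i.
  have := yj (inl (Tagged (fun S : member SS => grid_of N (val S)) k)) isT.
  rewrite psi_l oppr_lt0; move: yF; rewrite FE => -[_ /=]; rewrite /mass_at => ->.
  by rewrite ltxx.
have ess_fin : finite_set (@essential_facets R d N SS).
  apply: (@sub_finite_set _ _ [set tight W psi b i | i in [set: I]]).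
    move=> F [+ _]; rewrite AE => /(facet_tight u0W u0_int)[i ->].
    by exists i.
  exact/finite_image/finite_finset.
have tight_inj : injective (fun i : {i : 'I_m | i \in J} => tight W psi b (inr i)).
  move=> i j ij; apply/eqP/negPn/negP => neq.
  have [[y [_ yi] yj] _] := irr i; have [[z zt zj] _] := irr j.
  have : tight W psi b (inr i) z by rewrite ij.
  move=> [_ /= zi]; have := zj (inr i); rewrite zi ltxx => h.
  suff: false by []; apply: h; apply/eqP => -[ij'].
  by rewrite ij' eqxx in neq.
exists [seq ph i | i <- enum J]; split.
- rewrite size_map -cardE -card_sig.
  rewrite cardE -(size_map (fun i => tight W psi b (inr i))).
  apply: uniq_leq_size.
    by rewrite map_inj_uniq ?enum_uniq.
  by move=> F /mapP[i _ ->]; rewrite in_fset_set//; exact/mem_set.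
- by move=> f /mapP[i _ ->].
move=> w f c wC w0 fA c0 wP.
(* the polyhedral set knows level one only, so [w] is divided by the level, taken
   to be [c + e] as [c] may vanish *)
have wle (e : R) : 0 < e -> forall i, discrete_index w (ph i) <= c + e.
  move=> e0; have ce : 0 < c + e by rewrite ltr_wpDl.
  move=> i; rewrite -[leRHS]mulr1 -ler_pdivrMl// -discrete_indexZ.
  pose v : V := [ffun t => (c + e)^-1 * w t].
  have vE : (v : T -> R) = fun t => (c + e)^-1 * w t.
    by apply/funext => t; rewrite ffunE.
  rewrite -vE; apply: Jsound => [|t|j jJ]; rewrite vE.
  - have := consistent_linear (c + e)^-1 wC (@consistent_marginal_at R _ N SS (fun=> 0)).
    by apply: eq_consistent => t; rewrite /marginal_at big1 ?addr0.
  - by rewrite mulr_ge0// invr_ge0 ltW.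
  - rewrite discrete_indexZ ler_pdivrMl// mulr1; apply: (@le_trans _ _ c).
      by apply: wP; apply/mapP; exists j; rewrite ?mem_enum.
    by rewrite lerDl ltW.
have [M wM] := mass_of_consistent SS_gt0 wC.
apply/ler_addgt0Pr => e e0.
have [|p [p0 pw pM]] := dual w (M - (c + e)) w0.
  move=> g /phE[i ->]; rewrite (sum_weighted SS_gt0 _ wM) mulrC ler_pM2l ?ltr0n//.
  by rewrite lerD2l lerN2 wle.
apply: le_trans (discrete_index_decomp SS_gt0 fA wM p0 pw) _.
by rewrite lerBlDr addrC -lerBlDr.
Qed.

End facet_dual_class.

(** * Samples from a family of distributions on the grid *)

Section finite_index_class.
Variables (R : realType) (d : nat) (N : 'I_d -> nat) (SS : {set {set 'I_d}}).
Hypothesis N_gt0 : forall j, (0 < N j)%N.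
Hypothesis SS_gt0 : (0 < #|SS|)%N.

Notation K := (grid N (@id 'I_d)).
Notation T := (mass_coord N SS).
Notation s := (#|SS|%:R : R).
Notation point S k := (Tagged (fun S0 : member SS => grid_of N (val S0)) (i := S) k).

Definition normalized (f : T -> R) : Prop :=
  [/\ admissible f, forall t, f t <= s - 1 &
    forall S : member SS, lone SS (val S) -> forall k k', f (point S k) = f (point S k')].

Lemma discrete_index_le_fun (w f g : T -> R) : (forall t, 0 <= w t) ->
  (forall t, g t <= f t) -> discrete_index w f <= discrete_index w g.
Proof.
move=> w0 gf; rewrite lerN2 ler_wpM2l ?invr_ge0 ?ler0n// ler_sum// => t _.
by rewrite ler_wpM2l.
Qed.

Lemma normalize_seq (Phi : seq {ffun T -> R}) :
  (forall f : {ffun T -> R}, f \in Phi -> admissible f) ->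
  exists Psi : seq {ffun T -> R}, [/\ size Psi = size Phi,
    forall g : {ffun T -> R}, g \in Psi -> normalized g &
    forall w (c : R), (forall t, 0 <= w t) ->
      (forall g : {ffun T -> R}, g \in Psi -> discrete_index w g <= c) ->
      forall f : {ffun T -> R}, f \in Phi -> discrete_index w f <= c].
Proof.
move=> PhiA; have /choice[nf nfP] : forall f : {ffun T -> R}, exists g : {ffun T -> R},
    f \in Phi -> normalized g /\ forall t, g t <= f t.
  move=> f; have [/PhiA/(admissible_normalize N_gt0)[g [gA gf g1 gl]]|_] := boolP (f \in Phi).
    by exists g => _; split.
  by exists f.
exists [seq nf f | f <- Phi]; split; first by rewrite size_map.
  by move=> _ /mapP[f /nfP[] ? _ ->].
move=> w c w0 wc f fP; apply: (@le_trans _ _ (discrete_index w (nf f))).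
  by apply: discrete_index_le_fun => //; case: (nfP f fP).
by apply: wc; apply/mapP; exists f.
Qed.

(** Strong duality: if the index were larger than [c] at some [f], then no
    compatible part of mass [m - c] could be extracted from [w]. *)
Lemma finite_normalized_class : exists Psi : seq {ffun T -> R},
  (forall g : {ffun T -> R}, g \in Psi -> normalized g) /\
  forall w f (m c : R), (forall t, 0 <= w t) -> (forall S, mass w S = m) ->
    admissible f -> (forall g : {ffun T -> R}, g \in Psi -> discrete_index w g <= c) ->
    0 <= c -> discrete_index w f <= c.
Proof.
have [Phi [PhiA dual]] := finite_dual_class R N SS_gt0.
have [Psi [_ PsiN PsiP]] := normalize_seq PhiA.
exists Psi; split=> // w f m c w0 wm fA wc c0.
have wPhi := PsiP _ _ w0 wc.
have [|p [p0 pw pM]] := dual w (m - c) w0.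
  move=> g gP; rewrite (sum_weighted SS_gt0 _ wm) mulrC ler_pM2l ?ltr0n//.
  by rewrite lerD2l lerN2 wPhi.
apply: le_trans (discrete_index_decomp SS_gt0 fA wm p0 pw) _.
by rewrite lerBlDr addrC -lerBlDr.
Qed.

Lemma normalized_norm f t : normalized f -> `|f t| <= s.
Proof.
move=> [[f1 _] fs _]; rewrite ler_norml (le_trans _ (f1 t)) ?lerN2 ?ler1n//=.
by rewrite (le_trans (fs t))// gerBl.
Qed.

End finite_index_class.

Section sampling.
Variables (R : realType) (d : nat) (N : 'I_d -> nat) (SS : {set {set 'I_d}}).
Hypothesis N_gt0 : forall j, (0 < N j)%N.
Hypothesis SS_gt0 : (0 < #|SS|)%N.

Notation K := (grid N (@id 'I_d)).
Notation T := (mass_coord N SS).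
Notation s := (#|SS|%:R : R).
Notation point S k := (Tagged (fun S0 : member SS => grid_of N (val S0)) (i := S) k).

Variable n : {set 'I_d} -> nat.
Hypothesis n_gt0 : forall S, S \in SS -> (0 < n S)%N.
Variable q : T -> R.
Hypothesis q_ge0 : forall t, 0 <= q t.
Hypothesis q_mass : forall S, mass q S = 1.

Definition sample : finType := {S : member SS & 'I_(n (val S))}.

Let J := sample.
Notation size_of j := ((n (val (tag j)))%:R : R).

(** Observations of different members of [SS] take values in the same type, with
    probability zero for the points of another member: the concentration
    inequality is about functions on a power of one type. *)
Definition sample_law (j : sample) (t : T) : R := if tag t == tag j then q t else 0.

Notation E := (expectation sample_law).

Definition empirical_mass (y : {ffun sample -> T}) (t : T) : R :=
  \sum_(j | tag j == tag t) (size_of j)^-1 * (y j == t)%:R.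

Definition right_tag (j : sample) : pred T := fun t => tag t == tag j.

Lemma sample_law_ge0 j t : 0 <= sample_law j t.
Proof. by rewrite /sample_law; case: ifP. Qed.

Lemma sum_sample_law j (g : T -> R) :
  \sum_t sample_law j t * g t = \sum_(k : grid_of N (val (tag j))) q (point (tag j) k) * g (point (tag j) k).
Proof.
rewrite sum_mass_coord (bigD1 (tag j))//= [X in _ + X]big1 ?addr0.
  by apply: eq_bigr => k _; rewrite /sample_law eqxx.
by move=> S /negbTE Sj; apply: big1 => k _; rewrite /sample_law /= Sj mul0r.
Qed.

Lemma sample_law_sum1 j : \sum_t sample_law j t = 1.
Proof.
under eq_bigr do rewrite -[sample_law _ _]mulr1.
by rewrite sum_sample_law -[RHS](q_mass (tag j)); apply: eq_bigr => k _; rewrite mulr1.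
Qed.

Lemma sample_law_supp j t : ~~ right_tag j t -> sample_law j t = 0.
Proof. by rewrite /sample_law /right_tag => /negbTE->. Qed.

Lemma sum_sample (F : sample -> R) :
  \sum_j F j = \sum_(S : member SS) \sum_(i < n (val S)) F (Tagged (fun S : member SS => 'I_(n (val S))) i).
Proof.
rewrite (@sig_big_dep _ _ _ (member SS) (fun S => 'I_(n (val S))) xpredT
  (fun _ => xpredT) (fun S i => F (Tagged (fun S : member SS => 'I_(n (val S))) i))) /=.
by apply: eq_bigr => -[].
Qed.

Lemma sum_sample_size (F : member SS -> R) :
  \sum_(j : sample) (size_of j)^-1 * F (tag j) = \sum_(S : member SS) F S.
Proof.
rewrite sum_sample; apply: eq_bigr => S _ /=.
rewrite sumr_const card_ord -mulrnAl -[_ *+ _]mulr_natr mulVf ?mul1r//.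
by rewrite pnatr_eq0 -lt0n n_gt0 ?(valP S).
Qed.

Lemma sum_empirical (y : {ffun sample -> T}) (g : T -> R) : \sum_t empirical_mass y t * g t =
  \sum_j (size_of j)^-1 * (right_tag j (y j))%:R * g (y j).
Proof.
rewrite /empirical_mass; under eq_bigr do rewrite mulr_suml big_mkcond /=.
rewrite exchange_big /=; apply: eq_bigr => j _.
rewrite (bigD1 (y j))//= [X in _ + X]big1 ?addr0.
  by rewrite eqxx mulr1 /right_tag eq_sym; case: eqP; rewrite ?mulr1// mulr0 mul0r.
move=> t ty; case: ifP => // _; rewrite eq_sym (negbTE ty).
by rewrite mulr0 mul0r.
Qed.

Lemma empirical_mass_ge0 y t : 0 <= empirical_mass y t.
Proof. by apply: sumr_ge0 => j _; rewrite mulr_ge0 ?invr_ge0 ?ler0n. Qed.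

Lemma mass_empirical_mass (y : {ffun sample -> T}) S : (forall j, right_tag j (y j)) ->
  mass (empirical_mass y) S = 1.
Proof.
move=> yT; pose g (t : T) : R := (tag t == S)%:R.
have -> : mass (empirical_mass y) S = \sum_t empirical_mass y t * g t.
  rewrite sum_mass_coord (bigD1 S)//= [X in _ + X]big1 ?addr0.
    by apply: eq_bigr => k _; rewrite /g eqxx mulr1.
  by move=> S' /negbTE S'S; apply: big1 => k _; rewrite /g /= S'S mulr0.
rewrite sum_empirical.
under eq_bigr => j _ do rewrite yT mulr1 /g (eqP (yT j)).
rewrite (sum_sample_size (fun S' => (S' == S)%:R)) (bigD1 S)//= eqxx big1 ?addr0//.
by move=> S' /negbTE->.
Qed.

Lemma expectation_empirical (g : T -> R) :
  E (fun y => \sum_t empirical_mass y t * g t) = \sum_t q t * g t.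
Proof.
transitivity (\sum_j (size_of j)^-1 * \sum_t sample_law j t * ((right_tag j t)%:R * g t)).
  rewrite -(eq_bigr _ (fun j _ => f_equal _ (expectation_coord sample_law_sum1 j
    (fun t => (right_tag j t)%:R * g t)))).
  under [RHS]eq_bigr do rewrite -expectationZ.
  rewrite -expectation_sum; apply: eq_bigr => y _; congr (_ * _).
  by rewrite sum_empirical; apply: eq_bigr => j _; rewrite mulrA.
rewrite sum_mass_coord.
rewrite -(sum_sample_size (fun S => \sum_(k : grid_of N (val S)) q (point S k) * g (point S k))).
apply: eq_bigr => j _; rewrite sum_sample_law; congr (_ * _).
by apply: eq_bigr => k _; rewrite /right_tag eqxx mul1r.
Qed.

Lemma expectation_discrete_index f :
  E (fun y => discrete_index (empirical_mass y) f) = discrete_index q f.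
Proof.
rewrite /discrete_index -expectation_empirical -expectationZ -expectationN.
by [].
Qed.

(** The deviation is a sum of independent centred terms, one for each
    observation of [S]. *)
Lemma variance_empirical (S : member SS) (g : grid_of N (val S) -> R) :
  E (fun y => (\sum_k (empirical_mass y (point S k) - q (point S k)) * g k) ^+ 2) =
  (n (val S))%:R^-1 * (\sum_k q (point S k) * g k ^+ 2 - (\sum_k q (point S k) * g k) ^+ 2).
Proof.
set m := \sum_k q (point S k) * g k.
pose g' (t : T) : R := \sum_k g k * (t == point S k)%:R.
have g'E k : g' (point S k) = g k.
  rewrite /g' (bigD1 k)//= eqxx mulr1 big1 ?addr0// => k' k'k.
  by rewrite (_ : _ == _ = false) ?mulr0//; apply: contraNF k'k => /eqP h; rewrite (eq_from_Tagged h).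
have g'0 t : tag t != S -> g' t = 0.
  move=> tS; rewrite /g' big1// => k _; rewrite (_ : _ == _ = false) ?mulr0//.
  by apply: contraNF tS => /eqP->.
have sumg' (w : T -> R) (h : R -> R) : h 0 = 0 ->
    \sum_t w t * h (g' t) = \sum_k w (point S k) * h (g k).
  move=> h0; rewrite sum_mass_coord (bigD1 S)//= [X in _ + X]big1 ?addr0.
    by apply: eq_bigr => k _; rewrite g'E.
  by move=> S' S'S; apply: big1 => k _; rewrite g'0// h0 mulr0.
pose a (j : sample) (t : T) : R :=
  if tag j == S then (size_of j)^-1 * (g' t - m) else 0.
have nS : (n (val S))%:R != 0 :> R by rewrite pnatr_eq0 -lt0n n_gt0 ?(valP S).
have sumS (F : R) : \sum_(j : sample | tag j == S) (size_of j)^-1 * F = F.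
  rewrite big_mkcond (eq_bigr (fun j => (size_of j)^-1 * (if tag j == S then F else 0))).
    by rewrite (sum_sample_size (fun S' => if S' == S then F else 0)) -big_mkcond big_pred1_eq.
  by move=> j _; case: ifP; rewrite ?mulr0.
have aE y : \sum_k (empirical_mass y (point S k) - q (point S k)) * g k =
    \sum_j a j (y j).
  rewrite (eq_bigr (fun k => empirical_mass y (point S k) * g k - q (point S k) * g k)).
    rewrite sumrB -/m -(sumg' (empirical_mass y) id)// sum_empirical /a -big_mkcond /=.
    under [RHS]eq_bigr do rewrite mulrBr.
    rewrite sumrB sumS; congr (_ - _); rewrite [RHS]big_mkcond; apply: eq_bigr => j _.
    case: eqP => [jS|/eqP jS].
      rewrite /right_tag; case: eqP => [_|/eqP h]; first by rewrite mulr1.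
      have yS : tag (y j) != S by rewrite -jS.
      by rewrite (g'0 _ yS) !mulr0.
    rewrite /right_tag; case: eqP => [h|_]; last by rewrite mulr0 mul0r.
    by rewrite g'0 ?mulr0// h.
  by move=> k _; rewrite mulrBl.
have sumg (h : R -> R) j : tag j == S -> h 0 = 0 ->
    \sum_t sample_law j t * h (g' t) = \sum_k q (point S k) * h (g k).
  move=> jS h0; rewrite sumg'//; apply: eq_bigr => k _.
  by rewrite /sample_law /= eq_sym jS.
have a0 j : \sum_t sample_law j t * a j t = 0.
  rewrite /a; have [jS|_] := boolP (tag j == S); last by rewrite big1// => t _; rewrite mulr0.
  rewrite (eq_bigr (fun t => (size_of j)^-1 * (sample_law j t * g' t - sample_law j t * m))).
    rewrite -mulr_sumr sumrB (sumg id)// -mulr_suml sample_law_sum1 mul1r.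
    by rewrite subrr mulr0.
  by move=> t _; ring.
transitivity (E (fun y => (\sum_j a j (y j)) ^+ 2)).
  by apply: eq_bigr => y _; rewrite aE.
rewrite (expectation_sqr_sum sample_law_sum1 a0).
rewrite -[RHS]sumS [RHS]big_mkcond; apply: eq_bigr => j _; rewrite /a.
have [jS|_] := boolP (tag j == S); last by rewrite big1// => t _; rewrite expr0n mulr0.
rewrite (eq_bigr (fun t => (size_of j)^-1 ^+ 2 *
  (sample_law j t * g' t ^+ 2 - sample_law j t * g' t * (2 * m) + sample_law j t * m ^+ 2))).
  rewrite -mulr_sumr big_split /= sumrB -!mulr_suml sample_law_sum1 (sumg id)//.
  rewrite (sumg (fun x => x ^+ 2)) ?expr0n// -/m (eqP jS) expr2 -mulrA.
  by congr (_ * (_ * _)); ring.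
by move=> t _; ring.
Qed.

Lemma sum_empirical_update y j t (g : T -> R) : right_tag j t ->
  \sum_u empirical_mass (update y j t) u * g u =
  (size_of j)^-1 * g t + \sum_(i | i != j) (size_of i)^-1 * (right_tag i (y i))%:R * g (y i).
Proof.
move=> jt; rewrite sum_empirical (bigD1 j)//= ffunE eqxx jt mulr1; congr (_ + _).
by apply: eq_bigr => i /negbTE ij; rewrite ffunE ij.
Qed.

Section bounded_differences.
Variable f : T -> R.
Hypothesis fN : normalized f.

(** A normalized function is constant on a lone member, whose observations thus
    have no influence. *)
Definition difference_bound (j : sample) : R :=
  if lone SS (val (tag j)) then 0 else (size_of j)^-1.

(** The values of [f] lie in an interval of length [s], which cancels the factor
    [s^-1] of the index. *)
Lemma discrete_index_differences y j t t' : right_tag j t -> right_tag j t' ->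
  discrete_index (empirical_mass (update y j t)) f <=
  discrete_index (empirical_mass (update y j t')) f + difference_bound j.
Proof.
move=> jt jt'.
pose X := \sum_(i | i != j) (size_of i)^-1 * (right_tag i (y i))%:R * f (y i).
have updE u : right_tag j u ->
    discrete_index (empirical_mass (update y j u)) f = - (s^-1 * ((size_of j)^-1 * f u + X)).
  by move=> ju; rewrite /discrete_index sum_empirical_update.
have le_eq (a b a' b' c : R) : a = a' -> b = b' -> a' <= b' + c -> a <= b + c.
  by move=> -> ->.
apply: (le_eq _ _ _ _ _ (updE t jt) (updE t' jt')).
set c := (size_of j)^-1; rewrite -lerBlDl.
rewrite (_ : _ - _ = s^-1 * c * (f t' - f t)); last by ring.
have c0 : 0 <= c by rewrite invr_ge0.
rewrite /difference_bound; case: ifPn => jl.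
  suff -> : f t = f t' by rewrite subrr mulr0.
  case: fN => _ _ /(_ _ jl); move: jt jt' => /eqP jt /eqP jt'.
  by case: t jt => S k /= jt; case: t' jt' => S' k' /= jt'; subst S S'; exact.
rewrite -/c mulrC mulrA -[leRHS]mul1r ler_wpM2r// ler_pdivrMr ?ltr0n// mul1r.
by case: fN => -[f1 _] fs _; have := f1 t; have := fs t'; lra.
Qed.

End bounded_differences.

End sampling.

Section index_of_samples.
Variables (R : realType) (d : nat) (N : 'I_d -> nat) (SS : {set {set 'I_d}}).
Hypothesis N_gt0 : forall j, (0 < N j)%N.
Hypothesis SS_gt0 : (0 < #|SS|)%N.

Notation K := (grid N (@id 'I_d)).
Notation T := (mass_coord N SS).
Notation s := (#|SS|%:R : R).
Notation point S k := (Tagged (fun S0 : member SS => grid_of N (val S0)) (i := S) k).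

(** The maximum starts from zero, the index of the constant function zero. *)
Definition index_max (Phi : seq {ffun T -> R}) (w : T -> R) : R :=
  \big[Num.max/0]_(f <- Phi) discrete_index w f.

Lemma index_max_ge0 Phi w : 0 <= index_max Phi w.
Proof.
rewrite /index_max; elim: Phi => [|f Phi IH]; first by rewrite big_nil.
by rewrite big_cons le_max IH orbT.
Qed.

Lemma index_max_ge Phi w (f : {ffun T -> R}) : f \in Phi -> discrete_index w f <= index_max Phi w.
Proof.
rewrite /index_max; elim: Phi => [//|g Phi IH]; rewrite in_cons big_cons le_max.
by case/predU1P => [->|/IH->]; rewrite ?lexx ?orbT.
Qed.

Lemma index_max_le Phi w (c : R) : 0 <= c ->
  (forall f : {ffun T -> R}, f \in Phi -> discrete_index w f <= c) -> index_max Phi w <= c.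
Proof.
move=> c0; rewrite /index_max; elim: Phi => [|g Phi IH] h; first by rewrite big_nil.
rewrite big_cons ge_max h ?mem_head//= IH// => f fP; apply: h.
by rewrite in_cons fP orbT.
Qed.

Variable n : {set 'I_d} -> nat.
Hypothesis n_gt0 : forall S, S \in SS -> (0 < n S)%N.
Variable q : T -> R.
Hypothesis q_ge0 : forall t, 0 <= q t.
Hypothesis q_mass : forall S, mass q S = 1.

Local Notation E := (expectation (@sample_law R d N SS n q)).
Local Notation emp := (@empirical_mass R d N SS n).
Local Notation bound := (@difference_bound R d SS n).

Let law0 := @sample_law_ge0 R d N SS n q q_ge0.
Let law1 := @sample_law_sum1 R d N SS n q q_mass.
Let supp := @sample_law_supp R d N SS n q.

Variable Phi : seq {ffun T -> R}.
Hypothesis PhiN : forall f : {ffun T -> R}, f \in Phi -> normalized f.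

Let Z (y : {ffun sample SS n -> T}) : R := index_max Phi (emp y).

Lemma difference_bound_ge0 j : 0 <= bound j.
Proof. by rewrite /difference_bound; case: ifP => // _; rewrite invr_ge0. Qed.

Lemma index_max_differences y j t t' : right_tag j t -> right_tag j t' ->
  Z (update y j t) <= Z (update y j t') + bound j.
Proof.
move=> jt jt'; apply: index_max_le.
  by rewrite addr_ge0 ?index_max_ge0 ?difference_bound_ge0.
move=> f fP; apply: le_trans (discrete_index_differences SS_gt0 (PhiN fP) y jt jt') _.
by rewrite lerD2r index_max_ge.
Qed.

Lemma sum_sqr_difference_bound :
  \sum_j bound j ^+ 2 = \sum_(S : member SS | ~~ lone SS (val S)) (n (val S))%:R^-1.
Proof.
rewrite (eq_bigr (fun j : sample SS n => (n (val (tag j)))%:R^-1 *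
  (if lone SS (val (tag j)) then 0 else (n (val (tag j)))%:R^-1))).
  rewrite (sum_sample_size n_gt0 (fun S => if lone SS (val S) then 0 else (n (val S))%:R^-1)).
  by rewrite [RHS]big_mkcond; apply: eq_bigr => S _; case: ifP.
by move=> j _; rewrite /difference_bound; case: ifP; rewrite ?expr0n ?mulr0 ?expr2.
Qed.

Lemma index_max_upper_tail V t : 0 < V ->
  \sum_(S : member SS | ~~ lone SS (val S)) (n (val S))%:R^-1 <= V -> 0 <= t ->
  E (fun y => (E Z + t <= Z y)%R%:R) <= expR (- (2 * t ^+ 2 / V)).
Proof.
move=> V0 bV t0; apply: (mcdiarmid law0 law1 supp (c := bound)) => //.
  by move=> y j u u' ju ju'; rewrite lerBlDl; exact: index_max_differences.
by rewrite sum_sqr_difference_bound.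
Qed.

Lemma index_max_lower_tail V t : 0 < V ->
  \sum_(S : member SS | ~~ lone SS (val S)) (n (val S))%:R^-1 <= V -> 0 <= t ->
  E (fun y => (Z y <= E Z - t)%R%:R) <= expR (- (2 * t ^+ 2 / V)).
Proof.
move=> V0 bV t0.
have -> : E (fun y => (Z y <= E Z - t)%R%:R) =
    E (fun y => (E (fun y => - Z y) + t <= - Z y)%R%:R).
  apply: eq_bigr => y _; congr (_ * _%:R); congr nat_of_bool.
  by rewrite expectationN -[RHS]lerN2 opprK opprD opprK.
apply: (mcdiarmid law0 law1 supp (c := bound)) => //.
  move=> y j u u' ju ju'; rewrite opprK addrC lerBlDl.
  exact: index_max_differences.
by rewrite sum_sqr_difference_bound.
Qed.

(** A maximum of linear functions is convex, and the empirical masses are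
    unbiased. *)
Lemma index_max_le_expectation : index_max Phi q <= E Z.
Proof.
apply: index_max_le; first by apply: (expectation_ge0 law0) => y; exact: index_max_ge0.
move=> f fP; rewrite -(expectation_discrete_index n_gt0 q_mass).
by apply: (le_expectation law0) => y; exact: index_max_ge.
Qed.

(** By the Cauchy-Schwarz inequality and the variance of the binomial law, as
    [\sum_k q k * (1 - q k) <= 1 - #|K|^-1]. *)
Lemma expectation_norm1 (S : member SS) :
  E (fun y => \sum_k `|emp y (point S k) - q (point S k)|) <=
  Num.sqrt ((#|grid_of N (val S)|%:R - 1) / (n (val S))%:R).
Proof.
apply: (expectation_le_sqrt law0 law1).
set c := #|grid_of N (val S)|%:R.
have c0 : 0 < c :> R.
  by rewrite ltr0n; apply/card_gt0P; exists (restrict (val S) (grid_inhabited N_gt0)).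
apply: (@le_trans _ _ (E (fun y => c * \sum_k (emp y (point S k) - q (point S k)) ^+ 2))).
  apply: (le_expectation law0) => y; apply: le_trans (sqr_sum_le _ _) _.
  rewrite ler_wpM2l ?ler0n//.
  by apply: ler_sum => k _; rewrite real_normK ?num_real.
rewrite expectationZ (expectation_sum _ _ _ (fun k y => (emp y (point S k) - q (point S k)) ^+ 2)).
have var k : E (fun y => (emp y (point S k) - q (point S k)) ^+ 2) =
    (n (val S))%:R^-1 * (q (point S k) - q (point S k) ^+ 2).
  have delta (F : grid_of N (val S) -> R) : \sum_i F i * (i == k)%:R = F k.
    rewrite (bigD1 k)//= eqxx mulr1 big1 ?addr0// => i /negbTE->.
    by rewrite mulr0.
  have := variance_empirical n_gt0 q_mass (fun i : grid_of N (val S) => (i == k)%:R).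
  rewrite delta (eq_bigr (fun i => q (point S i) * (i == k)%:R)) => [|i _]; last first.
    by case: (i == k); rewrite ?expr1n// expr0n.
  rewrite delta => <-; apply: eq_bigr => y _; congr (_ * _ ^+ 2).
  by rewrite (delta (fun i => emp y (point S i) - q (point S i))).
under eq_bigr do rewrite var.
rewrite -mulr_sumr mulrCA mulrC ler_wpM2r ?invr_ge0 ?ler0n//.
rewrite sumrB -[X in X - _]/(mass q S) q_mass mulrBr mulr1 lerD2l lerN2.
have := sqr_sum_le xpredT (fun k => q (point S k)).
by rewrite -[X in X ^+ 2 <= _]/(mass q S) q_mass expr1n.
Qed.

Hypothesis q_compatible : exists2 p, (forall x, 0 <= p x) & q =1 marginal_at p.

Lemma compatible_index_le0 f : admissible f -> discrete_index q f <= 0.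
Proof.
move=> fA; have [p p0 qE] := q_compatible.
by rewrite (_ : q = marginal_at p) ?discrete_index_marginal_at_le0//; apply/funext.
Qed.

(** Compatible masses have a nonpositive index, and indices of two families
    differ by at most half of their distance in total variation, because the
    values of [f] are within [s / 2] of [(s - 2) / 2]. *)
Lemma expectation_index_le_tv : E Z <=
  2^-1 * \sum_(S : member SS) Num.sqrt ((#|grid_of N (val S)|%:R - 1) / (n (val S))%:R).
Proof.
apply: (@le_trans _ _ (E (fun y => 2^-1 * \sum_(S : member SS)
    \sum_k `|emp y (point S k) - q (point S k)|))); last first.
  rewrite expectationZ ler_wpM2l ?invr_ge0//.
  rewrite (expectation_sum _ _ _ (fun S y => \sum_k `|emp y (point S k) - q (point S k)|)).
  by apply: ler_sum => S _; exact: expectation_norm1.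
apply: (le_expectation_supp law0 supp) => y yT.
apply: index_max_le.
  by rewrite mulr_ge0 ?invr_ge0// sumr_ge0// => S _; exact: sumr_ge0.
move=> f fP; have [fA fs _] := PhiN fP.
rewrite -(sum_mass_coord (fun t => `|emp y t - q t|)).
have : discrete_index (emp y) f <= discrete_index (emp y) f - discrete_index q f.
  by rewrite lerBrDr gerDl compatible_index_le0.
move/le_trans; apply.
have shift (w : T -> R) : (forall S, mass w S = 1) ->
    discrete_index w f = - (s^-1 * \sum_t w t * (f t - (s - 2) / 2)) - (s - 2) / 2.
  move=> w1; rewrite /discrete_index; under [X in _ = - (_ * X) - _]eq_bigr do rewrite mulrBr.
  rewrite sumrB -mulr_suml (sum_mass w1) mulr1 mulrBr opprB mulrA mulVf ?mul1r.
    by rewrite addrAC subrr add0r.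
  by rewrite pnatr_eq0 -lt0n.
rewrite !shift//; last by move=> S; exact: mass_empirical_mass.
set h := (s - 2) / 2.
have : \sum_t q t * (f t - h) - \sum_t emp y t * (f t - h) <=
    s * (2^-1 * \sum_t `|emp y t - q t|).
  rewrite -sumrB mulrA mulr_sumr ler_sum// => t _; rewrite -mulrBl.
  apply: le_trans (ler_norm _) _; rewrite normrM distrC mulrC ler_wpM2r//.
  by rewrite ler_norml /h; have := fA.1 t; have := fs t; lra.
rewrite -ler_pdivrMl ?ltr0n// mulrBr; lra.
Qed.

End index_of_samples.

(** * From empirical to consistent families *)

Section correction_of_marginals.
Variables (R : realType) (d : nat) (N : 'I_d -> nat) (SS : {set {set 'I_d}}).
Hypothesis N_gt0 : forall j, (0 < N j)%N.
Hypothesis SS_gt0 : (0 < #|SS|)%N.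

Notation K := (grid N (@id 'I_d)).
Notation T := (mass_coord N SS).
Notation s := (#|SS|%:R : R).
Notation point S k := (Tagged (fun S0 : member SS => grid_of N (val S0)) (i := S) k).

Definition common (S S' : {set 'I_d}) : pred (idx S) := fun i => val i \in S'.

Lemma agree_common (S S' : {set 'I_d}) (x y : grid_of N S) (k : grid_of N (S :&: S')) :
  agree x k -> agree y k = agree_on (@common S S') x y.
Proof.
move=> /'forall_forallP xk; apply/idP/idP => [/'forall_forallP yk|/agree_onP xy].
  apply/agree_onP => i iS'; have iI : val i \in S :&: S' by rewrite inE (valP i).
  have := xk i (Sub (val i) iI); have := yk i (Sub (val i) iI); rewrite /= eqxx /=.
  by move=> /eqP yi /eqP xi; apply: val_inj; rewrite /= xi yi.
apply/'forall_forallP => i j; apply/implyP => ij; have := xk i j; rewrite ij /=.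
rewrite xy//; move/eqP : ij; rewrite /common => ->.
by have := valP j; rewrite inE => /andP[].
Qed.

Lemma agree_extension (S S' : {set 'I_d}) (k : grid_of N S') : S' \subset S ->
  agree (restrict S (extension N_gt0 k)) k.
Proof. by move=> S'S; rewrite agree_restrict_sub// agree_restrict extensionK. Qed.

Lemma marginal_of_average (S S' : {set 'I_d}) (a b : grid_of N S -> R) :
  average (@common S S') a =1 average (@common S S') b ->
  forall k : grid_of N (S :&: S'), marginal a k = marginal b k.
Proof.
move=> ab k; have xk := agree_extension k (finset.subsetIl S S').
rewrite /marginal !(eq_bigl _ _ (fun y => agree_common y xk)).
have := ab (restrict S (extension N_gt0 k)); rewrite /average.
by move/(mulfI _); apply; rewrite invr_neq0// fibre_card_neq0.
Qed.

Lemma card_grid_common (S S' : {set 'I_d}) (x : grid_of N S) :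
  #|grid_of N S| = (#|grid_of N (S :&: S')| * fibre_card (@common S S') x)%N.
Proof.
rewrite -sum1_card (eq_bigr (fun y : grid_of N S => \sum_(k : grid_of N (S :&: S') | agree y k) 1%N)).
  rewrite (exchange_big_dep xpredT)//= -sum_nat_const; apply: eq_bigr => k _.
  have xk := agree_extension k (finset.subsetIl S S').
  rewrite (fibre_cardE _ x (restrict S (extension N_gt0 k))) /fibre_card -sum1_card.
  by apply: eq_bigl => y; rewrite (agree_common y xk).
move=> y _; pose k0 : grid_of N (S :&: S') := restrict (S :&: S') (extension N_gt0 y).
have yE : y = restrict S (extension N_gt0 y) by rewrite extensionK.
rewrite (big_pred1 k0)// => k; rewrite {1}yE agree_restrict_sub ?finset.subsetIl//.
by rewrite agree_restrict eq_sym.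
Qed.

Lemma sum_average_total (S : {set 'I_d}) (A : pred (idx S)) (a : grid_of N S -> R) :
  \sum_x average A a x = \sum_x a x.
Proof.
transitivity (\sum_x average A a x * 1); first by apply: eq_bigr => x _; rewrite mulr1.
rewrite (average_selfadjoint A a (fun=> 1)); apply: eq_bigr => x _.
by rewrite /average sumr_const -[_ *+ _]mulr_natr mul1r mulVf ?mulr1// fibre_card_neq0.
Qed.

Definition overlapping (S : member SS) : seq (member SS) :=
  [seq S' <- enum (member SS) | (S' != S) && ~~ [disjoint val S & val S']].

Definition marginal_correction (S : member SS) (a : grid_of N (val S) -> R) :=
  correction [seq @common (val S) (val S') | S' : member SS <- overlapping S] a.

Lemma sum_marginal_correction S (a : grid_of N (val S) -> R) :
  \sum_x a x = 0 -> \sum_x marginal_correction a x = 0.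
Proof.
rewrite /marginal_correction; case: (overlapping S) => [_|S' l a0].
  by rewrite big1// => x _; rewrite /correction /= subrr.
set c := correction _ _; rewrite -(sum_average_total (@common (val S) (val S')) c).
rewrite (eq_bigr (average (@common (val S) (val S')) a)) ?sum_average_total// => x _.
by rewrite average_correction// in_cons eqxx.
Qed.

Lemma average_marginal_correction S S' (a : grid_of N (val S) -> R) x :
  S' != S -> ~~ [disjoint val S & val S'] ->
  average (@common (val S) (val S')) (marginal_correction a) x =
  average (@common (val S) (val S')) a x.
Proof.
move=> S'S dSS'; rewrite average_correction//; apply: map_f.
by rewrite mem_filter S'S dSS' mem_enum.
Qed.

Section perturbation.
Variable F : seq {ffun T -> R}.
Hypothesis FN : forall f : {ffun T -> R}, f \in F -> normalized f.
Hypothesis F_dual : forall w f (c : R), consistent w -> (forall t, 0 <= w t) ->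
  admissible f -> 0 <= c ->
  (forall g : {ffun T -> R}, g \in F -> discrete_index w g <= c) -> discrete_index w f <= c.

Variables e q : T -> R.
Hypothesis e_ge0 : forall t, 0 <= e t.
Hypothesis e_mass : forall S, mass e S = 1.
Hypothesis q_mass : forall S, mass q S = 1.
Hypothesis q_consistent : consistent q.

Let delta (t : T) : R :=
  marginal_correction (fun x => q (point (tag t) x) - e (point (tag t) x)) (tagged t).
Let Delta : R := \sum_t `|delta t|.
Let U (x : K) : R := \sum_t `|delta t| * (x == extension N_gt0 (tagged t))%:R.
Let v (t : T) : R := e t + delta t + marginal_at U t.

Let U_ge0 x : 0 <= U x.
Proof. by apply: sumr_ge0 => t _; rewrite mulr_ge0 ?ler0n. Qed.

Let sum_U : \sum_x U x = Delta.
Proof.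
rewrite exchange_big /=; apply: eq_bigr => t _; rewrite -mulr_sumr.
rewrite (bigD1 (extension N_gt0 (tagged t)))//= eqxx big1 ?addr0 ?mulr1//.
by move=> x /negbTE->.
Qed.

Let marginal_U t : `|delta t| <= marginal_at U t.
Proof.
rewrite /marginal_at (bigD1 (extension N_gt0 (tagged t)))/=; last first.
  by rewrite /coord extensionK; case: t.
rewrite -[leLHS]addr0 lerD//; last exact: sumr_ge0.
rewrite /U (bigD1 t)//= eqxx mulr1 lerDl.
by apply: sumr_ge0 => u _; rewrite mulr_ge0 ?ler0n.
Qed.

Let v_ge0 t : 0 <= v t.
Proof.
rewrite /v -addrA addr_ge0//; apply: le_trans (_ : 0 <= delta t + `|delta t|) _.
  by rewrite -lerBlDl sub0r -normrN ler_norm.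
by rewrite lerD2l.
Qed.

Let delta_mass S : mass delta S = 0.
Proof.
apply: sum_marginal_correction; rewrite sumrB.
by rewrite -/(mass q S) -/(mass e S) q_mass e_mass subrr.
Qed.

Let v_consistent : consistent v.
Proof.
pose w t := e t + delta t.
suff wC : consistent w.
  have := consistent_linear 1 wC (consistent_marginal_at SS U).
  by apply: eq_consistent => t; rewrite mul1r.
have w_mass S : mass w S = 1.
  by rewrite /mass big_split /= -/(mass e S) -/(mass delta S) e_mass delta_mass addr0.
have wq (S S' : member SS) : S' != S -> ~~ [disjoint val S & val S'] ->
    forall k : grid_of N (val S :&: val S'),
    marginal (fun x => w (point S x)) k = marginal (fun x => q (point S x)) k.
  move=> S'S dSS'; apply: marginal_of_average => x.
  pose D x := q (point S x) - e (point S x).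
  have cD := average_marginal_correction D x S'S dSS'.
  transitivity (average (@common (val S) (val S')) (fun x => e (point S x)) x +
      average (@common (val S) (val S')) (marginal_correction D) x).
    exact: averageD.
  by rewrite cD averageB addrC subrK.
split=> [S1 S2 d12 k|S1 S2]; last by rewrite !w_mass.
have [e12|n12] := eqVneq S1 S2; first by move: k; rewrite -e12 => k.
rewrite wq//; last by rewrite eq_sym.
rewrite (q_consistent.1 S1 S2 d12 k).
have d21 : ~~ [disjoint val S2 & val S1] by rewrite disjoint_sym.
have := wq S2 S1 n12 d21; move: k; rewrite [val S1 :&: val S2]finset.setIC => k.
by move=> ->.
Qed.

Let small_index f : normalized f -> `|discrete_index delta f| <= Delta.
Proof.
move=> fN; rewrite /discrete_index normrN normrM gtr0_norm ?invr_gt0 ?ltr0n//.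
rewrite ler_pdivrMl ?ltr0n// mulr_sumr; apply: le_trans (ler_norm_sum _ _ _) _.
apply: ler_sum => t _; rewrite normrM mulrC ler_wpM2r//.
exact: normalized_norm.
Qed.

(** The empirical family is moved onto a consistent one in two steps: [delta]
    gives it the marginals of the truth, and the marginals of [U], a measure on
    the whole grid, make up for the negative masses. Adding a compatible family
    never increases an index. *)
Lemma index_le_facets f : normalized f ->
  discrete_index e f <= index_max F e + (s + 1) * Delta.
Proof.
move=> fN; have [fA fs _] := fN.
have Delta0 : 0 <= Delta by apply: sumr_ge0.
have vE g : discrete_index v g =
    discrete_index e g + discrete_index delta g + discrete_index (marginal_at U) g.
  rewrite -!discrete_indexD; congr discrete_index.
have : discrete_index v f <= index_max F e + Delta.
  apply: F_dual => //; first by rewrite addr_ge0 ?index_max_ge0.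
  move=> g gF; have [gA _ _] := FN gF.
  rewrite vE -[leRHS]addr0 lerD//; last exact: discrete_index_marginal_at_le0.
  rewrite lerD ?index_max_ge//.
  by apply: le_trans (ler_norm _) _; exact/small_index/FN.
have UE : - discrete_index (marginal_at U) f <= s * Delta - Delta.
  rewrite /discrete_index opprK ler_pdivrMl ?ltr0n// sum_marginal_at -sum_U.
  have -> : s * (s * \sum_x U x - \sum_x U x) = \sum_x U x * (s * (s - 1)).
    by rewrite -mulr_suml; ring.
  apply: ler_sum => x _; rewrite ler_wpM2l//.
  apply: le_trans (ler_sum _ (fun S _ => fs (coord x S))) _.
  by rewrite sumr_const card_member mulr_natl.
have := small_index fN; rewrite ler_norml => /andP[dE _].
rewrite vE; lra.
Qed.

End perturbation.

End correction_of_marginals.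

Section expected_index.
Variables (R : realType) (d : nat) (N : 'I_d -> nat) (SS : {set {set 'I_d}}).
Hypothesis N_gt0 : forall j, (0 < N j)%N.
Hypothesis SS_gt0 : (0 < #|SS|)%N.

Notation K := (grid N (@id 'I_d)).
Notation T := (mass_coord N SS).
Notation s := (#|SS|%:R : R).
Notation point S k := (Tagged (fun S0 : member SS => grid_of N (val S0)) (i := S) k).

Variable n : {set 'I_d} -> nat.
Hypothesis n_gt0 : forall S, S \in SS -> (0 < n S)%N.
Variable q : T -> R.
Hypothesis q_ge0 : forall t, 0 <= q t.
Hypothesis q_mass : forall S, mass q S = 1.

Local Notation E := (expectation (@sample_law R d N SS n q)).
Local Notation emp := (@empirical_mass R d N SS n).
Local Notation bound := (@difference_bound R d SS n).

Let law0 := @sample_law_ge0 R d N SS n q q_ge0.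
Let law1 := @sample_law_sum1 R d N SS n q q_mass.
Let supp := @sample_law_supp R d N SS n q.

Lemma variance_average (S : member SS) (A : pred (idx (val S))) x :
  E (fun y => average A (fun k => q (point S k) - emp y (point S k)) x ^+ 2) <=
  (n (val S))%:R^-1 * \sum_k q (point S k) *
    ((agree_on A x k)%:R * ((fibre_card A x)%:R^-1 ^+ 2)).
Proof.
pose g (k : grid_of N (val S)) : R := (agree_on A x k)%:R * (fibre_card A x)%:R^-1.
have avgE y : average A (fun k => q (point S k) - emp y (point S k)) x =
    - \sum_k (emp y (point S k) - q (point S k)) * g k.
  rewrite -sumrN [LHS]mulr_sumr [LHS]big_mkcond; apply: eq_bigr => k _; rewrite /g.
  case: (agree_on A x k); last by rewrite mul0r mulr0 oppr0.
  by rewrite mul1r mulrC -mulNr opprB.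
apply: (@le_trans _ _ (E (fun y =>
    (\sum_k (emp y (point S k) - q (point S k)) * g k) ^+ 2))).
  by apply: (le_expectation law0) => y; rewrite avgE sqrrN.
rewrite (variance_empirical n_gt0 q_mass) ler_wpM2l ?invr_ge0 ?ler0n//.
apply: (@le_trans _ _ (\sum_k q (point S k) * g k ^+ 2)).
  by rewrite gerBl sqr_ge0.
rewrite ler_sum// => k _; rewrite /g exprMn ler_wpM2l//.
by case: (agree_on A x k); rewrite ?expr1n// expr0n.
Qed.

(** Averaging over the fibres of [S] over [S :&: S'] divides the variance by
    their size, which leaves the number of fibres in place of the number of
    points. *)
Lemma expectation_average_sqr (S : member SS) (S' : {set 'I_d}) :
  #|grid_of N (val S)|%:R * E (fun y => \sum_x
    average (@common _ (val S) S') (fun k => q (point S k) - emp y (point S k)) x ^+ 2)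
  <= #|grid_of N (val S :&: S')|%:R / (n (val S))%:R.
Proof.
set A := common _.
pose x0 : grid_of N (val S) := restrict (val S) (grid_inhabited N_gt0).
have f0 := fibre_card_neq0 R A x0.
have -> : #|grid_of N (val S :&: S')|%:R / (n (val S))%:R =
    #|grid_of N (val S)|%:R * ((n (val S))%:R^-1 * (fibre_card A x0)%:R^-1) :> R.
  by rewrite (card_grid_common N_gt0 S' x0) natrM mulrCA mulfK// mulrC.
apply: ler_wpM2l; first exact: ler0n.
rewrite (expectation_sum _ _ _ (fun x y =>
  average A (fun k => q (point S k) - emp y (point S k)) x ^+ 2)).
apply: le_trans (ler_sum _ (fun x _ => variance_average A x)) _.
rewrite -mulr_sumr; apply: ler_wpM2l; first by rewrite invr_ge0.
have fibre (k : grid_of N (val S)) : \sum_(x : grid_of N (val S)) (agree_on A x k)%:R * ((fibre_card A x)%:R^-1 ^+ 2) =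
    (fibre_card A x0)%:R^-1 :> R.
  under eq_bigr => x _ do rewrite agree_on_sym (fibre_cardE A x x0).
  rewrite -mulr_suml -natr_sum -big_mkcond /= sum1_card -/(fibre_card A k).
  by rewrite (fibre_cardE A k x0) expr2 mulrA mulfV ?mul1r.
rewrite exchange_big /= le_eqVlt; apply/orP; left; apply/eqP.
transitivity (mass q S * (fibre_card A x0)%:R^-1); last by rewrite q_mass mul1r.
rewrite /mass mulr_suml; apply: eq_bigr => k _.
by rewrite -(fibre k) mulr_sumr.
Qed.

Lemma expectation_correction (S : member SS) :
  E (fun y => \sum_k `|marginal_correction (fun k => q (point S k) - emp y (point S k)) k|)
  <= \sum_(S' <- overlapping S)
       Num.sqrt (#|grid_of N (val S :&: val S')|%:R / (n (val S))%:R).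
Proof.
pose v (S' : member SS) y : R := #|grid_of N (val S)|%:R * \sum_x
  average (@common _ (val S) (val S')) (fun k => q (point S k) - emp y (point S k)) x ^+ 2.
have v0 S' y : 0 <= v S' y.
  by apply: mulr_ge0; [exact: ler0n|apply: sumr_ge0 => x _; exact: sqr_ge0].
have vE S' : E (v S') <= #|grid_of N (val S :&: val S')|%:R / (n (val S))%:R.
  by rewrite /v expectationZ; exact: expectation_average_sqr.
have le_v y : \sum_k `|marginal_correction (fun k => q (point S k) - emp y (point S k)) k| <=
    \sum_(S' <- overlapping S) Num.sqrt (v S' y).
  by apply: le_trans (norm1_correction _ _) _; rewrite big_map.
clearbody v.
apply: le_trans (le_expectation law0 le_v) _.
rewrite (expectation_sum _ _ _ (fun S' y => Num.sqrt (v S' y))).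
apply: ler_sum => S' _; apply: (expectation_le_sqrt law0 law1).
apply: le_trans (vE S'); apply: (le_expectation law0) => y.
by rewrite sqr_sqrtr.
Qed.

End expected_index.

Section expected_maximum.
Variables (R : realType) (d : nat) (N : 'I_d -> nat) (SS : {set {set 'I_d}}).
Hypothesis N_gt0 : forall j, (0 < N j)%N.
Hypothesis SS_gt0 : (0 < #|SS|)%N.

Notation K := (grid N (@id 'I_d)).
Notation T := (mass_coord N SS).
Notation s := (#|SS|%:R : R).
Notation point S k := (Tagged (fun S0 : member SS => grid_of N (val S0)) (i := S) k).

Variable n : {set 'I_d} -> nat.
Hypothesis n_gt0 : forall S, S \in SS -> (0 < n S)%N.
Variable q : T -> R.
Hypothesis q_ge0 : forall t, 0 <= q t.
Hypothesis q_mass : forall S, mass q S = 1.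

Local Notation E := (expectation (@sample_law R d N SS n q)).
Local Notation emp := (@empirical_mass R d N SS n).
Local Notation bound := (@difference_bound R d SS n).

Let law0 := @sample_law_ge0 R d N SS n q q_ge0.
Let law1 := @sample_law_sum1 R d N SS n q q_mass.
Let supp := @sample_law_supp R d N SS n q.

(** Maximal inequality for finitely many sub-Gaussian variables. *)
Lemma expectation_index_max (F : seq {ffun T -> R}) (V : R) (m : nat) :
  (forall f : {ffun T -> R}, f \in F -> normalized f) ->
  (forall f : {ffun T -> R}, f \in F -> discrete_index q f <= 0) ->
  (size F <= m)%N -> (0 < m)%N -> 0 < V ->
  \sum_(S : member SS | ~~ lone SS (val S)) (n (val S))%:R^-1 <= V ->
  E (fun y => index_max F (emp y)) <= Num.sqrt (V * ln (2 * m%:R) / 2).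
Proof.
move=> FN Fq Fm m0 V0 bV; set M := E _.
pose L : R := ln (2 * m%:R); rewrite -/L.
have m2 : 1 < 2 * m%:R :> R.
  by rewrite (@lt_le_trans _ _ 2) ?ltr1n// ler_peMr ?ler1n// ler0n.
have L0 : 0 < L by rewrite ln_gt0.
pose l : R := Num.sqrt (8 * L / V).
have l0 : 0 < l by rewrite sqrtr_gt0 divr_gt0// mulr_gt0.
have l2 : l ^+ 2 = 8 * L / V by rewrite sqr_sqrtr// ltW// divr_gt0// mulr_gt0.
have mgf f : f \in F -> E (fun y => expR (l * discrete_index (emp y) f)) <= expR (l ^+ 2 * V / 8).
  move=> fF; pose G y := discrete_index (emp y) f.
  have Gd : bounded_differences (@right_tag d N SS n) G bound.
    by move=> y j t t' jt jt'; rewrite lerBlDl; exact/(discrete_index_differences SS_gt0 (FN f fF)).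
  apply: le_trans (expectation_mgf law0 law1 supp Gd (ltW l0) (V := V) _); last first.
    by rewrite (sum_sqr_difference_bound R n_gt0).
  apply: (le_expectation law0) => y; rewrite ler_expR ler_wpM2l ?(ltW l0)//.
  have EG : E G <= 0 by rewrite /G (expectation_discrete_index n_gt0 q_mass) Fq.
  by rewrite -[leLHS]subr0; exact: lerB (lexx _) EG.
have : expR (l * M) <= 2 * m%:R * expR (l ^+ 2 * V / 8).
  apply: (@le_trans _ _ (E (fun y => expR (l * index_max F (emp y))))).
    have : 1 <= E (fun y => expR (- (l * M)) * expR (l * index_max F (emp y))).
      have -> : 1 = E (fun y => (1 - l * M) + l * index_max F (emp y)).
        rewrite expectationD expectationZ (expectation_cst law1) -/M.
        by rewrite subrK.
      apply: (le_expectation law0) => y; rewrite -expRD.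
      by rewrite -addrA; exact: expR_ge1Dx.
    by rewrite expectationZ expRN ler_pdivlMl ?expR_gt0// mulr1.
  apply: (@le_trans _ _ (E (fun y => 1 + \sum_(f <- F) expR (l * discrete_index (emp y) f)))).
    apply: (le_expectation law0) => y; rewrite /index_max.
    elim: (F) => [|f F' IH]; first by rewrite !big_nil mulr0 expR0 addr0.
    rewrite !big_cons maxr_pMr ?(ltW l0)//; rewrite [Num.max]/Order.max; case: ifP => _.
      by apply: le_trans IH _; rewrite lerD2l lerDr expR_ge0.
    by rewrite addrCA lerDl addr_ge0// sumr_ge0// => g _; exact: expR_ge0.
  rewrite expectationD (expectation_cst law1).
  rewrite (expectation_sum _ _ _ (fun (f : {ffun T -> R}) y => expR (l * discrete_index (emp y) f))).
  have e1 : 1 <= expR (l ^+ 2 * V / 8).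
    by rewrite -[leLHS]expR0 ler_expR mulr_ge0 ?invr_ge0// mulr_ge0 ?ltW// exprn_gt0.
  have sumF : \sum_(f <- F) E (fun y => expR (l * discrete_index (emp y) f)) <=
      m%:R * expR (l ^+ 2 * V / 8).
    rewrite big_seq; apply: le_trans (ler_sum _ mgf) _.
    rewrite -big_seq big_const_seq count_predT iter_addr_0 -[leLHS]mulr_natl.
    by rewrite ler_wpM2r ?expR_ge0// ler_nat.
  have e2 : 1 <= m%:R * expR (l ^+ 2 * V / 8).
    by apply: (le_trans e1); rewrite ler_peMl ?expR_ge0// ler1n.
  apply: le_trans (lerD e2 sumF) _.
  by rewrite -mulrDl -mulr2n -[_ *+ 2]mulr_natl.
rewrite -[2 * m%:R]lnK ?posrE ?(lt_trans _ m2)// -expRD ler_expR l2 -/L.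
rewrite divfK ?gt_eqF// => h.
have {h} : l * M <= 2 * L by move: h; lra.
rewrite mulrC -ler_pdivlMr// => /le_trans; apply.
rewrite le_eqVlt; apply/orP; left; apply/eqP.
have lp : 0 <= 2 * L / l by rewrite divr_ge0 ?mulr_ge0// ltW.
rewrite -[LHS]ger0_norm// -sqrtr_sqr; congr Num.sqrt.
rewrite exprMn exprVn l2; field; rewrite !gt_eqF//.
Qed.

End expected_maximum.

(** * The two critical values on a finite grid *)

Section critical_values_on_grid.
Variables (R : realType) (d : nat) (N : 'I_d -> nat) (SS : {set {set 'I_d}}).
Hypothesis N_gt0 : forall j, (0 < N j)%N.
Hypothesis SS_gt0 : (0 < #|SS|)%N.

Notation K := (grid N (@id 'I_d)).
Notation T := (mass_coord N SS).
Notation s := (#|SS|%:R : R).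
Notation point S k := (Tagged (fun S0 : member SS => grid_of N (val S0)) (i := S) k).

Variable n : {set 'I_d} -> nat.
Hypothesis n_gt0 : forall S, S \in SS -> (0 < n S)%N.

Definition tv_critical_value (a : R) : R :=
  2^-1 * \sum_(S in SS) Num.sqrt ((#|grid_of N S|%:R - 1) / (n S)%:R) +
  Num.sqrt (2^-1 * ln a^-1 * \sum_(S in SS) (n S)%:R^-1).

Definition min_size : nat :=
  let nmax := \big[maxn/0%N]_(S in SS) n S in \big[minn/nmax]_(S in SS) n S.

Definition overlap_level (a : R) : R :=
  \big[Num.max/0]_(p : {set 'I_d} * {set 'I_d} | overlap SS p.1 p.2)
    ((#|grid_of N (p.1 :&: p.2)|%:R * ln 2 + ln (2 * s * (s - 1) / a))
      / (minn (n p.1) (n p.2))%:R).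

Definition facet_critical_value (a : R) : R :=
  s * Num.sqrt (Num.max
    (2 * ln (Num.max (2 * (nb_essential_facets R N SS)%:R * s / a) 1) / min_size%:R)
    (2 ^+ (2 * #|SS| + 7) * overlap_level a)).

Lemma n_member_gt0 (S : member SS) : (0 < n (val S))%N.
Proof. by apply: n_gt0; exact: (valP S). Qed.

Lemma min_size_le S : S \in SS -> (min_size <= n S)%N.
Proof.
move=> SSS; rewrite /min_size -minEnat -leEnat.
exact: (@bigmin_le_cond _ nat _ _ S (fun S => S \in SS)).
Qed.

Lemma min_size_gt0 : (0 < min_size)%N.
Proof.
have /card_gt0P[S0 S0SS] := SS_gt0.
rewrite /min_size; elim/big_ind: _ => [|x y x0 y0|S /n_gt0//]; last by rewrite leq_min x0.
by apply: leq_trans (n_gt0 S0SS) _; apply: leq_bigmax_cond.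
Qed.

Lemma pairs_ge1 (x : R) : 2 <= x -> 1 <= 2 * x * (x - 1).
Proof. by move=> x2; nra. Qed.

Lemma exp2_double (k : nat) (x : R) :
  2 ^+ (2 * k + 7) * x = (2 ^+ (k + 3)) ^+ 2 * (2 * x).
Proof. by rewrite -exprM mulrA -exprSr mulnDl mulnC -addnS. Qed.

Lemma size_overlapping (S : member SS) : (size (overlapping S) < #|SS|)%N.
Proof.
rewrite size_filter -card_member cardE -(count_predC (fun S' : member SS =>
  (S' != S) && ~~ [disjoint val S & val S']) (enum (member SS))).
rewrite -[ltnLHS]addn0 ltn_add2l -has_count; apply/hasP.
by exists S; rewrite ?mem_enum//= eqxx.
Qed.

(** Makes the bound of [expectation_index_max] comparable with the first term of
    [facet_critical_value]. *)
Lemma facet_log_bound (nb z a m V : R) : 1 <= nb -> 2 <= z -> 0 < a < 1 -> 0 < m ->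
  0 <= V <= z / m -> Num.sqrt (V * ln (2 * nb) / 2) <=
    z * Num.sqrt (2 * ln (Num.max (2 * nb * z / a) 1) / m) / 2.
Proof.
move=> nb1 z2 /andP[a0 a1] m0 /andP[V0 Vz].
set l := ln (Num.max _ _).
have z0 : 0 <= z by apply: le_trans z2.
have nb2 : 1 <= 2 * nb by lra.
have ll : ln (2 * nb) <= l.
  rewrite /l ler_ln ?posrE; last 2 first.
  - by rewrite (lt_le_trans ltr01).
  - by rewrite lt_max ltr01 orbT.
  rewrite le_max; apply/orP; left; rewrite -mulrA ler_peMr ?(le_trans ler01)//.
  by rewrite ler_pdivlMr//; lra.
have l20 : 0 <= ln (2 * nb) by rewrite ln_ge0.
have l0 := le_trans l20 ll.
have -> : z * Num.sqrt (2 * l / m) / 2 = Num.sqrt ((z / 2) ^+ 2 * (2 * l / m)).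
  by rewrite [RHS]sqrtrM ?sqr_ge0// sqrtr_sqr ger0_norm ?divr_ge0// mulrAC.
rewrite ler_wsqrtr//.
have -> : (z / 2) ^+ 2 * (2 * l / m) = z * (z / m * l / 2).
  by field; rewrite gt_eqF.
apply: (@le_trans _ _ (z / m * l / 2)).
  by rewrite ler_wpM2r ?invr_ge0// ler_pM.
rewrite ler_peMl//; last by apply: le_trans z2; rewrite ler1n.
by rewrite !mulr_ge0 ?invr_ge0// ltW.
Qed.

Lemma cubic_split (x y : R) : (x + 1) * (x * (x - 1) * y) <= x ^+ 2 * x * y - x * y.
Proof. by rewrite le_eqVlt; apply/orP; left; apply/eqP; ring. Qed.

Lemma half_double (x y z : R) : x * (2 * y * z) / 2 = y * x * z.
Proof. by field. Qed.

Lemma sqr_le_exp2 k : (k ^ 2 <= 2 ^ (k + 2))%N.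
Proof.
elim: k => [//|[//|[//|[//|k]]] IH]; rewrite addSn expnS.
by apply: leq_trans (leq_mul (leqnn 2) IH); rewrite -!mulnn; nia.
Qed.

Lemma ln2_ge_half : 2^-1 <= ln 2 :> R.
Proof.
rewrite -ler_expR lnK ?posrE// -lef_pV2 ?posrE ?expR_gt0//.
by rewrite -expRN; have := expR_ge1Dx (- 2^-1 : R); lra.
Qed.

Section level.
Variable a : R.
Hypothesis a01 : 0 < a < 1.

Let lna : 0 < ln a^-1.
Proof. by case/andP: a01 => a0 a1; rewrite ln_gt0// invf_gt1. Qed.

Lemma exp_level (V : R) : 0 < V ->
  expR (- (2 * Num.sqrt (2^-1 * ln a^-1 * V) ^+ 2 / V)) = a.
Proof.
move=> V0; rewrite sqr_sqrtr ?mulr_ge0 ?invr_ge0// ?ltW//.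
rewrite (_ : 2 * _ / V = ln a^-1); last by field; rewrite gt_eqF.
case/andP: a01 => a0 _; rewrite lnV ?posrE// opprK lnK//.
Qed.

(** The level dominates both the squared size of the corrections and the squared
    deviation of the statistic, the latter because [ln a^-1] is at most the
    logarithm in the level. *)
Lemma overlap_levelP (S S' : member SS) : S' != S -> ~~ [disjoint val S & val S'] ->
  [/\ #|grid_of N (val S :&: val S')|%:R / (n (val S))%:R <= 2 * overlap_level a,
      (n (val S))%:R^-1 * ln a^-1 <= overlap_level a & (2 <= #|SS|)%N].
Proof.
move=> S'S dSS'.
have s2 : (2 <= #|SS|)%N.
  rewrite (cardD1 (val S)) (valP S) add1n ltnS; apply/card_gt0P; exists (val S').
  by rewrite inE val_eqE S'S (valP S').
have ov : overlap SS (val S) (val S').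
  by rewrite /overlap (valP S) (valP S') val_eqE eq_sym S'S dSS'.
have n0 := n_member_gt0 S; have n0' := n_member_gt0 S'.
pose k : R := #|grid_of N (val S :&: val S')|%:R.
pose l : R := ln (2 * s * (s - 1) / a).
have ll : ln a^-1 <= l.
  case/andP: a01 => a0 _; have s2R : 2 <= s by rewrite (ler_nat _ 2).
  have c1 := pairs_ge1 s2R; have c0 := lt_le_trans ltr01 c1.
  rewrite /l ler_ln ?posrE ?invr_gt0//; last by rewrite divr_gt0.
  by apply: ler_peMl c1; rewrite invr_ge0 ltW.
have k0 : 0 <= k by rewrite ler0n.
have le_level : (k * ln 2 + l) / (minn (n (val S)) (n (val S')))%:R <= overlap_level a.
  rewrite /overlap_level.
  exact: (@le_bigmax_cond _ R _ 0 (val S, val S') (fun p => overlap SS p.1 p.2)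
    (fun p => (#|grid_of N (p.1 :&: p.2)|%:R * ln 2 + l) / (minn (n p.1) (n p.2))%:R)).
have le_n (x : R) : 0 <= x -> x / (n (val S))%:R <= x / (minn (n (val S)) (n (val S')))%:R.
  move=> x0; apply: ler_wpM2l => //.
  by rewrite lef_pV2 ?posrE ?ltr0n ?leq_min ?n0// ler_nat geq_minl.
have kl0 : 0 <= k * ln 2 + l.
  apply: addr_ge0; last exact: le_trans (ltW lna) ll.
  by apply: mulr_ge0 => //; apply: le_trans ln2_ge_half.
have nl : (k * ln 2 + l) / (n (val S))%:R <= overlap_level a := le_trans (le_n _ kl0) le_level.
have l0 := le_trans (ltW lna) ll; have k2 := ler_wpM2l k0 ln2_ge_half.
split=> //; [|apply: le_trans nl].
  apply: (@le_trans _ _ (2 * ((k * ln 2 + l) / (n (val S))%:R))); last by rewrite ler_pM2l.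
  by rewrite [leRHS]mulrA; apply: ler_wpM2r; [rewrite invr_ge0|rewrite -/k; lra].
rewrite mulrC; apply: ler_wpM2r; first by rewrite invr_ge0.
by apply: (le_trans ll); rewrite lerDr (le_trans _ k2)// mulr_ge0// invr_ge0.
Qed.

Lemma not_lone (S : member SS) : ~~ lone SS (val S) ->
  exists2 S' : member SS, S' != S & ~~ [disjoint val S & val S'].
Proof.
move=> /forallPn[S']; rewrite negb_imply => /andP[/andP[S'SS S'S] dis].
by exists (Sub S' S'SS); [rewrite -val_eqE|rewrite disjoint_sym].
Qed.

Variable q : T -> R.
Hypothesis q_ge0 : forall t, 0 <= q t.
Hypothesis q_mass : forall S, mass q S = 1.

Local Notation E := (expectation (@sample_law R d N SS n q)).
Local Notation emp := (@empirical_mass R d N SS n).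

Let law0 := @sample_law_ge0 R d N SS n q q_ge0.
Let law1 := @sample_law_sum1 R d N SS n q q_mass.
Let supp := @sample_law_supp R d N SS n q.

Variable Phi : seq {ffun T -> R}.
Hypothesis PhiN : forall f : {ffun T -> R}, f \in Phi -> normalized f.

Let Z (y : {ffun sample SS n -> T}) : R := index_max Phi (emp y).

Section tails.
Variables (V C : R).
Hypothesis V_gt0 : 0 < V.
Hypothesis V_ge : \sum_(S : member SS | ~~ lone SS (val S)) (n (val S))%:R^-1 <= V.
Let t := Num.sqrt (2^-1 * ln a^-1 * V).

(** [t] is the deviation at which the bound of [mcdiarmid] equals [a]. *)
Lemma rejection_probability : E Z + t <= C -> E (fun y => (C <= Z y)%R%:R) <= a.
Proof.
move=> EC; rewrite -[leRHS](exp_level V_gt0).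
apply: le_trans (index_max_upper_tail SS_gt0 n_gt0 q_ge0 q_mass PhiN V_gt0 V_ge (sqrtr_ge0 _)).
apply: (le_expectation law0) => y; rewrite ler_nat.
by case: (leP C (Z y)) => // CZ; rewrite (le_trans EC CZ).
Qed.

Lemma acceptance_probability c : t <= C -> c + C <= index_max Phi q ->
  E (fun y => (Z y < c)%R%:R) <= a.
Proof.
move=> tC cC; rewrite -[leRHS](exp_level V_gt0).
apply: le_trans (index_max_lower_tail SS_gt0 n_gt0 q_ge0 q_mass PhiN V_gt0 V_ge (sqrtr_ge0 _)).
apply: (le_expectation law0) => y; rewrite ler_nat.
case: (ltP (Z y) c) => // Zc.
have := index_max_le_expectation n_gt0 q_ge0 q_mass Phi => qE.
have : Z y <= E Z - t.
  apply: le_trans (ltW Zc) _; rewrite lerBrDr; apply: le_trans (le_trans cC qE).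
  by rewrite lerD2l.
by move=> ->.
Qed.

End tails.

Let big_member (F : {set 'I_d} -> R) :
  \sum_(S in SS) F S = \sum_(S : member SS) F (val S).
Proof. by rewrite big_sub. Qed.

Let total_variance : R := \sum_(S : member SS) (n (val S))%:R^-1.

Let total_variance_gt0 : 0 < total_variance.
Proof.
have /card_gt0P[S0 S0SS] := SS_gt0.
rewrite /total_variance (bigD1 (Sub S0 S0SS))//= ltr_pwDl ?invr_gt0 ?ltr0n ?n_gt0//.
by apply: sumr_ge0 => S _; rewrite invr_ge0.
Qed.

Let variance_le_total :
  \sum_(S : member SS | ~~ lone SS (val S)) (n (val S))%:R^-1 <= total_variance.
Proof.
by rewrite big_mkcond ler_sum// => S _; case: ifP => // _; rewrite invr_ge0.
Qed.

Lemma tv_acceptance c : c + tv_critical_value a <= index_max Phi q ->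
  E (fun y => (Z y < c)%R%:R) <= a.
Proof.
apply: (acceptance_probability total_variance_gt0 variance_le_total).
rewrite /tv_critical_value !big_member -/total_variance lerDr mulr_ge0 ?invr_ge0//.
by apply: sumr_ge0 => S _; exact: sqrtr_ge0.
Qed.

Lemma tv_rejection : (exists2 p, (forall x, 0 <= p x) & q =1 marginal_at p) ->
  E (fun y => (tv_critical_value a <= Z y)%R%:R) <= a.
Proof.
move=> q_compatible.
apply: (rejection_probability total_variance_gt0 variance_le_total).
rewrite /tv_critical_value !big_member lerD2r.
exact: (expectation_index_le_tv N_gt0 SS_gt0 n_gt0 q_ge0 q_mass PhiN q_compatible).
Qed.

Let overlap_variance : R := \sum_(S : member SS | ~~ lone SS (val S)) (n (val S))%:R^-1.

Hypothesis has_overlap : [exists p : {set 'I_d} * {set 'I_d}, overlap SS p.1 p.2].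

Let overlapping_members : exists S S' : member SS, S' != S /\ ~~ [disjoint val S & val S'].
Proof.
have /existsP[[S S'] /and4P[/= SSS S'SS neq dis]] := has_overlap.
by exists (Sub S SSS), (Sub S' S'SS); rewrite -val_eqE /= eq_sym.
Qed.

Let overlap_level_gt0 : 0 < overlap_level a.
Proof.
have [S [S' [neq dis]]] := overlapping_members.
have [_ h _] := overlap_levelP neq dis; apply: lt_le_trans h.
by rewrite mulr_gt0// invr_gt0 ltr0n n_member_gt0.
Qed.

Let s_ge2 : 2 <= s.
Proof.
have [S [S' [neq dis]]] := overlapping_members.
by have [_ _ h] := overlap_levelP neq dis; rewrite (ler_nat _ 2).
Qed.

Let overlap_variance_gt0 : 0 < overlap_variance.
Proof.
have [S [S' [neq dis]]] := overlapping_members.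
rewrite /overlap_variance (bigD1 S)/=.
  rewrite ltr_pwDl ?invr_gt0 ?ltr0n ?n_member_gt0//.
  by apply: sumr_ge0 => ? _; rewrite invr_ge0.
apply/negP => /forallP/(_ (val S')); rewrite (valP S') val_eqE neq /=.
by rewrite disjoint_sym (negbTE dis).
Qed.

Let root : R := Num.sqrt (2 * overlap_level a).

Let deviation_le : Num.sqrt (2^-1 * ln a^-1 * overlap_variance) <= s * root.
Proof.
have s0 : 0 <= s by rewrite ler0n.
have -> : s * root = Num.sqrt (s ^+ 2 * (2 * overlap_level a)).
  by rewrite sqrtrM ?sqr_ge0// sqrtr_sqr ger0_norm.
rewrite ler_wsqrtr//.
apply: (@le_trans _ _ (2^-1 * (s * overlap_level a))).
  rewrite -mulrA ler_wpM2l ?invr_ge0// mulrC /overlap_variance mulr_suml.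
  have -> : s * overlap_level a = \sum_(S : member SS) overlap_level a.
    by rewrite sumr_const card_member mulr_natl.
  rewrite big_mkcond ler_sum// => S _; case: ifPn => [/not_lone[S' neq dis]|_].
    by have [] := overlap_levelP neq dis.
  exact: ltW.
rewrite !mulrA; apply: ler_wpM2r; first exact: ltW.
rewrite expr2.
have : s <= s * s by rewrite ler_peMl// ler1n.
lra.
Qed.

Let half_budget : s ^+ 2 * s * root <=
  s * Num.sqrt (2 ^+ (2 * #|SS| + 7) * overlap_level a) / 2.
Proof.
rewrite exp2_double sqrtrM ?sqr_ge0// sqrtr_sqr ger0_norm ?exprn_ge0// -/root.
rewrite (_ : s * _ / 2 = 2 ^+ (#|SS| + 2) * s * root).
  apply: ler_wpM2r; first exact: sqrtr_ge0.
  apply: ler_wpM2r; first exact: ler0n.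
  by rewrite -!natrX ler_nat sqr_le_exp2.
by rewrite addnS exprS half_double.
Qed.

Let max_budget (x y : R) : (Num.sqrt x + Num.sqrt y) / 2 <= Num.sqrt (Num.max x y).
Proof.
have := @ler_wsqrtr R x (Num.max x y); have := @ler_wsqrtr R y (Num.max x y).
rewrite !le_max !lexx orbT => /(_ isT) hy /(_ isT) hx; lra.
Qed.

Lemma facet_acceptance c : c + facet_critical_value a <= index_max Phi q ->
  E (fun y => (Z y < c)%R%:R) <= a.
Proof.
apply: (acceptance_probability overlap_variance_gt0 (lexx _)).
apply: le_trans deviation_le _; rewrite /facet_critical_value.
set x := 2 * ln _ / _; set y := 2 ^+ _ * _.
apply: (@le_trans _ _ (s ^+ 2 * s * root)).
  rewrite -mulrA ler_peMl ?mulr_ge0 ?sqrtr_ge0 ?ler0n// exprn_ege1//.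
  by rewrite ler1n.
apply: le_trans half_budget _; rewrite -/y -mulrA ler_wpM2l ?ler0n//.
by apply: le_trans (max_budget x y); have := sqrtr_ge0 x; lra.
Qed.

Hypothesis q_compatible : exists2 p, (forall x, 0 <= p x) & q =1 marginal_at p.

(** The mean of the statistic exceeds that of the maximum over the facets by at
    most the expected size of the corrections. Half of the critical value pays
    for the maximum over the facets, the other half for the corrections and for
    the deviation from the mean. *)
Lemma facet_rejection : E (fun y => (facet_critical_value a <= Z y)%R%:R) <= a.
Proof.
apply: (rejection_probability overlap_variance_gt0 (lexx _)).
have [F0 [F0size F0A F0dual]] := facet_dual_class R N_gt0 SS_gt0.
have [F [Fsize FN F_of]] := normalize_seq N_gt0 F0A.
have F_dual w f (c : R) : consistent w -> (forall t, 0 <= w t) -> admissible f ->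
    0 <= c -> (forall g : {ffun T -> R}, g \in F -> discrete_index w g <= c) ->
    discrete_index w f <= c.
  by move=> wC w0 fA c0 /(F_of w c w0); exact: F0dual.
have qC : consistent q.
  have [p _ qE] := q_compatible.
  by apply: eq_consistent (consistent_marginal_at SS p) => t; rewrite qE.
pose Delta y : R := \sum_(S : member SS)
  \sum_k `|marginal_correction (fun k => q (point S k) - emp y (point S k)) k|.
have EZ : E Z <= E (fun y => index_max F (emp y)) + (s + 1) * E Delta.
  rewrite -expectationZ -expectationD.
  apply: (le_expectation_supp law0 supp) => y yT; apply: index_max_le.
    rewrite addr_ge0 ?index_max_ge0// mulr_ge0 ?addr_ge0 ?ler0n//.
    by apply: sumr_ge0 => S _; exact: sumr_ge0.
  move=> f fP.
  have e1 S : mass (emp y) S = 1 by exact: mass_empirical_mass.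
  have := index_le_facets N_gt0 SS_gt0 FN F_dual (@empirical_mass_ge0 R d N SS n y) e1 q_mass qC (PhiN fP).
  by rewrite sum_mass_coord.
have EDelta : E Delta <= s * (s - 1) * root.
  rewrite /Delta (expectation_sum _ _ _ (fun S y =>
    \sum_k `|marginal_correction (fun k => q (point S k) - emp y (point S k)) k|)).
  have -> : s * (s - 1) * root = \sum_(S : member SS) (s - 1) * root.
    by rewrite sumr_const card_member -[RHS]mulr_natl mulrA.
  apply: ler_sum => S _.
  apply: le_trans (expectation_correction N_gt0 n_gt0 q_ge0 q_mass S) _.
  apply: (@le_trans _ _ (\sum_(S' <- overlapping S) root)).
    rewrite big_seq [leRHS]big_seq; apply: ler_sum => S'.
    rewrite mem_filter => /andP[/andP[neq dis] _].
    by rewrite /root ler_wsqrtr//; have [] := overlap_levelP neq dis.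
  rewrite big_const_seq count_predT iter_addr_0 -[leLHS]mulr_natl.
  rewrite ler_wpM2r ?sqrtr_ge0// lerBrDr natr1 ler_nat.
  exact: size_overlapping.
have EF : E (fun y => index_max F (emp y)) <=
    s * Num.sqrt (2 * ln (Num.max (2 * (nb_essential_facets R N SS)%:R * s / a) 1) / min_size%:R) / 2.
  have [F00|Fn0] := posnP (size F).
    move/size0nil : F00 => ->.
    rewrite (_ : E _ = E (fun=> 0)); last first.
      by apply: eq_bigr => y _; rewrite /index_max big_nil.
    by rewrite (expectation_cst law1) !mulr_ge0 ?invr_ge0 ?ler0n ?sqrtr_ge0.
  have nbF : (size F <= nb_essential_facets R N SS)%N by rewrite Fsize.
  have nb0 := leq_trans Fn0 nbF.
  have Fq f : f \in F -> discrete_index q f <= 0.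
    by move=> /FN[fA _ _]; exact: compatible_index_le0.
  apply: le_trans (expectation_index_max SS_gt0 n_gt0 q_ge0 q_mass FN Fq nbF nb0
    overlap_variance_gt0 (lexx _)) _.
  apply: facet_log_bound s_ge2 a01 _ _; rewrite ?ler1n// ?ltr0n ?min_size_gt0//.
  rewrite ltW//=; have -> : s / min_size%:R = \sum_(S : member SS) min_size%:R^-1.
    by rewrite sumr_const card_member mulr_natl.
  rewrite /overlap_variance big_mkcond; apply: ler_sum => S _; case: ifP => _.
    rewrite lef_pV2 ?posrE ?ltr0n ?min_size_gt0 ?n_member_gt0//.
    by rewrite ler_nat min_size_le// (valP S).
  by rewrite invr_ge0.
apply: (le_trans (lerD EZ deviation_le)).
have -> : facet_critical_value a = s * Num.sqrt (Num.max
    (2 * ln (Num.max (2 * (nb_essential_facets R N SS)%:R * s / a) 1) / min_size%:R)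
    (2 ^+ (2 * #|SS| + 7) * overlap_level a)) by [].
move: EF half_budget; set x := 2 * ln _ / _; set y := 2 ^+ _ * _ => EF hb.
have s0 : 0 <= s by rewrite ler0n.
apply: le_trans (ler_wpM2l s0 (max_budget x y)).
have D : (s + 1) * E Delta <= s ^+ 2 * s * root - s * root.
  apply: (@le_trans _ _ ((s + 1) * (s * (s - 1) * root))).
    by apply: ler_wpM2l EDelta; rewrite addr_ge0.
  by rewrite cubic_split.
have -> : s * ((Num.sqrt x + Num.sqrt y) / 2) = s * Num.sqrt x / 2 + s * Num.sqrt y / 2.
  by rewrite mulrA mulrDr mulrDl.
apply: le_trans (lerD EF hb).
rewrite -addrA lerD2l; apply: le_trans (lerD D (lexx _)) _.
by rewrite subrK.
Qed.

End level.
End critical_values_on_grid.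

(** * Cells of the sample space *)

Lemma integral_step (dT : measure_display) (T : measurableType dT) (R : realType)
    (mu : {measure set T -> \bar R}) (I : finType) (C : I -> set T) (D : set T)
    (f : T -> R) (phi : I -> R) :
  (forall i, measurable (C i)) ->
  (forall i j x, C i x -> C j x -> i = j) ->
  (forall x, D x <-> exists i, C i x) ->
  (forall i x, C i x -> f x = phi i) ->
  (\int[mu]_(x in D) (f x)%:E = \sum_i (phi i)%:E * mu (C i))%E.
Proof.
move=> mC dC DE fphi.
have D_big : D = \big[setU/set0]_(i <- enum I) C i.
  rewrite -bigcup_seq; apply/seteqP; split=> [x /DE[i Ci]|x [i _ Ci]].
    by exists i => //=; rewrite mem_enum.
  by apply/DE; exists i.
have mD : measurable D.
  by rewrite D_big; apply: bigsetU_measurable.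
have mf : measurable_fun D f.
  move=> _ B mB; rewrite (_ : D `&` _ = \bigcup_(i in [set i | B (phi i)]) C i).
    by apply: fin_bigcup_measurable => // ; exact: finite_finset.
  apply/seteqP; split=> [x [/DE[i Ci] /= Bf]|x [i /= Bi Ci]].
    by exists i => //=; rewrite -(fphi i x Ci).
  by split=> /=; [apply/DE; exists i|rewrite (fphi i x Ci)].
rewrite D_big integral_bigsetU_EFin//; last 3 first.
- exact: enum_uniq.
- by move=> i j _ _ [x [Ci Cj]]; exact: dC Ci Cj.
- by rewrite -D_big; exact/measurable_EFinP.
rewrite big_enum /=; apply: eq_bigr => i _.
rewrite (eq_integral (cst (phi i)%:E)) ?integral_cst// => x /set_mem Ci /=.
by rewrite (fphi i x Ci).
Qed.

Lemma measure_partition (dT : measure_display) (T : measurableType dT) (R : realType)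
    (mu : {measure set T -> \bar R}) (I : finType) (C : I -> set T) (D : set T) :
  (forall i, measurable (C i)) ->
  (forall i j x, C i x -> C j x -> i = j) ->
  (forall x, D x <-> exists i, C i x) ->
  (mu D = \sum_i mu (C i))%E.
Proof.
move=> mC dC DE.
have mD : measurable D.
  rewrite (_ : D = \bigcup_(i in setT) C i).
    by apply: fin_bigcup_measurable => //; exact: finite_finset.
  by apply/seteqP; split=> [x /DE[i Ci]|x [i _ Ci]]; [exists i|apply/DE; exists i].
have := @integral_step _ _ _ mu I C D (cst 1) (cst 1) mC dC DE (fun _ _ _ => erefl).
rewrite (eq_integral (cst 1%E)) // integral_cst// mul1e => ->.
by apply: eq_bigr => i _; rewrite mul1e.
Qed.

Section coordinate_cells.
Variables (R : realType) (d0 d : nat) (m : 'I_d -> option nat) (h : 'I_d -> R).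
Hypothesis m_pos : forall (j : 'I_d) (k : nat), (d0 <= j)%N -> m j = Some k -> (1 <= k)%N.
Hypothesis h_pos : forall j : 'I_d, (j < d0)%N -> 0 < h j.
Hypothesis fin : forall j, nlevels d0 m h j != None.

Definition grid_size (j : 'I_d) : nat := odflt 0%N (nlevels d0 m h j).

Lemma nlevelsE (j : 'I_d) : nlevels d0 m h j = Some (grid_size j).
Proof. by rewrite /grid_size; case: (nlevels _ _ _ j) (fin j). Qed.

Lemma grid_size_ge (j : 'I_d) : (j < d0)%N -> (h j)^-1 <= (grid_size j)%:R.
Proof.
move=> jd; rewrite /grid_size /nlevels jd /=.
have : 0 < Num.ceil (h j)^-1 by rewrite ceil_gt_int invr_gt0 h_pos.
move=> c0; apply: le_trans (real_ceil_ge (num_real _)) _.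
by rewrite -[leLHS]/((Num.ceil (h j)^-1)%:~R) -{1}(gtz0_abs c0).
Qed.

Lemma grid_size_gt0 (j : 'I_d) : (0 < grid_size j)%N.
Proof.
have := nlevelsE j; rewrite /nlevels; case: ltnP => [jd _|jd].
  have := grid_size_ge jd; rewrite -(ltr_nat R); apply: lt_le_trans.
  by rewrite invr_gt0 h_pos.
by move/(m_pos jd).
Qed.

Definition coord_cell (j : 'I_d) (v : 'I_(grid_size j)) : set R :=
  if (j < d0)%N then subinterval (h j) v.+1 else [set v.+1%:R].

Lemma measurable_coord_cell j v : measurable (@coord_cell j v).
Proof.
rewrite /coord_cell; case: ifP => _; last exact: measurable_set1.
rewrite (_ : subinterval _ _ = [set` `[(v.+1%:R - 1) * h j, Num.min (v.+1%:R * h j) 1[]).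
  exact: measurable_itv.
by apply/seteqP; split=> x /=; rewrite in_itv.
Qed.

Lemma coord_cell_space j v : @coord_cell j v `<=` coord_space d0 m j.
Proof.
rewrite /coord_cell /coord_space; case: ltnP => jd x /=.
  rewrite /subinterval in_itv /= -natr1 addrK => /andP[xl].
  rewrite lt_min => /andP[_ ->]; rewrite andbT (le_trans _ xl)//.
  by rewrite mulr_ge0 ?ler0n ?ltW ?h_pos.
move=> ->; exists v.+1 => //; rewrite /upto /=.
have := nlevelsE j; rewrite /nlevels ltnNge jd /= => ->.
exact: ltn_ord.
Qed.

Lemma coord_cell_cover j y : coord_space d0 m j y -> exists v, @coord_cell j v y.
Proof.
rewrite /coord_cell /coord_space; case: ltnP => jd /=.
  rewrite in_itv /= => /andP[y0 y1]; have hj := h_pos jd.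
  have yh0 : 0 <= y / h j by rewrite divr_ge0// ltW.
  have /andP[tl tu] := truncn_itv yh0.
  have tN : (Num.truncn (y / h j) < grid_size j)%N.
    rewrite -(ltr_nat R); apply: le_lt_trans tl _.
    apply: lt_le_trans (grid_size_ge jd).
    by rewrite ltr_pdivrMr// mulVf ?gt_eqF.
  exists (Ordinal tN); rewrite /subinterval /= -natr1 addrK natr1.
  by rewrite -ler_pdivlMr// tl lt_min y1 andbT -ltr_pdivrMr.
move=> [k /andP[k1 kN] ky]; have kS : k = k.-1.+1 by rewrite prednK.
have kN' : (k.-1 < grid_size j)%N.
  by move: kN; have := nlevelsE j; rewrite /nlevels ltnNge jd /= => ->; rewrite -kS.
by exists (Ordinal kN'); rewrite /= -kS ky.
Qed.

Lemma coord_cell_inj j v v' y : @coord_cell j v y -> @coord_cell j v' y -> v = v'.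
Proof.
rewrite /coord_cell; case: ltnP => jd /=; last first.
  by move=> -> /eqP; rewrite eqr_nat eqSS => /eqP/val_inj.
have hj := h_pos jd; have side (u w : nat) : (u.+1%:R - 1) * h j <= y ->
    y < w.+1%:R * h j -> (u <= w)%N.
  move=> h1 h2; have := le_lt_trans h1 h2; rewrite ltr_pM2r// -natr1 addrK ltr_nat.
  by rewrite ltnS.
rewrite /subinterval /= !lt_min => /andP[v1 /andP[v2 _]] /andP[v'1 /andP[v'2 _]].
by apply/val_inj/eqP; rewrite eqn_leq (side v v')// (side v' v).
Qed.

Definition coord_point (j : 'I_d) (v : 'I_(grid_size j)) : R :=
  if (j < d0)%N then v%:R * h j else v.+1%:R.

Lemma coord_pointP j v : coord_cell (j := j) v (coord_point v).
Proof.
rewrite /coord_cell /coord_point; case: ifP => jd //.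
rewrite /subinterval /= -[v.+1%:R]natr1 addrK; apply/andP; split=> //.
rewrite lt_min natr1 ltr_pM2r ?h_pos// ltr_nat ltnSn /=.
rewrite -ltr_pdivlMr ?h_pos// mul1r.
have : (Num.ceil (h j)^-1 - 1)%:~R < (h j)^-1 by apply: real_ceilB1_lt; exact: num_real.
apply: le_lt_trans; have := ltn_ord v; rewrite {2}/grid_size /nlevels jd /=.
have c0 : 0 < Num.ceil (h j)^-1 by rewrite ceil_gt_int invr_gt0 h_pos.
rewrite -ltz_nat gtz0_abs// => vc.
have : v%:Z <= Num.ceil (h j)^-1 - 1 by rewrite -ltzD1 subrK.
by rewrite -(ler_int R).
Qed.

(* the default value is taken outside of the coordinate space only *)
Definition coord_index (j : 'I_d) (y : R) : 'I_(grid_size j) :=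
  odflt (Ordinal (grid_size_gt0 j)) [pick v | `[< coord_cell (j := j) v y >]].

Lemma coord_indexP j y v : coord_cell (j := j) v y -> coord_index j y = v.
Proof.
move=> vy; rewrite /coord_index; case: pickP => [w /asboolP wy|/(_ v)/asboolP//].
exact: coord_cell_inj wy vy.
Qed.

Lemma coord_index_cell j y : coord_space d0 m j y -> coord_cell (coord_index j y) y.
Proof. by move=> /coord_cell_cover[v vy]; rewrite (coord_indexP vy). Qed.

End coordinate_cells.

(** * The discretised index of a family of laws *)

Section discretisation.
Variables (R : realType) (d0 d : nat) (m : 'I_d -> option nat) (h : 'I_d -> R).
Hypothesis m_pos : forall (j : 'I_d) (k : nat), (d0 <= j)%N -> m j = Some k -> (1 <= k)%N.
Hypothesis h_pos : forall j : 'I_d, (j < d0)%N -> 0 < h j.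
Hypothesis fin : forall j, nlevels d0 m h j != None.

Notation N := (grid_size d0 m h).

Section boxes.
Variables (I : finType) (e : I -> 'I_d).

Definition cell_box (k : grid N e) : set (pts R I) :=
  [set x | forall i, coord_cell (k i) (x i)].

Definition cell_index (x : pts R I) : grid N e :=
  [ffun i => coord_index m_pos h_pos fin (e i) (x i)].

Definition cell_point (k : grid N e) : pts R I := fun i => coord_point (k i).

Lemma measurable_cell_box k : measurable (cell_box k).
Proof.
rewrite (_ : cell_box k = \bigcap_(i in setT) (fun x : pts R I => x i) @^-1` coord_cell (k i)).
  apply: fin_bigcap_measurable; first exact: finite_finset.
  move=> i _; rewrite -[X in measurable X]setTI; apply: measurable_coord => //.
  exact: measurable_coord_cell.
by apply/seteqP; split=> x kx i => [_|]; exact: kx.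
Qed.

Lemma measurable_space : measurable (@Defs.space R d0 d m I e).
Proof.
rewrite (_ : Defs.space _ _ _ = \bigcap_(i in setT) (fun x : pts R I => x i) @^-1` coord_space d0 m (e i)).
  apply: fin_bigcap_measurable; first exact: finite_finset.
  move=> i _; rewrite -[X in measurable X]setTI; apply: measurable_coord => //.
  exact: measurable_coord_space.
by apply/seteqP; split=> x kx i => [_|]; exact: kx.
Qed.

Lemma cell_box_space k : cell_box k `<=` Defs.space d0 m e.
Proof. by move=> x kx i; exact: (coord_cell_space h_pos fin (kx i)). Qed.

Lemma cell_box_index k x : cell_box k x -> cell_index x = k.
Proof. by move=> kx; apply/ffunP => i; rewrite ffunE; exact: coord_indexP. Qed.

Lemma index_cell_box x : Defs.space d0 m e x -> cell_box (cell_index x) x.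
Proof. by move=> sx i; rewrite ffunE; exact: coord_index_cell. Qed.

Lemma space_cover x : Defs.space d0 m e x <-> exists k, cell_box k x.
Proof.
by split=> [/index_cell_box kx|[k /cell_box_space//]]; exists (cell_index x).
Qed.

Lemma cell_box_inj k k' x : cell_box k x -> cell_box k' x -> k = k'.
Proof. by move=> /cell_box_index <- /cell_box_index <-. Qed.

Lemma cell_pointP k : cell_box k (cell_point k).
Proof. by move=> i; exact: coord_pointP. Qed.

End boxes.

Lemma cell_box_cell (S : {set 'I_d}) (k : grid_of N S) :
  cell_box k = cell d0 h (fun i : idx S => (k i).+1).
Proof.
apply/seteqP; split=> x kx i; have := kx i; rewrite /coord_cell; case: ifP => // _.
Qed.

Lemma cell_grid (S : {set 'I_d}) (k : idx S -> nat) :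
  (forall i, upto (nlevels d0 m h (val i)) (k i)) ->
  exists k' : grid_of N S, cell d0 h k = cell_box k'.
Proof.
move=> kN; have k1 i : (0 < k i)%N by case/andP: (kN i).
have kl i : ((k i).-1 < N (val i))%N.
  by have /andP[_] := kN i; rewrite (nlevelsE fin) prednK.
exists [ffun i => Ordinal (kl i)]; rewrite cell_box_cell; congr cell.
by apply/funext => i; rewrite ffunE /= prednK.
Qed.

Variable SS : {set {set 'I_d}}.
Hypothesis SS_gt0 : (0 < #|SS|)%N.

Notation T := (mass_coord N SS).
Notation point S k := (Tagged (fun S0 : member SS => grid_of N (val S0)) (i := S) k).

Section measures.
Variable mu : forall S : {set 'I_d}, {measure set (pts R (idx S)) -> \bar R}.
Hypothesis mu1 : forall S, S \in SS -> mu S (@space_of R d0 d m S) = 1%E.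

Definition cell_mass (t : T) : R := fine (mu (val (tag t)) (cell_box (tagged t))).

Lemma cell_massE (S : member SS) (k : grid_of N (val S)) :
  mu (val S) (cell_box k) = (cell_mass (point S k))%:E.
Proof.
rewrite /cell_mass fineK// ge0_fin_numE//.
apply: (@le_lt_trans _ _ (mu (val S) (@space_of R d0 d m (val S)))).
  apply: le_measure; rewrite ?inE; [exact: measurable_cell_box|exact: measurable_space|].
  exact: cell_box_space.
by rewrite mu1 ?ltry//; exact: (valP S).
Qed.

Lemma cell_mass_ge0 t : 0 <= cell_mass t.
Proof. exact: fine_ge0. Qed.

Lemma integral_cells (S : member SS) (f : pts R (idx (val S)) -> R) (phi : T -> R) :
  (forall k x, cell_box k x -> f x = phi (point S k)) ->
  (\int[mu (val S)]_(x in @space_of R d0 d m (val S)) (f x)%:E =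
   (\sum_(k : grid_of N (val S)) cell_mass (point S k) * phi (point S k))%:E)%E.
Proof.
move=> fphi.
rewrite (@integral_step _ _ _ (mu (val S)) (grid_of N (val S)) (@cell_box _ val) _ f
  (fun k => phi (point S k))) => //.
- rewrite -sumEFin; apply: eq_bigr => k _.
  by rewrite cell_massE -EFinM mulrC.
- exact: measurable_cell_box.
- by move=> k k' x; exact: cell_box_inj.
- exact: space_cover.
Qed.

Lemma mass_cell_mass S : mass cell_mass S = 1.
Proof.
have := @integral_cells S (cst 1) (cst 1) (fun _ _ _ => erefl).
rewrite (eq_integral (cst 1%E)) // integral_cst; last exact: measurable_space.
rewrite mul1e mu1; last exact: (valP S).
by move=> -[->]; apply: eq_bigr => k _; rewrite mulr1.
Qed.

Lemma index_at_cells (f : forall S, pts R (idx S) -> R) (phi : T -> R) :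
  (forall (S : member SS) k x, cell_box k x -> f (val S) x = phi (point S k)) ->
  index_at d0 m SS mu f = (discrete_index cell_mass phi)%:E.
Proof.
move=> fphi; rewrite /index_at /discrete_index.
rewrite big_sub (eq_bigr (fun S : member SS =>
  (\sum_(k : grid_of N (val S)) cell_mass (point S k) * phi (point S k))%:E)).
  by rewrite sumEFin -EFinM -EFinN (sum_mass_coord (fun t => cell_mass t * phi t)).
by move=> S _; apply: integral_cells => k x; exact: fphi.
Qed.

Lemma proj_cell_box (S : {set 'I_d}) (k : grid N (@id 'I_d)) (z : pts R 'I_d) :
  cell_box k z -> cell_box (restrict S k) (proj_to z : pts R (idx S)).
Proof. by move=> kz i; rewrite ffunE; exact: kz. Qed.

Lemma nonneg_sumE (f : forall S, pts R (idx S) -> R) :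
  nonneg_sum d0 m SS f <->
  forall x, full_space d0 m x -> 0 <= \sum_(S in SS) f S (proj_to x).
Proof.
split=> [h0 x sx|h0].
  rewrite -lee_fin; apply: (le_trans h0); apply: ereal_inf_lbound.
  by exists x.
by apply: le_ereal_inf_tmp => _ [x sx <-]; rewrite lee_fin; exact: h0.
Qed.

(** A function that is constant on cells is a function on the grid, and the
    pointwise constraints on the full space become those on the full grid, as
    every cell contains a point. *)
Lemma incompat_index_hE (Phi : seq {ffun T -> R}) :
  (forall g : {ffun T -> R}, g \in Phi -> normalized g) ->
  (forall w f (M c : R), (forall t, 0 <= w t) -> (forall S, mass w S = M) ->
    admissible f -> (forall g : {ffun T -> R}, g \in Phi -> discrete_index w g <= c) ->
    0 <= c -> discrete_index w f <= c) ->
  incompat_index_h d0 m SS h mu = (index_max Phi cell_mass)%:E.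
Proof.
move=> PhiN PhiP; apply/eqP; rewrite eq_le; apply/andP; split.
  apply: ge_ereal_sup => _ [f [fG f0] <-].
  pose phi (t : T) : R := f (val (tag t)) (cell_point (tagged t)).
  have fphi (S : member SS) k x : cell_box k x -> f (val S) x = phi (point S k).
    move=> kx; have [_ /(_ (fun i => (k i).+1)) fcst] := fG _ (valP S).
    move: fcst; rewrite -cell_box_cell; apply=> // [i|]; last exact: cell_pointP.
    by rewrite (nlevelsE fin) /upto /= ltn_ord.
  rewrite (index_at_cells fphi) lee_fin.
  apply: (PhiP _ _ 1) => [t|S||g gP|]; first exact: cell_mass_ge0.
  - exact: mass_cell_mass.
  - split=> [t|x].
      by have [+ _] := fG _ (valP (tag t)); apply; apply: cell_box_space; exact: cell_pointP.
    have /nonneg_sumE/(_ (cell_point x)) := f0.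
    rewrite big_sub; have xx := @cell_pointP _ id x => /(_ (cell_box_space xx)).
    congr (_ <= _); apply: eq_bigr => S _.
    rewrite (fphi S (restrict (val S) x))//.
    exact: proj_cell_box.
  - exact: index_max_ge.
  - exact: index_max_ge0.
have admissible_le phi : admissible phi ->
    ((discrete_index cell_mass phi)%:E <= incompat_index_h d0 m SS h mu)%E.
  move=> [phi1 phi0].
  pose f (S : {set 'I_d}) : pts R (idx S) -> R :=
    if insub S is Some S' then fun x =>
      phi (point S' [ffun i : idx (val S') => coord_index m_pos h_pos fin (val i)
        (if insub (val i) : option (idx S) is Some i' then x i' else 0)]) else fun=> 0.
  have fE (S : member SS) x : f (val S) x = phi (point S (@cell_index _ val x)).
    rewrite /f valK; congr (phi (point S _)); apply/ffunP => i; rewrite !ffunE.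
    by rewrite valK.
  have fphi (S : member SS) k x : cell_box k x -> f (val S) x = phi (point S k).
    by move=> kx; rewrite fE (cell_box_index kx).
  rewrite -(index_at_cells fphi); apply: ereal_sup_ubound; exists f => //.
  split.
    move=> S SSS; rewrite -[S]/(val (Sub S SSS : member SS)); split=> [x _|].
      by rewrite fE.
    move=> k kN x y; have [k' ->] := cell_grid kN => kx ky.
    by rewrite (fphi _ _ _ kx) (fphi _ _ _ ky).
  apply/nonneg_sumE => x sx; rewrite big_sub.
  apply: le_trans (phi0 (@cell_index _ id x)) _.
  rewrite le_eqVlt; apply/orP; left; apply/eqP; apply: eq_bigr => S _.
  rewrite fE; congr (phi (point S _)).
  by apply/ffunP => i; rewrite !ffunE.
suff : forall c : R, (forall phi, admissible phi -> discrete_index cell_mass phi <= c) ->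
    0 <= c -> index_max Phi cell_mass <= c.
  move=> hc; case E : (incompat_index_h d0 m SS h mu) => [c||].
  - rewrite lee_fin; apply: hc => [phi /admissible_le|].
      by rewrite E lee_fin.
    have : admissible (fun _ : T => 0 : R).
      by split=> [t|x]; rewrite ?lerN10// big1.
    move/admissible_le; rewrite E lee_fin; apply: le_trans.
    by rewrite /discrete_index big1 ?mulr0 ?oppr0// => t _; rewrite mulr0.
  - exact: leey.
  - have : admissible (fun _ : T => 0 : R).
      by split=> [t|x]; rewrite ?lerN10// big1.
    by move/admissible_le; rewrite E.
move=> c hc c0; apply: index_max_le => // g /PhiN[gA _ _]; exact: hc.
Qed.

End measures.

End discretisation.

(** * Observations and the cells that they hit *)

Section samples.
Variables (R : realType) (d0 d : nat) (m : 'I_d -> option nat) (h : 'I_d -> R).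
Hypothesis m_pos : forall (j : 'I_d) (k : nat), (d0 <= j)%N -> m j = Some k -> (1 <= k)%N.
Hypothesis h_pos : forall j : 'I_d, (j < d0)%N -> 0 < h j.
Hypothesis fin : forall j, nlevels d0 m h j != None.

Notation N := (grid_size d0 m h).

Variable SS : {set {set 'I_d}}.
Hypothesis SS_gt0 : (0 < #|SS|)%N.

Notation T := (mass_coord N SS).
Notation point S k := (Tagged (fun S0 : member SS => grid_of N (val S0)) (i := S) k).

Variable n : {set 'I_d} -> nat.
Hypothesis n_gt0 : forall S, S \in SS -> (0 < n S)%N.
Variables (P : forall S : {set 'I_d}, probability (pts R (idx S)) R).
Hypothesis P1 : dist_seq d0 m SS P.
Variables (dO : measure_display) (Omega : measurableType dO) (Pr : probability Omega R).
Variable X : forall S : {set 'I_d}, nat -> Omega -> pts R (idx S).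
Arguments X : clear implicits.
Hypothesis samples : indep_samples d0 m SS n P Pr X.

Notation q := (@cell_mass R d0 d m h SS P).
Notation sample_point S i := (Tagged (fun S0 : member SS => 'I_(n (val S0))) (i := S) i).

Let Xspace S i w : S \in SS -> (i < n S)%N -> space_of d0 m (X S i w).
Proof. by move=> SSS i_lt; have [/(_ S i SSS i_lt)[_]] := samples. Qed.

Definition point_index (S : member SS) (x : pts R (idx (val S))) : T :=
  point S (@cell_index R d0 d m h m_pos h_pos fin _ val x).

Definition sample_index (w : Omega) : {ffun sample SS n -> T} :=
  [ffun j : sample SS n => point_index (X (val (tag j)) (nat_of_ord (tagged j)) w)].

Lemma point_index_cell (S : member SS) (k : grid_of N (val S)) x :
  space_of d0 m x -> (point_index x == point S k) = `[< cell_box k x >].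
Proof.
move=> sx; apply/idP/asboolP => [/eqP e|kx].
  by rewrite -(eq_from_Tagged e); exact: index_cell_box.
by rewrite /point_index (cell_box_index m_pos h_pos fin kx).
Qed.

Lemma empiricalE w S A : empirical n X w S A =
  ((n S)%:R^-1 * \sum_(i < n S) (X S i w \in A)%:R)%:E.
Proof.
rewrite EFinM; congr (_ * _)%E.
by rewrite -sumEFin; apply: eq_bigr => i _; exact: diracE.
Qed.

Lemma empirical_space w S : S \in SS -> empirical n X w S (@space_of R d0 d m S) = 1%E.
Proof.
move=> SSS; rewrite empiricalE (eq_bigr (fun=> 1)) => [|i _].
  by rewrite sumr_const card_ord mulVf ?pnatr_eq0 -?lt0n ?n_gt0.
by rewrite mem_set//; exact: Xspace.
Qed.

Lemma cell_mass_empirical w : cell_mass (empirical n X w) =1 empirical_mass R (sample_index w).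
Proof.
case=> S k; rewrite /cell_mass empiricalE /= /empirical_mass [RHS]big_mkcond sum_sample.
rewrite (bigD1 S)//= [X in _ + X]big1 ?addr0 => [|S' S'S]; last first.
  by rewrite big1 // => i _; rewrite (negbTE S'S).
rewrite mulr_sumr; apply: eq_bigr => i _; rewrite eqxx /=; congr (_ * _%:R).
by rewrite ffunE /= point_index_cell; last exact: Xspace (valP S) _.
Qed.

Let hit (S : member SS) (t : T) : set (pts R (idx (val S))) :=
  [set x | space_of d0 m x /\ point_index x = t].

Let hitE (S : member SS) (t : T) : measurable (@hit S t) /\
  P (val S) (@hit S t) = (if tag t == S then q t else 0)%:E.
Proof.
case: t => S' k; have [/= S'S|/= tS] := eqVneq S' S; last first.
  rewrite (_ : @hit S _ = set0) ?measure0//; apply/seteqP; split=> // x [_].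
  by move/(congr1 tag) => /= xS; rewrite xS eqxx in tS.
case: S / S'S; rewrite (_ : @hit S' _ = cell_box k).
  by split; [exact: measurable_cell_box|exact: cell_massE].
apply/seteqP; split=> x => [[sx /eqP]|].
  by rewrite point_index_cell// => /asboolP.
move=> kx; have sx := cell_box_space h_pos fin kx; split=> //.
by apply/eqP; rewrite point_index_cell//; exact/asboolP.
Qed.

(* no condition at the pairs [(S, i)] that index no observation, so that [target]
   is defined for all of them *)
Let target (y : {ffun sample SS n -> T}) (S : {set 'I_d}) (i : nat) : set (pts R (idx S)) :=
  [set x : pts R (idx S) | forall (SSS : S \in SS) (i_lt : (i < n S)%N),
    @hit (exist _ S SSS) (y (sample_point (exist _ S SSS) (Ordinal i_lt))) x].

Let targetE y (S : member SS) (i : 'I_(n (val S))) :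
  @target y (val S) i = @hit S (y (sample_point S i)).
Proof.
case: S i => S SSS [i i_lt] /=; apply/seteqP; split=> [x /(_ SSS i_lt)//|x hx e1 e2].
by rewrite (bool_irrelevance e1 SSS) (bool_irrelevance e2 i_lt).
Qed.

Let measurable_target y S i : measurable (@target y S i).
Proof.
have [SSS|SSS] := boolP (S \in SS); last first.
  rewrite (_ : target _ _ = setT)//; apply/seteqP; split=> // x _ e1.
  by have := SSS; rewrite e1.
have [i_lt|i_ge] := ltnP i (n S); last first.
  rewrite (_ : target _ _ = setT)//; apply/seteqP; split=> // x _ e1 e2.
  by have := e2; rewrite ltnNge i_ge.
have := @targetE y (exist _ S SSS) (Ordinal i_lt); rewrite /= => ->.
by case: (hitE (exist _ S SSS) (y (sample_point (exist _ S SSS) (Ordinal i_lt)))).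
Qed.

Let preimageE y : [set w | sample_index w = y] =
  \bigcap_(S in [set` SS]) \bigcap_(i in `I_(n S)) X S i @^-1` @target y S i.
Proof.
apply/seteqP; split=> [w <- S /= SSS i /= i_lt e1 e2|w wy].
  by split; [exact: Xspace|rewrite ffunE].
apply/ffunP => -[S i]; rewrite ffunE /=.
have := wy (val S) (valP S) i (ltn_ord i); rewrite /preimage /= targetE.
by case.
Qed.

Lemma measurable_sample_index y : measurable [set w | sample_index w = y].
Proof.
rewrite preimageE; apply: fin_bigcap_measurable; first exact: finite_finset.
move=> S /= SSS; apply: fin_bigcap_measurable; first exact: finite_II.
move=> i /= i_lt; rewrite -[X in measurable X]setTI.
by have [/(_ S i SSS i_lt)[mX _] _ _] := samples; exact: mX.
Qed.

(** The cells hit by the observations are independent, with the cell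
    probabilities as law. *)
Lemma sample_index_law y :
  Pr [set w | sample_index w = y] = (\prod_j sample_law q j (y j))%:E.
Proof.
rewrite preimageE; have [_ samp ->] := samples; last exact: measurable_target.
rewrite big_sub /=.
transitivity (\prod_(S : member SS) \prod_(i < n (val S))
    sample_law q (sample_point S i) (y (sample_point S i)))%:E.
  rewrite -prodEFin; apply: eq_bigr => S _; rewrite -prodEFin; apply: eq_bigr => i _.
  rewrite samp; [|exact: (valP S)|exact: ltn_ord|exact: measurable_target].
  by rewrite targetE; case: (hitE S (y (sample_point S i))).
congr (_%:E); rewrite (@sig_big_dep _ _ _ (member SS) (fun S => 'I_(n (val S))) xpredT
  (fun _ => xpredT) (fun S i => sample_law q (sample_point S i) (y (sample_point S i)))) /=.
by apply: eq_bigr => -[].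
Qed.

Lemma probability_sample_index (B : pred {ffun sample SS n -> T}) :
  Pr [set w | B (sample_index w)] = (expectation (sample_law q) (fun y => (B y)%:R))%:E.
Proof.
pose hits y := if B y then [set w | sample_index w = y] else set0.
have mC y : measurable (hits y).
  by rewrite /hits; case: ifP => // _; exact: measurable_sample_index.
have DE w : [set w | B (sample_index w)] w <-> exists y, hits y w.
  split=> [Bw|[y]]; first by exists (sample_index w); rewrite /hits Bw.
  by rewrite /hits; case: ifP => // By /= ->.
rewrite (measure_partition Pr mC _ DE) => [|y y' w]; last first.
  by rewrite /hits; case: ifP => // _; case: ifP => // _ /= <- <-.
rewrite -sumEFin; apply: eq_bigr => y _; rewrite /hits EFinM.
case: (B y); last by rewrite measure0 mule0.
by rewrite mule1; exact: sample_index_law.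
Qed.

End samples.

(** * Compatible laws, and grids with infinitely many cells *)

Lemma probability_setI1 (dT : measure_display) (T : measurableType dT) (R : realType)
    (P : probability T R) (A D : set T) :
  measurable A -> measurable D -> P D = 1%E -> P A = P (A `&` D).
Proof.
move=> mA mD D1.
rewrite (measureDI _ mA mD) [X in (X + _)%E](_ : _ = 0%E) ?add0e//.
apply/eqP; rewrite eq_le measure_ge0 andbT.
apply: (@le_trans _ _ (P (~` D))).
  by apply: le_measure; rewrite ?inE; [exact: measurableD|exact: measurableC|move=> x []].
by rewrite probability_setC// D1 subee.
Qed.

Section compatible_cells.
Variables (R : realType) (d0 d : nat) (m : 'I_d -> option nat) (h : 'I_d -> R).
Hypothesis m_pos : forall (j : 'I_d) (k : nat), (d0 <= j)%N -> m j = Some k -> (1 <= k)%N.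
Hypothesis h_pos : forall j : 'I_d, (j < d0)%N -> 0 < h j.
Hypothesis fin : forall j, nlevels d0 m h j != None.

Notation N := (grid_size d0 m h).

Lemma measurable_proj_to (S : {set 'I_d}) : measurable_fun [set: pts R 'I_d] (@proj_to R d S).
Proof. by apply: measurable_fun_pts => i; exact: measurable_coord. Qed.

(** The masses that the joint law gives to the cells of the full grid. *)
Lemma compatible_cell_mass (SS : {set {set 'I_d}})
    (P : forall S : {set 'I_d}, probability (pts R (idx S)) R) :
  compatible d0 m SS P ->
  exists2 p, (forall x, 0 <= p x) & @cell_mass R d0 d m h SS P =1 marginal_at p.
Proof.
move=> [Q [Q1 QP]]; pose p (x : grid N (@id 'I_d)) := fine (Q (cell_box x)).
exists p => [x|]; first exact: fine_ge0.
case=> S k; rewrite /cell_mass /=.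
have mk : measurable (@proj_to R d (val S) @^-1` cell_box k).
  by rewrite -[X in measurable X]setTI; apply: measurable_proj_to => //; exact: measurable_cell_box.
have mF : measurable (full_space d0 m : set (pts R 'I_d)) by exact: measurable_space.
rewrite -QP; [|exact: (valP S)|exact: measurable_cell_box].
rewrite (probability_setI1 mk mF Q1).
pose C (x : grid N (@id 'I_d)) := if restrict (val S) x == k then cell_box x else set0.
have mC x : measurable (C x).
  by rewrite /C; case: ifP => // _; exact: measurable_cell_box.
have CE x : (@proj_to R d (val S) @^-1` cell_box k `&` full_space d0 m) x <-> exists z, C z x.
  split=> [[kx sx]|[z]].
    have zx := index_cell_box m_pos h_pos fin sx.
    exists (@cell_index R d0 d m h m_pos h_pos fin _ id x); rewrite /C ifT//.
    by apply/eqP; exact: (cell_box_inj m_pos h_pos fin (proj_cell_box zx) kx).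
  rewrite /C; case: eqP => // zk zx; split; last exact: cell_box_space zx.
  by rewrite /preimage /= -zk; exact: proj_cell_box.
transitivity (fine (\sum_x Q (C x))%E).
  congr fine; apply: measure_partition mC _ CE => x y z; rewrite /C.
  by case: eqP => // _; case: eqP => // _; exact: cell_box_inj.
have Ceq x : (Q (C x) = (if coord x S == Tagged (fun S0 : member SS => grid_of N (val S0)) k then p x else 0)%:E)%E.
  rewrite /C /coord (inj_eq (@eq_from_Tagged _ _ _)); case: ifP => // _; rewrite ?measure0 //.
  rewrite /p fineK// fin_num_measure//; exact: measurable_cell_box.
by rewrite (eq_bigr _ (fun x _ => Ceq x)) sumEFin /= /marginal_at [RHS]big_mkcond.
Qed.

End compatible_cells.

(** The integral of the negative part of [f] is a supremum over the simple
    functions below it, and these are at most one. *)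
Lemma integral_ge_lower_bound (dT : measure_display) (T : measurableType dT) (R : realType)
    (mu : {measure set T -> \bar R}) (D : set T) (f : T -> R) :
  measurable D -> mu D = 1%E -> (forall x, D x -> - 1 <= f x) ->
  (- 1 <= \int[mu]_(x in D) (f x)%:E)%E.
Proof.
move=> mD D1 f1; rewrite integralE -[leLHS]add0e.
apply: leeB; first exact: integral_ge0.
rewrite -D1 -[leRHS]mul1e -(integral_cst _ mD) !ge0_integralE //.
apply: ereal_sup_le => _ [g /= gf <-]; exists g => // x.
apply: le_trans (gf x) _; rewrite /patch; case: ifP => // /set_mem/f1 fx.
by rewrite unlock /= ge_max lee01 andbT lee_fin lerNl.
Qed.

Section trivial_bound.
Variables (R : realType) (d0 d : nat) (m : 'I_d -> option nat) (SS : {set {set 'I_d}}).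
Hypothesis SS_gt0 : (0 < #|SS|)%N.
Variable mu : forall S : {set 'I_d}, {measure set (pts R (idx S)) -> \bar R}.
Hypothesis mu1 : forall S, S \in SS -> mu S (@space_of R d0 d m S) = 1%E.

Lemma index_at_le1 f : (forall S, S \in SS -> forall x, space_of d0 m x -> - 1 <= f S x) ->
  (index_at d0 m SS mu f <= 1)%E.
Proof.
move=> f1; rewrite /index_at leeNl.
have s0 : #|SS|%:R != 0 :> R by rewrite pnatr_eq0 -lt0n.
have -> : (- 1 = (#|SS|%:R^-1)%:E * (- #|SS|%:R : R)%:E)%E.
  by rewrite -EFinM mulrN mulVf.
apply: lee_wpmul2l; first by rewrite lee_fin invr_ge0.
rewrite (_ : (_%:E = \sum_(S in SS) (-1)%:E)%E); last first.
  by rewrite sumEFin sumr_const -mulNrn.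
by apply: lee_sum => S SSS; apply: integral_ge_lower_bound; [exact: measurable_space|exact: mu1|exact: f1].
Qed.

Lemma incompat_index_le1 : (incompat_index d0 m SS mu <= 1)%E.
Proof.
apply: ge_ereal_sup => _ [f [fG _] <-]; apply: index_at_le1 => S SSS x.
by have [+ _ _] := fG S SSS; apply.
Qed.

Lemma incompat_index_h_le1 h : (incompat_index_h d0 m SS h mu <= 1)%E.
Proof.
apply: ge_ereal_sup => _ [f [fG _] <-]; apply: index_at_le1 => S SSS x.
by have [+ _] := fG S SSS; apply.
Qed.

End trivial_bound.

(** * Measurability of upper semi-continuous functions *)

Section borel_sets.
Variables (R : realType) (I : finType).

(** The balls for the maximum norm generate a filter that converges to [x] in
    every coordinate, hence in the product topology. *)
Lemma nbhs_pts_ball (x : pts R I) (V : set (pts R I)) : nbhs x V ->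
  exists2 e : R, 0 < e & forall y, (forall i, `|x i - y i| < e) -> V y.
Proof.
pose F : set_system (pts R I) := [set A | exists2 e : R, 0 < e &
  forall y, (forall i, `|x i - y i| < e) -> A y].
have FF : Filter F.
  split=> [|A B [e e0 Ae] [e' e'0 Be']|A B AB [e e0 Ae]].
  - by exists 1.
  - exists (Num.min e e') => [|y ye]; first by rewrite lt_min e0.
    by split; [apply: Ae|apply: Be'] => i; have := ye i; rewrite lt_min => /andP[].
  - by exists e => // y /Ae/AB.
suff : F --> x by apply.
apply/cvg_sup => i; apply/cvg_image.
  by apply/seteqP; split=> // t _; exists (fun=> t).
move=> A /= /nbhs_ballP[e /= e0 eA].
exists [set y : pts R I | A (y i)]; first by exists e => // y ye; apply: eA; exact: ye.
by apply/seteqP; split=> [_ [y Ay <-]//|t At]; exists (fun=> t).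
Qed.

Let rational_box (ab : {ffun I -> rat * rat}) : set (pts R I) :=
  [set y | forall i, ratr (ab i).1 < y i < ratr (ab i).2].

Let measurable_rational_box ab : measurable (rational_box ab).
Proof.
rewrite (_ : rational_box ab = \bigcap_(i in setT)
  (fun x : pts R I => x i) @^-1` [set` `]ratr (ab i).1, ratr (ab i).2[]).
  apply: fin_bigcap_measurable; first exact: finite_finset.
  by move=> i _; rewrite -[X in measurable X]setTI; apply: measurable_coord.
by apply/seteqP; split=> x xab i; [move=> _; have := xab i|have := xab i Logic.I]; rewrite /= in_itv.
Qed.

(** The product topology of finitely many copies of the line has a countable
    base of boxes. *)
Lemma measurable_open_pts (V : set (pts R I)) : open V -> measurable V.
Proof.
move=> oV; pose F (ab : {ffun I -> rat * rat}) :=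
  if `[< rational_box ab `<=` V >] then rational_box ab else set0.
rewrite (_ : V = \bigcup_ab F ab); last first.
  apply/seteqP; split=> [x Vx|x [ab _]]; last by rewrite /F; case: asboolP => // h /h.
  have [e e0 eV] : exists2 e : R, 0 < e & forall y, (forall i, `|x i - y i| < e) -> V y.
    by apply: nbhs_pts_ball; exact: open_nbhs_nbhs.
  have ex i : exists ab : rat * rat,
      x i - e < ratr ab.1 < x i /\ x i < ratr ab.2 < x i + e.
    have [a] := @rat_in_itvoo R (x i - e) (x i) ltac:(by rewrite ltrBlDr ltrDl).
    have [b] := @rat_in_itvoo R (x i) (x i + e) ltac:(by rewrite ltrDl).
    by rewrite !inE => bx ax; exists (a, b).
  have [ab abP] := choice ex.
  exists [ffun i => ab i] => //; rewrite /F ifT; last first.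
    apply/asboolP => y yab; apply: eV => i; have := yab i; rewrite ffunE.
    have [/andP[? ?] /andP[? ?]] := abP i => /andP[? ?].
    by rewrite ltr_distl; apply/andP; split; lra.
  by move=> i; rewrite ffunE; have [/andP[_ ->] /andP[->]] := abP i.
apply: countable_bigcupT_measurable => // ab.
by rewrite /F; case: ifP.
Qed.

Lemma measurable_upper_semicontinuous (D : set (pts R I)) (f : pts R I -> R) :
  measurable D ->
  lower_semicontinuous (fun x : subspace D => (- f x)%:E) -> measurable_fun D f.
Proof.
move=> mD /lower_semicontinuousP fD.
rewrite (_ : f = -%R \o (fun x => - f x)); last by apply/funext => x /=; rewrite opprK.
apply: measurableT_comp => //.
apply: (measurability _ (RGenOInfty.measurableE R)).
move=> _ [_ [a ->] <-].
have /open_subspaceP[V oV VD] := fD a.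
rewrite (_ : _ `&` _ = V `&` D).
  by apply: measurableI => //; exact: measurable_open_pts.
by rewrite VD setIC; apply/seteqP; split=> x [] /=; rewrite ?in_itv/= ?andbT ?lte_fin.
Qed.

End borel_sets.

(** * Uniform distributions on the cells *)

Section reference_measure.
Variables (R : realType) (d0 d : nat) (m : 'I_d -> option nat) (h : 'I_d -> R).
Hypothesis m_pos : forall (j : 'I_d) (k : nat), (d0 <= j)%N -> m j = Some k -> (1 <= k)%N.
Hypothesis h_pos : forall j : 'I_d, (j < d0)%N -> 0 < h j.
Hypothesis fin : forall j, nlevels d0 m h j != None.

Notation N := (grid_size d0 m h).

Definition width (j : 'I_d) (v : 'I_(N j)) : R :=
  if (j < d0)%N then Num.min (v.+1%:R * h j) 1 - v%:R * h j else 1.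

Lemma coord_meas_continuous (j : 'I_d) (A : set R) : (j < d0)%N -> A `<=` coord_space d0 m j ->
  coord_meas d0 m j A = lebesgue_measure A.
Proof. by move=> jd Aj; rewrite /coord_meas jd /mrestr setIidl. Qed.

Lemma coord_meas_point (j : 'I_d) (a : R) : (d0 <= j)%N -> coord_space d0 m j a ->
  coord_meas d0 m j [set a] = 1%E.
Proof.
move=> jd aj; rewrite /coord_meas ltnNge jd /= /mrestr setIidl => [|_ ->//].
by rewrite /counting asboolT ?fset_set1 ?cardfs1//; exact: finite_set1.
Qed.

Lemma coord_meas_cell j v : coord_meas d0 m j (coord_cell (j := j) v) = (width v)%:E.
Proof.
have vj := coord_cell_space h_pos fin (v := v); rewrite /width.
case: (ltnP j d0) => jd.
  rewrite (coord_meas_continuous jd vj) /coord_cell jd.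
  rewrite (_ : subinterval _ _ = [set` `[v%:R * h j, Num.min (v.+1%:R * h j) 1[]).
    have := coord_pointP h_pos v.
    rewrite /coord_cell /coord_point jd /subinterval /= => /andP[_ lt].
    by rewrite lebesgue_measure_itv /= lte_fin lt.
  by apply/seteqP; split=> x /=; rewrite in_itv /subinterval /= -natr1 addrK.
move: vj; rewrite /coord_cell ltnNge jd /= => vj; apply: coord_meas_point => //.
exact: vj.
Qed.

Lemma width_gt0 j v : 0 < width (j := j) v.
Proof.
rewrite /width; case: ifP => // jd; rewrite subr_gt0.
have := coord_pointP h_pos v.
by rewrite /coord_cell /coord_point jd /subinterval /= => /andP[].
Qed.

Section boxes.
Variables (I : finType) (e : I -> 'I_d).

Definition cell_ref : {measure set (pts R I) -> \bar R} :=
  prod_meas (fun i : I => coord_meas d0 m (e i)).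

Lemma cell_ref_box (B : I -> set R) : (forall i, measurable (B i)) ->
  cell_ref [set z | forall i, B i (z i)] = (\big[*%E/1]_i coord_meas d0 m (e i) (B i))%E.
Proof. exact: prod_meas_box. Qed.

Definition volume (k : grid N e) : R := \prod_i width (k i).

Lemma volume_gt0 k : 0 < volume k.
Proof. by apply: prodr_gt0 => i _; exact: width_gt0. Qed.

Lemma cell_ref_cell (k : grid N e) : cell_ref (cell_box k) = (volume k)%:E.
Proof.
rewrite (cell_ref_box (fun i => measurable_coord_cell (k i))).
by rewrite -prodEFin; apply: eq_bigr => i _; exact: coord_meas_cell.
Qed.

Lemma inv_volume_ge0 k : 0 <= (volume k)^-1.
Proof. by rewrite invr_ge0 ltW// volume_gt0. Qed.

Definition uniform (k : grid N e) : {measure set (pts R I) -> \bar R} :=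
  mscale (NngNum (inv_volume_ge0 k)) (mrestr cell_ref (measurable_cell_box k)).

Lemma uniformE k A : uniform k A = ((volume k)^-1%:E * cell_ref (A `&` cell_box k))%E.
Proof. by []. Qed.

Lemma uniform_cell k : uniform k (cell_box k) = 1%E.
Proof.
by rewrite uniformE setIid cell_ref_cell -EFinM mulVf// gt_eqF// volume_gt0.
Qed.

Lemma uniformT k : uniform k setT = 1%E.
Proof. by rewrite -(uniform_cell k) !uniformE setTI setIid. Qed.

Definition coord_law (j : 'I_d) (v : 'I_(N j)) (B : set R) : \bar R :=
  ((width v)^-1%:E * coord_meas d0 m j (B `&` coord_cell v))%E.

Lemma coord_lawT j v : coord_law (j := j) v setT = 1%E.
Proof.
by rewrite /coord_law setTI coord_meas_cell -EFinM mulVf// gt_eqF// width_gt0.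
Qed.

Lemma uniform_box k (B : I -> set R) : (forall i, measurable (B i)) ->
  uniform k [set z | forall i, B i (z i)] = (\big[*%E/1]_i coord_law (k i) (B i))%E.
Proof.
move=> mB; rewrite uniformE.
have -> : [set z : pts R I | forall i, B i (z i)] `&` cell_box k =
    [set z | forall i, (B i `&` coord_cell (k i)) (z i)].
  apply/seteqP; split=> [x [xB xk] i|x xBk]; first by split.
  by split=> i; have [] := xBk i.
have mBk i : measurable (B i `&` coord_cell (k i)).
  by apply: measurableI => //; exact: measurable_coord_cell.
rewrite (cell_ref_box mBk).
rewrite /coord_law big_split /=; congr (_ * _)%E.
by rewrite prodEFin prodfV.
Qed.

End boxes.

Section boxes_generate.
Variable I : finType.

Definition boxes : set (set (pts R I)) :=
  [set A | exists B : I -> set R, (forall i, measurable (B i)) /\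
    A = [set z | forall i, B i (z i)]].

Lemma measurable_box (B : I -> set R) : (forall i, measurable (B i)) ->
  measurable ([set z | forall i, B i (z i)] : set (pts R I)).
Proof.
move=> mB; rewrite (_ : [set z | _] = \bigcap_(i in setT) (fun x : pts R I => x i) @^-1` B i).
  apply: fin_bigcap_measurable; first exact: finite_finset.
  by move=> i _; rewrite -[X in measurable X]setTI; apply: measurable_coord.
by apply/seteqP; split=> x kx i => [_|]; exact: kx.
Qed.

Lemma measurable_boxes : @measurable _ (pts R I) = <<s boxes >>.
Proof.
apply/seteqP; split.
  apply: sub_sigma_algebra2 => _ [i [B [mB ->]]].
  exists (fun k => if k == i then B else setT); split=> [k|]; first by case: ifP.
  apply/seteqP; split=> [x Bx k|x /(_ i)]; last by rewrite eqxx.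
  by case: eqP => [->|].
apply: smallest_sub; first exact: sigma_algebra_measurable.
by move=> _ [B [mB ->]]; exact: measurable_box.
Qed.

Lemma boxes_setI : setI_closed boxes.
Proof.
move=> _ _ [B [mB ->]] [C [mC ->]]; exists (fun i => B i `&` C i).
split=> [i|]; first exact: measurableI.
by apply/seteqP; split=> [x [Bx Cx] i|x BC]; [split|split=> i; have [] := BC i].
Qed.

Lemma boxes_setT : boxes setT.
Proof. by exists (fun=> setT); split=> //; apply/seteqP; split. Qed.

End boxes_generate.

(** Projecting the uniform distribution on a cell of the full space gives the
    uniform distribution on the projected cell: both are product measures, so
    they agree on boxes. *)
Lemma uniform_proj (S : {set 'I_d}) (x : grid N (@id 'I_d)) (A : set (pts R (idx S))) :
  measurable A -> uniform x (@proj_to R d S @^-1` A) = uniform (restrict S x) A.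
Proof.
pose image_of : {measure set (pts R (idx S)) -> \bar R} :=
  pushforward (uniform x) (@proj_to R d S).
pose image := image_of (@measurable_proj_to R d S).
move=> mA; rewrite -[LHS]/(image A).
apply: (measure_unique (@boxes (idx S)) (fun=> setT)) => //.
- exact: measurable_boxes.
- exact: boxes_setI.
- by move=> _; exact: boxes_setT.
- by rewrite bigcup_const.
- move=> _ [B [mB ->]]; rewrite /image /image_of /= /pushforward.
  pose B' (j : 'I_d) := if insub j : option (idx S) is Some i then B i else setT.
  have mB' j : measurable (B' j) by rewrite /B'; case: insubP.
  rewrite (_ : _ @^-1` _ = [set z | forall j, B' j (z j)]); last first.
    apply/seteqP; split=> z zB.
      by move=> j; rewrite /B'; case: insubP => // i _ <-; exact: zB.
    by move=> i; have := zB (val i); rewrite /B' valK.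
  rewrite !uniform_box//.
  rewrite (bigID (fun j => j \in S)) /= [X in (_ * X)%E]big1 ?mule1; last first.
    by move=> j jS; rewrite /B' insubN// coord_lawT.
  rewrite big_sub; apply: eq_bigr => i _.
  by rewrite /B' valK ffunE.
- by move=> _; rewrite /image /image_of /= /pushforward preimage_setT uniformT ltry.
Qed.

End reference_measure.

(** * Laws between two mixtures *)

Section mixtures.
Variables (dT : measure_display) (T : measurableType dT) (R : realType) (J : finType).
Variable u : J -> {measure set T -> \bar R}.

Lemma mixture_measure (a : J -> R) : (forall j, 0 <= a j) ->
  exists nu : {measure set T -> \bar R},
    (forall A, nu A = \sum_j (a j)%:E * u j A)%E /\
    forall g : T -> \bar R, measurable_fun setT g -> (forall x, 0 <= g x)%E ->
      (\int[nu]_x g x = \sum_j (a j)%:E * \int[u j]_x g x)%E.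
Proof.
move=> a0; have [j0 _|J0] := pickP (@predT J); last first.
  exists mzero; split=> [A|g mg g0].
    by rewrite big1 // => j; have := J0 j.
  by rewrite integral_measure_zero big1 // => j; have := J0 j.
pose j_ i := nth j0 (enum J) i.
have sum_enum (F : J -> \bar R) : (\sum_(i < size (enum J)) F (j_ i) = \sum_j F j)%E.
  by rewrite -[RHS]big_enum (big_nth j0) big_mkord.
exists (msum (fun i => mscale (NngNum (a0 (j_ i))) (u (j_ i))) (size (enum J))).
split=> [A|g mg g0]; first by rewrite -sum_enum.
rewrite ge0_integral_measure_sum// -sum_enum; apply: eq_bigr => i _.
by rewrite ge0_integral_mscale.
Qed.

Variable P : {measure set T -> \bar R}.
Hypothesis P1 : P setT = 1%E.
Hypothesis u1 : forall j, u j setT = 1%E.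
Variables a q b : J -> R.
Hypothesis a0 : forall j, 0 <= a j.
Hypothesis aq : forall j, a j <= q j.
Hypothesis qb : forall j, q j <= b j.
Hypothesis q1 : \sum_j q j = 1.
Hypothesis Pa : forall A, measurable A -> (\sum_j (a j)%:E * u j A <= P A)%E.
Hypothesis Pb : forall A, measurable A -> (P A <= \sum_j (b j)%:E * u j A)%E.
Variables (g : T -> R) (s : R).
Hypothesis mg : measurable_fun setT g.
Hypothesis gs : forall x, 0 <= g x <= s.

Let s0 : 0 <= s.
Proof. by have /andP[h0 /(le_trans h0)] := gs point. Qed.

Let b0 j : 0 <= b j.
Proof. exact: le_trans (a0 j) (le_trans (aq j) (qb j)). Qed.

Let mean (mu : {measure set T -> \bar R}) : R := fine (\int[mu]_x (g x)%:E).

Let mgE : measurable_fun setT (EFin \o g).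
Proof. exact/measurable_EFinP. Qed.

Let mcE : measurable_fun setT (fun x => (s - g x)%:E).
Proof. by apply/measurable_EFinP; apply: measurable_funB. Qed.

Let g0E x : (0 <= (g x)%:E)%E.
Proof. by rewrite lee_fin; have /andP[] := gs x. Qed.

Let c0E x : (0 <= (s - g x)%:E)%E.
Proof. by rewrite lee_fin subr_ge0; have /andP[] := gs x. Qed.

Let mean_split (mu : {measure set T -> \bar R}) : mu setT = 1%E ->
  (\int[mu]_x (g x)%:E + \int[mu]_x (s - g x)%:E = s%:E)%E.
Proof.
move=> mu1; rewrite -ge0_integralD//.
under eq_integral do rewrite -EFinD addrC subrK.
by rewrite (eq_integral (cst s%:E)) // integral_cst// mu1 mule1.
Qed.

Let meanE (mu : {measure set T -> \bar R}) : mu setT = 1%E ->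
  (\int[mu]_x (g x)%:E = (mean mu)%:E)%E /\ (\int[mu]_x (s - g x)%:E = (s - mean mu)%:E)%E.
Proof.
move=> mu1; have sE := mean_split mu1.
have i0 : (0 <= \int[mu]_x (g x)%:E)%E by exact: integral_ge0.
have i1 : (0 <= \int[mu]_x (s - g x)%:E)%E by exact: integral_ge0.
rewrite /mean; move: i0 i1 sE; case: (\int[mu]_x (g x)%:E)%E => [x||] //=;
  case: (\int[mu]_x (s - g x)%:E)%E => [y||] //= _ _ [] <-.
by rewrite [x + y]addrC addrK.
Qed.

Let mean_bounds (mu : {measure set T -> \bar R}) : mu setT = 1%E -> 0 <= mean mu <= s.
Proof.
move=> mu1; have [e1 e2] := meanE mu1.
rewrite -lee_fin -e1 integral_ge0//= -subr_ge0 -lee_fin -e2.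
exact: integral_ge0.
Qed.

(** Bounding the mean of [g] from below by the lower mixture, and the mean of
    [s - g] from above by the upper one, and averaging the two estimates: one
    of [g] and [s - g] has mean at most [s / 2] under each component. *)
Lemma mixture_sandwich :
  \sum_j q j * mean (u j) - mean P <= s / 2 * \sum_j (b j - a j).
Proof.
have [lo [loE lo_int]] := mixture_measure a0.
have [hi [hiE hi_int]] := mixture_measure b0.
have low : \sum_j a j * mean (u j) <= mean P.
  rewrite -lee_fin -(meanE P1).1 -sumEFin.
  apply: (@le_trans _ _ (\int[lo]_x (g x)%:E)%E); last first.
    by apply: ge0_le_measure_integral => // A mA; rewrite loE; exact: Pa.
  by rewrite lo_int//; apply: lee_sum => j _; rewrite EFinM (meanE (u1 j)).1.
have high : s - mean P <= \sum_j b j * (s - mean (u j)).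
  rewrite -lee_fin -(meanE P1).2 -sumEFin.
  apply: (@le_trans _ _ (\int[hi]_x (s - g x)%:E)%E).
    by apply: ge0_le_measure_integral => // A mA; rewrite hiE; exact: Pb.
  by rewrite hi_int//; apply: lee_sum => j _; rewrite EFinM (meanE (u1 j)).2.
have e1 : \sum_j q j * mean (u j) - mean P <= \sum_j (q j - a j) * mean (u j).
  under [leRHS]eq_bigr do rewrite mulrBl.
  by rewrite sumrB lerD2l lerN2.
have e2 : \sum_j q j * mean (u j) - mean P <= \sum_j (b j - q j) * (s - mean (u j)).
  have -> : \sum_j q j * mean (u j) = s - \sum_j q j * (s - mean (u j)).
    under [X in _ - X]eq_bigr do rewrite mulrBr.
    by rewrite sumrB -mulr_suml q1 mul1r opprB addrC subrK.
  under [leRHS]eq_bigr do rewrite mulrBl.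
  by rewrite sumrB addrAC lerD2r.
have e3 : \sum_j (q j - a j) * mean (u j) + \sum_j (b j - q j) * (s - mean (u j)) <=
    s * \sum_j (b j - a j).
  rewrite -big_split mulr_sumr; apply: ler_sum => j _ /=.
  have /andP[m0 m1] := mean_bounds (u1 j).
  have h1 : (q j - a j) * mean (u j) <= (q j - a j) * s by rewrite ler_wpM2l// subr_ge0.
  have h2 : (b j - q j) * (s - mean (u j)) <= (b j - q j) * s.
    by rewrite ler_wpM2l ?subr_ge0// gerBl.
  by apply: le_trans (lerD h1 h2) _; rewrite -mulrDl mulrC [q j - _ + _]addrC addrA subrK.
have := le_trans (lerD e1 e2) e3; set D := \sum_j q j * _ - _.
by rewrite mulrAC ler_pdivlMr// mulr_natr mulr2n.
Qed.

End mixtures.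

(** * Smooth densities on the cells *)

Section density_cells.
Variables (R : realType) (d0 d : nat) (m : 'I_d -> option nat) (h : 'I_d -> R).
Hypothesis m_pos : forall (j : 'I_d) (k : nat), (d0 <= j)%N -> m j = Some k -> (1 <= k)%N.
Hypothesis h_pos : forall j : 'I_d, (j < d0)%N -> 0 < h j.
Hypothesis fin : forall j, nlevels d0 m h j != None.

Notation N := (grid_size d0 m h).

Variables (r : 'I_d -> R) (L : R) (S : {set 'I_d}) (P : probability (pts R (idx S)) R).
Hypothesis r_ge0 : forall j : 'I_d, (j < d0)%N -> 0 <= r j.
Hypothesis L_ge0 : 0 <= L.
Hypothesis P1 : P (@space_of R d0 d m S) = 1%E.
Variable p : pts R (idx S) -> R.
Hypothesis pP : is_density d0 m P p.
Hypothesis p_smooth : forall x, space_of d0 m x -> (0 < P (disc_fiber d0 m x))%E ->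
  holder (fun j : cont_idx d0 S => r (val j)) L
    (fun z => p (Defs.glue z x) / fine (P (disc_fiber d0 m x))).

Notation K := (grid_of N S).

Definition same_fiber (k k' : K) : bool :=
  [forall i : idx S, (d0 <= val i)%N ==> (k i == k' i)].

Definition fiber (k : K) : set (pts R (idx S)) := disc_fiber d0 m (cell_point k).

Lemma same_fiber_sym k k' : same_fiber k k' = same_fiber k' k.
Proof. by apply: eq_forallb => i; rewrite eq_sym. Qed.

Lemma fiberP k y : fiber k y <-> exists k', (if same_fiber k k' then cell_box k' else set0) y.
Proof.
split=> [[sy yk]|[k']].
  have cy := index_cell_box m_pos h_pos fin sy.
  exists (@cell_index R d0 d m h m_pos h_pos fin _ val y); rewrite ifT//.
  apply/forallP => i; apply/implyP => id0; apply/eqP.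
  apply: (coord_cell_inj h_pos (y := y i)); last exact: cy.
  by rewrite (yk i id0); exact: coord_pointP.
case: ifP => // /forallP same cy; split; first exact: cell_box_space cy.
move=> i id0; have := cy i; have /implyP/(_ id0)/eqP <- := same i.
by rewrite /coord_cell /cell_point /coord_point ltnNge id0.
Qed.

Lemma measure_fiber (mu : {measure set (pts R (idx S)) -> \bar R}) k :
  (mu (fiber k) = \sum_(k' | same_fiber k k') mu (cell_box k'))%E.
Proof.
rewrite (measure_partition mu _ _ (fiberP k)) => [|k'|k1 k2 x].
- rewrite [RHS]big_mkcond; apply: eq_bigr => k' _; case: ifP => // _.
- by case: ifP => // _; exact: measurable_cell_box.
- by case: ifP => // _; case: ifP => // _; exact: cell_box_inj.
Qed.

Lemma coord_meas_space (j : 'I_d) : (j < d0)%N -> coord_meas d0 m j (coord_space d0 m j) = 1%E :> \bar R.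
Proof.
move=> jd; rewrite (coord_meas_continuous jd)// /coord_space jd.
by rewrite lebesgue_measure_itv /= lte_fin ltr01 oppr0 adde0.
Qed.

(** A fibre is the unit cube in the continuous coordinates. *)
Lemma sum_volume_fiber k : \sum_(k' | same_fiber k k') volume k' = 1.
Proof.
apply: EFin_inj; rewrite -sumEFin.
under eq_bigr do rewrite -cell_ref_cell//.
rewrite -measure_fiber.
pose B (i : idx S) : set R := if (val i < d0)%N then coord_space d0 m (val i)
  else [set cell_point k i].
rewrite (_ : fiber k = [set z | forall i, B i (z i)]).
  rewrite cell_ref_box; last first.
    by move=> i; rewrite /B; case: ifP => _; [exact: measurable_coord_space|exact: measurable_set1].
  rewrite big1 // => i _; rewrite /B; case: ltnP => id0; first exact: coord_meas_space.
  apply: coord_meas_point => //; apply: (coord_cell_space h_pos fin).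
  exact: coord_pointP.
apply/seteqP; split=> z.
  by move=> [sz zk] i; rewrite /B; case: ltnP => id0; [exact: sz|exact: zk].
move=> zB; split=> i; have := zB i; rewrite /B; case: ltnP => // id0.
  move=> ->; apply: (coord_cell_space h_pos fin); exact: coord_pointP.
Qed.

Definition prob (A : set (pts R (idx S))) : R := fine (P A).

Lemma probE A : measurable A -> P A = (prob A)%:E.
Proof. by move=> mA; rewrite fineK// fin_num_measure. Qed.

Lemma measurable_fiber k : measurable (fiber k).
Proof.
rewrite (_ : fiber k = \bigcup_(k' in setT) (if same_fiber k k' then cell_box k' else set0)).
  apply: fin_bigcup_measurable; first exact: finite_finset.
  by move=> k' _; case: ifP => // _; exact: measurable_cell_box.
by apply/seteqP; split=> [x /fiberP[i Ci]|x [i _ Ci]]; [exists i|apply/fiberP; exists i].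
Qed.

Lemma prob_fiber k : prob (fiber k) = \sum_(k' | same_fiber k k') prob (cell_box k').
Proof.
apply: EFin_inj; rewrite -probE; last exact: measurable_fiber.
rewrite measure_fiber -sumEFin; apply: eq_bigr => k' _.
by apply: probE; exact: measurable_cell_box.
Qed.

Lemma prob_space A : measurable A -> (P A = \sum_(k : K) P (A `&` cell_box k))%E.
Proof.
move=> mA; have mS : measurable (@space_of R d0 d m S) by exact: measurable_space.
rewrite (probability_setI1 mA mS P1).
apply: measure_partition => [k|k k' x [_ kx] [_ k'x]|x].
- by apply: measurableI => //; exact: measurable_cell_box.
- exact: cell_box_inj kx k'x.
- rewrite /= /space_of; split=> [[Ax /(space_cover m_pos h_pos fin)[k kx]]|[k [Ax kx]]]; first by exists k.
  by split=> //; exact: cell_box_space kx.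
Qed.

Lemma sum_prob_cells : \sum_(k : K) prob (cell_box k) = 1.
Proof.
apply: EFin_inj; rewrite -sumEFin -(probability_setT P) prob_space//.
by apply: eq_bigr => k _; rewrite setTI probE//; exact: measurable_cell_box.
Qed.

(** Exchanging the sums over the cells and over the cells of their fibres. *)
Lemma sum_prob_fiber_volume : \sum_k prob (fiber k) * volume k = 1.
Proof.
under eq_bigr do rewrite prob_fiber mulr_suml big_mkcond /=.
rewrite exchange_big /= -[RHS]sum_prob_cells; apply: eq_bigr => k' _.
rewrite -big_mkcond -mulr_sumr (eq_bigl (same_fiber k')) ?sum_volume_fiber ?mulr1// => k.
exact: same_fiber_sym.
Qed.

Definition holder_width : R := \sum_(j : cont_idx d0 S) h (val j) `^ r (val j).

Lemma cont_idx_sub (j : cont_idx d0 S) : val j \in S.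
Proof. by have /andP[] := valP j. Qed.

Let to_idx (j : cont_idx d0 S) : idx S := Sub (val j) (cont_idx_sub j).

Lemma glue_cell (k : K) y : cell_box k y ->
  Defs.glue (fun j => y (to_idx j)) (cell_point k) = y.
Proof.
move=> ky; apply/funext => i; rewrite /Defs.glue; case: insubP => [j _ ji|].
  by congr (y _); apply: val_inj; rewrite /= ji.
rewrite (valP i) /= -leqNgt => id0; have := ky i.
by rewrite /coord_cell /cell_point /coord_point ltnNge id0.
Qed.

Lemma coord_cell_width (j : 'I_d) v (a b : R) : (j < d0)%N ->
  coord_cell (v : 'I_(N j)) a -> coord_cell (v : 'I_(N j)) b -> `|a - b| <= h j.
Proof.
move=> jd; rewrite /coord_cell jd /subinterval /= !lt_min -natr1 addrK.
move=> /andP[a1 /andP[a2 _]] /andP[b1 /andP[b2 _]].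
by rewrite ler_distl; move: a1 a2 b1 b2; rewrite mulrDl mul1r; move: (_ * _) => t; lra.
Qed.

Lemma density_oscillation (k : K) y y' : (0 < P (fiber k))%E ->
  cell_box k y -> cell_box k y' -> p y <= p y' + prob (fiber k) * (L * holder_width).
Proof.
move=> Pk ky ky'.
have unit_interval z : cell_box k z -> forall j, 0 <= z (to_idx j) < 1.
  move=> /(cell_box_space h_pos fin) sz j; have := sz (to_idx j).
  by rewrite /coord_space; have /andP[_ ->] := valP j; rewrite /= in_itv.
have sk : space_of d0 m (cell_point k : pts R (idx S)).
  by apply: (cell_box_space h_pos fin); exact: cell_pointP.
have := p_smooth sk Pk (unit_interval y ky) (unit_interval y' ky').
rewrite !glue_cell// -/(fiber k) -/(prob (fiber k)) => osc.
have c0 : 0 < prob (fiber k).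
  by rewrite -lte_fin -probE//; exact: measurable_fiber.
rewrite -lerBlDl -ler_pdivrMl// mulrC mulrBl.
apply: le_trans (ler_norm _) (le_trans osc _); rewrite ler_wpM2l//.
apply: ler_sum => j _; have /andP[_ jd] := valP j.
apply: ge0_ler_powR; rewrite ?nnegrE ?r_ge0 ?normr_ge0//.
  by rewrite ltW// h_pos.
exact: (coord_cell_width jd (ky (to_idx j)) (ky' (to_idx j))).
Qed.

Lemma uniform_density (k : K) (c : R) A :
  ((c * volume k)%:E * uniform h_pos k A =
   c%:E * @ref_meas R d0 d m S (A `&` cell_box k))%E.
Proof.
rewrite uniformE muleA -EFinM mulfK// gt_eqF// volume_gt0//.
Qed.

Lemma prob_density_le (k : K) (c : R) A : measurable A ->
  (forall x, cell_box k x -> p x <= c) ->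
  (P (A `&` cell_box k) <= (c * volume k)%:E * uniform h_pos k A)%E.
Proof.
move=> mA pc; have [mp p0 PE] := pP.
have kS : A `&` cell_box k `<=` @space_of R d0 d m S.
  by move=> x [_ /(cell_box_space h_pos fin)].
have mk : measurable (A `&` cell_box k) by apply: measurableI => //; exact: measurable_cell_box.
rewrite PE// uniform_density -[leRHS]integral_cst//.
apply: ge0_le_integral => //.
- by move=> x /kS/p0; rewrite lee_fin.
- by apply/measurable_EFinP; apply: (measurable_funS _ kS mp); exact: measurable_space.
- by move=> x [_ /pc]; rewrite lee_fin.
Qed.

Lemma prob_density_ge (k : K) (c : R) A : measurable A -> 0 <= c ->
  (forall x, cell_box k x -> c <= p x) ->
  ((c * volume k)%:E * uniform h_pos k A <= P (A `&` cell_box k))%E.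
Proof.
move=> mA c0 pc; have [mp p0 PE] := pP.
have kS : A `&` cell_box k `<=` @space_of R d0 d m S.
  by move=> x [_ /(cell_box_space h_pos fin)].
have mk : measurable (A `&` cell_box k) by apply: measurableI => //; exact: measurable_cell_box.
rewrite PE// uniform_density -[leLHS]integral_cst//.
apply: ge0_le_integral => //.
- by apply/measurable_EFinP; apply: (measurable_funS _ kS mp); exact: measurable_space.
- by move=> x [_ /pc]; rewrite lee_fin.
Qed.

(** The density lies between its infimum on the cell and this infimum plus its
    oscillation. On a null fibre nothing is known about the density, but there
    the law vanishes. *)
Lemma cell_sandwich (k : K) : exists ab : R * R,
  [/\ 0 <= ab.1, ab.1 <= prob (cell_box k), prob (cell_box k) <= ab.2,
     ab.2 - ab.1 <= prob (fiber k) * (L * holder_width) * volume k &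
     forall A, measurable A ->
       (ab.1%:E * uniform h_pos k A <= P (A `&` cell_box k))%E /\
       (P (A `&` cell_box k) <= ab.2%:E * uniform h_pos k A)%E].
Proof.
suff [ab [ab0 abM abP]] : exists ab : R * R,
  [/\ 0 <= ab.1, ab.2 - ab.1 <= prob (fiber k) * (L * holder_width) * volume k &
     forall A, measurable A ->
       (ab.1%:E * uniform h_pos k A <= P (A `&` cell_box k))%E /\
       (P (A `&` cell_box k) <= ab.2%:E * uniform h_pos k A)%E].
  have mk : measurable (cell_box k) by exact: measurable_cell_box.
  have := abP _ mk; rewrite setIid (uniform_cell h_pos fin) !mule1 probE// !lee_fin => -[].
  by exists ab.
have holder_width_ge0 : 0 <= holder_width by apply: sumr_ge0 => j _; exact: powR_ge0.
have [Pk|] := ltP 0%E (P (fiber k)); last first.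
  rewrite measure_le0 => /eqP Pk; exists (0, 0); split=> //=.
    rewrite subr0 !mulr_ge0//; first exact: fine_ge0.
    by rewrite ltW// volume_gt0.
  move=> A mA; rewrite !mul0e; split=> //.
  rewrite -Pk; apply: le_measure; rewrite ?inE.
  - by apply: measurableI => //; exact: measurable_cell_box.
  - exact: measurable_fiber.
  - move=> x [_ kx]; apply/fiberP; exists k; rewrite ifT//.
    by apply/forallP => i; rewrite eqxx implybT.
have [_ p0 _] := pP; pose B := p @` cell_box k.
have lB : lbound B 0.
  by move=> _ [x /(cell_box_space h_pos fin) sx <-]; exact: p0.
have Bne : B !=set0 by exists (p (cell_point k)), (cell_point k) => //; exact: cell_pointP.
pose lo := inf B; pose hi := lo + prob (fiber k) * (L * holder_width).
have lo0 : 0 <= lo by exact: lb_le_inf.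
have lo_le x : cell_box k x -> lo <= p x.
  by move=> kx; apply: ge_inf; [exists 0|exists x].
have hi_ge x : cell_box k x -> p x <= hi.
  move=> kx; rewrite -lerBlDr; apply: lb_le_inf => // _ [y ky <-].
  by rewrite lerBlDr; exact: density_oscillation.
exists (lo * volume k, hi * volume k); split=> /=.
- by rewrite mulr_ge0// ltW// volume_gt0.
- by rewrite -mulrBl /hi addrAC subrr add0r.
- by move=> A mA; split; [exact: prob_density_ge|exact: prob_density_le].
Qed.

(** Replacing a bounded function by its averages over the cells changes its
    mean under a smooth law by at most the oscillation of the density. *)
Lemma cell_average_bias (g : pts R (idx S) -> R) (s : R) :
  measurable_fun setT g -> (forall x, 0 <= g x <= s) ->
  \sum_(k : K) prob (cell_box k) * fine (\int[uniform h_pos k]_x (g x)%:E)%E -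
    fine (\int[P]_x (g x)%:E)%E <= s / 2 * (L * holder_width).
Proof.
move=> mg gs; have [ab abP] := choice cell_sandwich.
have s0 : 0 <= s by have /andP[h0 /(le_trans h0)] := gs (fun=> 0).
have uT (k : K) : uniform h_pos k setT = 1%E by exact: uniformT.
have a0 k : 0 <= (ab k).1 by have [] := abP k.
have aq k : (ab k).1 <= prob (cell_box k) by have [] := abP k.
have qb k : prob (cell_box k) <= (ab k).2 by have [] := abP k.
have Pa A : measurable A -> (\sum_k (ab k).1%:E * uniform h_pos k A <= P A)%E.
  move=> mA; rewrite (prob_space mA); apply: lee_sum => k _.
  by have [_ _ _ _ /(_ A mA)[]] := abP k.
have Pb A : measurable A -> (P A <= \sum_k (ab k).2%:E * uniform h_pos k A)%E.
  move=> mA; rewrite (prob_space mA); apply: lee_sum => k _.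
  by have [_ _ _ _ /(_ A mA)[]] := abP k.
have sandwich := mixture_sandwich (probability_setT P) uT a0 aq qb sum_prob_cells Pa Pb mg gs.
apply: le_trans sandwich _.
rewrite ler_wpM2l ?divr_ge0//.
apply: (@le_trans _ _ (\sum_(k : K) (prob (fiber k) * volume k) * (L * holder_width))).
  by apply: ler_sum => k _; rewrite mulrAC; have [] := abP k.
by rewrite -mulr_suml sum_prob_fiber_volume mul1r.
Qed.

End density_cells.

(** * The bias of the discretisation *)

Lemma uniform_proj_integral (R : realType) (d0 d : nat) (m : 'I_d -> option nat) (h : 'I_d -> R)
    (h_pos : forall j : 'I_d, (j < d0)%N -> 0 < h j) (fin : forall j, nlevels d0 m h j != None)
    (S : {set 'I_d}) (x : grid (grid_size d0 m h) (@id 'I_d)) (g : pts R (idx S) -> \bar R) :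
  measurable_fun setT g -> (forall y, 0 <= g y)%E ->
  (\int[uniform h_pos (restrict S x)]_y g y = \int[uniform h_pos x]_z g (proj_to z))%E.
Proof.
move=> mg g0.
have := @ge0_integral_pushforward _ _ _ _ R _ (@measurable_proj_to R d S) (uniform h_pos x) setT g
  measurableT mg (fun y _ => g0 y).
rewrite preimage_setT => <-.
apply: eq_measure_integral => [|mp A mA _]; first exact: measurable_proj_to.
by rewrite /= /pushforward uniform_proj.
Qed.

Section bias.
Variables (R : realType) (d0 d : nat) (m : 'I_d -> option nat) (h : 'I_d -> R).
Hypothesis m_pos : forall (j : 'I_d) (k : nat), (d0 <= j)%N -> m j = Some k -> (1 <= k)%N.
Hypothesis h_pos : forall j : 'I_d, (j < d0)%N -> 0 < h j.
Hypothesis fin : forall j, nlevels d0 m h j != None.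

Notation N := (grid_size d0 m h).

Variable SS : {set {set 'I_d}}.
Hypothesis SS_gt0 : (0 < #|SS|)%N.

Notation T := (mass_coord N SS).
Notation s := (#|SS|%:R : R).
Notation point S k := (Tagged (fun S0 : member SS => grid_of N (val S0)) (i := S) k).

Variables (r : 'I_d -> R) (L : R) (P : forall S : {set 'I_d}, probability (pts R (idx S)) R).
Hypothesis r_ge0 : forall j : 'I_d, (j < d0)%N -> 0 <= r j.
Hypothesis L_ge0 : 0 <= L.
Hypothesis P_smooth : smooth_class d0 m SS r L P.

Notation q := (@cell_mass R d0 d m h SS P).

Definition bias : R := L * (s - 1) * \sum_(j < d | (j < d0)%N) h j `^ r j.

Let P1 S : S \in SS -> P S (@space_of R d0 d m S) = 1%E.
Proof. by case: P_smooth => + _; apply. Qed.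

Let measurable_space_of S : measurable (@space_of R d0 d m S).
Proof. exact: measurable_space. Qed.

Lemma bias_ge0 : 0 <= bias.
Proof.
rewrite /bias !mulr_ge0 ?subr_ge0 ?ler1n//; apply: sumr_ge0 => j _; exact: powR_ge0.
Qed.

Lemma half_le_pred (x : R) : 2 <= x -> x / 2 <= x - 1.
Proof. by move=> x2; rewrite ler_pdivrMr//; lra. Qed.

Lemma holder_width_le (S : {set 'I_d}) :
  holder_width d0 h r S <= \sum_(j < d | (j < d0)%N) h j `^ r j.
Proof.
rewrite /holder_width -(big_sub (fun j : 'I_d => (j \in S) && (j < d0)%N)
  (fun j => h j `^ r j)).
rewrite big_mkcond [leRHS]big_mkcond; apply: ler_sum => j _ /=.
rewrite unfold_in /=; case: (j \in S) => //=.
by case: ifP => // _; exact: powR_ge0.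
Qed.

Lemma bounded_integral_fin (dT : measure_display) (U : measurableType dT)
    (mu : {measure set U -> \bar R}) (g : U -> R) (c : R) :
  mu setT = 1%E -> measurable_fun setT g -> (forall x, 0 <= g x <= c) ->
  (\int[mu]_x (g x)%:E = (fine (\int[mu]_x (g x)%:E))%:E)%E.
Proof.
move=> mu1 mg gc; rewrite fineK// ge0_fin_numE; last first.
  by apply: integral_ge0 => x _; rewrite lee_fin; have /andP[] := gc x.
apply: (@le_lt_trans _ _ (\int[mu]_x (cst c%:E) x)%E); last first.
  by rewrite integral_cst// mu1 mule1 ltry.
apply: ge0_le_integral => //.
- by move=> x _; rewrite lee_fin; have /andP[] := gc x.
- exact/measurable_EFinP.
- by move=> x _; rewrite lee_fin; have /andP[] := gc x.
Qed.

Lemma proj_to_surjective (S : {set 'I_d}) (x : pts R (idx S)) : space_of d0 m x ->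
  exists2 z : pts R 'I_d, full_space d0 m z & proj_to z = x.
Proof.
move=> sx; pose o j : 'I_(N j) := Ordinal (grid_size_gt0 m_pos h_pos fin j).
exists (fun j => if insub j is Some i then x i else coord_point (o j)).
  move=> j; case: insubP => [i _ <-|_]; first exact: sx.
  apply: (coord_cell_space h_pos fin); exact: coord_pointP.
by apply/funext => i; rewrite /proj_to valK.
Qed.

Section competitor.
Variable f : forall S : {set 'I_d}, pts R (idx S) -> R.
Hypothesis fG : class_G d0 m SS f.

Let f_ge S x : S \in SS -> space_of d0 m x -> - 1 <= f (S := S) x.
Proof. by move=> SSS sx; case: fG => /(_ S SSS)[+ _ _] _; apply. Qed.

Let mf S : S \in SS -> measurable_fun (@space_of R d0 d m S) (f (S := S)).
Proof.
move=> SSS; case: fG => /(_ S SSS)[_ _ usc] _.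
exact: measurable_upper_semicontinuous usc.
Qed.

(** With a single member, the nonnegativity of the sum is that of [f]. *)
Lemma index_at_single : #|SS| = 1%N -> (index_at d0 m SS P f <= 0)%E.
Proof.
move/eqP/cards1P => [S0 SSE].
have S0S : S0 \in SS by rewrite SSE finset.inE.
rewrite /index_at oppe_le0 mule_ge0 ?lee_fin ?invr_ge0//.
rewrite SSE big_set1; apply: integral_ge0 => x sx; rewrite lee_fin.
have [z sz <-] := proj_to_surjective sx.
have [_ /nonneg_sumE/(_ z sz)] := fG.
by rewrite SSE big_set1.
Qed.

(** Shifted by one, and extended by zero, to have values in [[0, s]] everywhere. *)
Definition truncated (S : {set 'I_d}) : pts R (idx S) -> R :=
  fun x => if x \in @space_of R d0 d m S then Num.min (f x) (s - 1) + 1 else 0.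

Lemma truncatedE S x : space_of d0 m x -> truncated (S := S) x = Num.min (f x) (s - 1) + 1.
Proof. by move=> sx; rewrite /truncated mem_set. Qed.

Lemma measurable_truncated S : S \in SS -> measurable_fun setT (truncated (S := S)).
Proof.
move=> SSS; pose D := @space_of R d0 d m S.
have mg : measurable_fun D (fun x => Num.min (f (S := S) x) (s - 1) + 1).
  by apply: measurable_funD => //; apply: measurable_minr => //; exact: mf.
move=> _ B mB; rewrite setTI (_ : _ @^-1` B =
    (D `&` (fun x => Num.min (f (S := S) x) (s - 1) + 1) @^-1` B) `|`
    (~` D `&` cst 0 @^-1` B)).
  apply: measurableU; first exact: mg.
  by apply: measurable_cst => //; exact: measurableC.
apply/seteqP; split=> x; rewrite /preimage /truncated /= -/D.
  by case: ifPn => [/set_mem|/negP]; [left|rewrite inE; right].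
by move=> [[Dx]|[Dx]]; [rewrite mem_set|rewrite memNset].
Qed.

Lemma truncated_bounds S x : S \in SS -> 0 <= truncated (S := S) x <= s.
Proof.
move=> SSS; have [sx|sx] := pselect (space_of d0 m x); last first.
  by rewrite /truncated memNset// ler0n lexx.
rewrite truncatedE// -lerBlDr sub0r le_min f_ge//=.
rewrite lerBrDr addNr ler0n /= -lerBrDr.
by rewrite ge_min lexx orbT.
Qed.

Notation cell_uniform k := (uniform h_pos k).

Definition cell_average (t : T) : R :=
  fine (\int[cell_uniform (tagged t)]_x (truncated x)%:E)%E - 1.

Lemma cell_averageE (S : member SS) (k : grid_of N (val S)) :
  (\int[cell_uniform k]_x (truncated x)%:E = (cell_average (point S k) + 1)%:E)%E.
Proof.
rewrite /cell_average subrK /=; apply: (bounded_integral_fin (c := s)) => [||x].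
- exact: uniformT.
- exact: measurable_truncated (valP S).
- exact: truncated_bounds (valP S).
Qed.

Lemma sum_truncated_ge (z : pts R 'I_d) : full_space d0 m z ->
  s <= \sum_(S : member SS) truncated (proj_to z : pts R (idx (val S))).
Proof.
move=> sz; have sS (S : member SS) : space_of d0 m (proj_to z : pts R (idx (val S))).
  by move=> i; exact: sz.
under eq_bigr => S _ do rewrite (truncatedE (sS S)).
rewrite big_split /= sumr_const card_member lerDr -card_member.
apply: truncated_sum_ge0 => [S|]; first exact: f_ge (valP S) (sS S).
have [_ /nonneg_sumE/(_ z sz)] := fG.
by rewrite big_sub.
Qed.

(** The averages of the [f S] over the projections of one cell of the full space
    are integrals against the same law, so their sum is the integral of a
    nonnegative function. *)
Lemma cell_average_admissible : admissible cell_average.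
Proof.
split=> [t|x].
  rewrite /cell_average lerBrDr addNr; apply: fine_ge0; apply: integral_ge0 => y _.
  by rewrite lee_fin; have /andP[] := truncated_bounds y (valP (tag t)).
suff : s <= \sum_(S : member SS) (cell_average (coord x S) + 1).
  by rewrite big_split /= sumr_const card_member lerDr.
have m_proj (S : member SS) :
    measurable_fun setT (fun z => (truncated (proj_to z : pts R (idx (val S))))%:E).
  apply/measurable_EFinP; apply: measurableT_comp (measurable_truncated (valP S)) _.
  exact: measurable_proj_to.
have proj_ge0 (S : member SS) z : (0 <= (truncated (proj_to z : pts R (idx (val S))))%:E)%E.
  by rewrite lee_fin; have /andP[] := truncated_bounds (proj_to z) (valP S).
have m_sum : measurable_fun setT (fun z => \sum_(S : member SS)
    (truncated (proj_to z : pts R (idx (val S))))%:E)%E.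
  exact: (emeasurable_sum (index_enum (member SS)) m_proj).
rewrite -lee_fin -sumEFin.
have -> : (\sum_(S : member SS) (cell_average (coord x S) + 1)%:E =
    \int[cell_uniform x]_z \sum_(S : member SS) (truncated (proj_to z : pts R (idx (val S))))%:E)%E.
  rewrite ge0_integral_sum//; apply: eq_bigr => S _.
  rewrite -(cell_averageE (restrict (val S) x)).
  rewrite (uniform_proj_integral (S := val S) h_pos fin x (g := fun y => (truncated y)%:E))//.
  - by apply/measurable_EFinP; exact: measurable_truncated (valP S).
  - by move=> y; rewrite lee_fin; have /andP[] := truncated_bounds y (valP S).
have mx : measurable (cell_box x) by exact: measurable_cell_box.
apply: (@le_trans _ _ (\int[cell_uniform x]_(z in cell_box x) cst s%:E z)%E).
  by rewrite integral_cst// uniform_cell// mule1.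
apply: le_trans (ge0_subset_integral _ mx measurableT _ _ _); last exact: subsetT.
- apply: ge0_le_integral => //.
  + by move=> z _; rewrite lee_fin.
  + exact: measurable_funTS.
  + move=> z xz; rewrite sumEFin lee_fin; apply: sum_truncated_ge.
    exact: cell_box_space xz.
- exact: m_sum.
- by move=> z _; apply: sume_ge0.
Qed.

Lemma integral_truncated_le S : S \in SS ->
  ((fine (\int[P S]_x (truncated x)%:E) - 1)%:E <=
   \int[P S]_(x in @space_of R d0 d m S) (f x)%:E)%E.
Proof.
move=> SSS; pose D := @space_of R d0 d m S.
have mD : measurable D by exact: measurable_space_of.
have gE : (\int[P S]_x (truncated x)%:E = (fine (\int[P S]_x (truncated x)%:E))%:E)%E.
  apply: (bounded_integral_fin (c := s)) => [||x]; first exact: probability_setT.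
    exact: measurable_truncated.
  exact: truncated_bounds.
have D_lty : (P S D < +oo)%E by rewrite P1// ltry.
have fI : (P S).-integrable D (EFin \o f (S := S)).
  apply: measurable_bounded_integrable => //; first exact: mf.
  have [/(_ S SSS)[f1 [M fM] _] _] := fG.
  exists (Num.max 1 M); split; first exact: num_real.
  move=> c /ltW cM x /= xD; apply: le_trans cM; rewrite ler_norml le_max fM// orbT andbT.
  by apply: le_trans (f1 x xD); rewrite lerN2 le_max lexx.
have oneI : (P S).-integrable D (EFin \o cst 1).
  apply: measurable_bounded_integrable => //.
  exists 1; split; first exact: num_real.
  by move=> c /ltW c1 x _; rewrite /= normr1.
have add1 : (\int[P S]_(x in D) (f x + 1)%:E = \int[P S]_(x in D) (f x)%:E + 1)%E.
  rewrite -[in RHS](P1 SSS) -[X in (_ + X)%E]mul1e -integral_cst//.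
  exact: (integralD_EFin mD fI oneI).
rewrite EFinB leeBlDr// -gE -add1.
have -> : (\int[P S]_x (truncated x)%:E = \int[P S]_(x in D) (truncated x)%:E)%E.
  rewrite [RHS]integral_mkcond; apply: eq_integral => x _.
  by rewrite patchE /truncated -/D; case: ifP.
apply: ge0_le_integral => //.
- by move=> x _; rewrite lee_fin; have /andP[] := truncated_bounds x SSS.
- by apply: measurable_funTS; apply/measurable_EFinP; exact: measurable_truncated.
- by apply/measurable_EFinP; apply: measurable_funD => //; exact: mf.
- by move=> x xD; rewrite lee_fin truncatedE// lerD2r ge_min lexx.
Qed.

(** Truncation at [s - 1] lowers [f], which only increases the index; it makes
    [cell_average_bias] available, with the constant [s / 2 <= s - 1]. *)
Lemma index_at_cell_average : (2 <= #|SS|)%N ->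
  (index_at d0 m SS P f <= (discrete_index q cell_average + bias)%:E)%E.
Proof.
move=> s2; pose G (S : member SS) : R := fine (\int[P (val S)]_x (truncated x)%:E)%E.
pose width := \sum_(j < d | (j < d0)%N) h j `^ r j.
have s_gt0 : 0 < s by rewrite ltr0n.
apply: (@le_trans _ _ (- (s^-1 * \sum_(S : member SS) (G S - 1)))%:E).
  rewrite /index_at EFinN leeN2 EFinM; apply: lee_wpmul2l; first by rewrite lee_fin invr_ge0.
  rewrite -sumEFin [leRHS]big_sub; apply: lee_sum => S _.
  exact: integral_truncated_le (valP S).
rewrite lee_fin /discrete_index (sum_mass_coord (fun t => q t * cell_average t)).
pose A (S : member SS) := \sum_(k : grid_of N (val S)) q (point S k) * cell_average (point S k).
have step (S : member SS) : A S - (G S - 1) <= s / 2 * (L * width).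
  have [SSS [p [pP p_holder]]] : val S \in SS /\ exists p, is_density d0 m (P (val S)) p /\
      forall x, space_of d0 m x -> (0 < P (val S) (disc_fiber d0 m x))%E ->
      holder (fun j : cont_idx d0 (val S) => r (val j)) L
        (fun z => p (Defs.glue z x) / fine (P (val S) (disc_fiber d0 m x))).
    by split; [exact: (valP S)|case: P_smooth => _; apply; exact: (valP S)].
  have := cell_average_bias m_pos h_pos fin r_ge0 L_ge0 (P1 SSS) pP p_holder
    (measurable_truncated SSS) (fun x => truncated_bounds x SSS).
  have -> : A S - (G S - 1) = \sum_(k : grid_of N (val S))
      prob (P (val S)) (cell_box k) * fine (\int[cell_uniform k]_x (truncated x)%:E)%E - G S.
    rewrite /A /cell_average; under eq_bigr do rewrite mulrBr mulr1.
    rewrite sumrB /= (_ : \sum_k q (point S k) = 1); last exact: mass_cell_mass.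
    by rewrite opprB addrA subrK.
  move/le_trans; apply; rewrite ler_wpM2l ?divr_ge0//.
  by rewrite ler_wpM2l// holder_width_le.
have width_ge0 : 0 <= width by apply: sumr_ge0 => j _; exact: powR_ge0.
rewrite -/width -lerBlDl opprK addrC -mulrBr -sumrB ler_pdivrMl//.
apply: le_trans (ler_sum _ (fun S _ => step S)) _.
rewrite sumr_const card_member -[leLHS]mulr_natl ler_wpM2l//.
rewrite /bias -/width [leLHS]mulrCA [leLHS]mulrA ler_wpM2r// ler_wpM2l//.
by apply: half_le_pred; rewrite ler_nat.
Qed.

End competitor.

(** The cell averages of [f] are an admissible function on the grid, to which the
    bound [c] applies. With a single member the terms are nonpositive, and [0 <= c]
    because the zero function is admissible. *)
Lemma incompat_index_le c :
  (forall f : {ffun T -> R}, admissible f -> discrete_index q f <= c) ->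
  (incompat_index d0 m SS P <= (c + bias)%:E)%E.
Proof.
move=> cP; apply: ge_ereal_sup => _ [f fG <-].
have [s1|s2] := leqP #|SS| 1.
  have /(index_at_single fG)/le_trans-> // : #|SS| = 1%N by apply/eqP; rewrite eqn_leq s1.
  rewrite lee_fin addr_ge0 ?bias_ge0//.
  have := cP [ffun=> 0]; rewrite {1}/discrete_index big1 ?mulr0 ?oppr0; last first.
    by move=> t _; rewrite ffunE mulr0.
  apply; split=> [t|x]; first by rewrite ffunE lerN10.
  by rewrite big1// => S _; rewrite ffunE.
apply: le_trans (index_at_cell_average fG s2) _; rewrite lee_fin lerD2r.
have [a1 a0] := cell_average_admissible fG.
pose a : {ffun T -> R} := [ffun t => cell_average f t].
have -> : discrete_index q (cell_average f) = discrete_index q a.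
  by rewrite /discrete_index; congr (- (_ * _)); apply: eq_bigr => t _; rewrite ffunE.
apply: cP; split=> [t|x]; first by rewrite ffunE.
by under eq_bigr do rewrite ffunE.
Qed.

End bias.

(** * The test *)

Lemma crit_finiteP (R : realType) (d0 d : nat) (m : 'I_d -> option nat) (SS : {set {set 'I_d}})
    (h : 'I_d -> R) (n : {set 'I_d} -> nat) (a : R) :
  (forall j, nlevels d0 m h j != None) ->
  exists2 c : R, crit d0 m SS h n a = c%:E &
    c = tv_critical_value (grid_size d0 m h) SS n a \/
    [exists p : {set 'I_d} * {set 'I_d}, overlap SS p.1 p.2] /\
    c = facet_critical_value (grid_size d0 m h) SS n a.
Proof.
move=> fin; rewrite /crit ifT; last by apply/forallP.
set c1 := crit1 _ _ _ _ _ _; case: ifP => [ov|_]; last first.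
  by exists c1; [rewrite min_l ?leey|left].
set c2 := crit2 _ _ _ _ _ _; exists (Num.min c1 c2).
  by rewrite /Order.min lte_fin; case: ifP.
by rewrite /Num.min /Order.min; case: ifP => _; [left|right].
Qed.

Lemma crit_infinite (R : realType) (d0 d : nat) (m : 'I_d -> option nat) (SS : {set {set 'I_d}})
    (h : 'I_d -> R) (n : {set 'I_d} -> nat) (a : R) :
  ~ (forall j, nlevels d0 m h j != None) -> crit d0 m SS h n a = +oo%E.
Proof. by move=> inf; rewrite /crit ifF//; apply/negP => /forallP. Qed.

Theorem theorem14 (R : realType) (d0 d : nat)
    (d0_ge1 : (1 <= d0)%N) (d0_le_d : (d0 <= d)%N)
    (m : 'I_d -> option nat)
    (m_pos : forall (j : 'I_d) (k : nat),
       (d0 <= j)%N -> m j = Some k -> (1 <= k)%N)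
    (SS : {set {set 'I_d}}) (SS_nonempty : (0 < #|SS|)%N)
    (h : 'I_d -> R) (h_pos : forall j : 'I_d, (j < d0)%N -> 0 < h j)
    (r : 'I_d -> R) (r_bounds : forall j : 'I_d, (j < d0)%N -> 0 < r j <= 1)
    (L : R) (L_pos : 0 < L)
    (alpha beta : R) (alpha_bounds : 0 < alpha < 1) (beta_bounds : 0 < beta < 1)
    (n : {set 'I_d} -> nat) (n_pos : forall S, S \in SS -> (1 <= n S)%N)
    (P : forall S : {set 'I_d}, probability (pts R (idx S)) R)
    (P_smooth : smooth_class d0 m SS r L P)
    (dO : measure_display) (Omega : measurableType dO)
    (Pr : probability Omega R)
    (X : forall S : {set 'I_d}, nat -> Omega -> pts R (idx S))
    (X_samples : indep_samples d0 m SS n P Pr X) :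
  let Rh_hat (w : Omega) := incompat_index_h d0 m SS h (empirical n X w) in
  let C (a : R) := crit d0 m SS h n a in
  (compatible d0 m SS P ->
     (Pr [set w | C alpha <= Rh_hat w] <= alpha%:E)%E) /\
  ((incompat_index d0 m SS P >=
      (L * (#|SS|%:R - 1) * \sum_(j < d | (j < d0)%N) h j `^ r j)%:E
      + C alpha + C beta)%E ->
     (Pr [set w | Rh_hat w < C alpha] <= beta%:E)%E).
Proof.
move=> Rh_hat C; have [P1 _] := P_smooth.
have emp1 w S : S \in SS -> empirical n X w S (@space_of R d0 d m S) = 1%E.
  exact: (empirical_space n_pos X_samples).
have [fin|infinite] := pselect (forall j, nlevels d0 m h j != None); last first.
  have CE a : C a = +oo%E by rewrite /C crit_infinite.
  split=> [_|].
    rewrite (_ : [set w | _] = set0) ?measure0 ?lee_fin; first by case/andP: alpha_bounds => /ltW.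
    apply/seteqP; split=> // w /=; rewrite CE leye_eq => /eqP Rw.
    by have := incompat_index_h_le1 SS_nonempty (emp1 w) h; rewrite -/(Rh_hat w) Rw.
  rewrite !CE => /= le; have := incompat_index_le1 SS_nonempty P1.
  by move/(le_trans le).
pose N := grid_size d0 m h.
have N_gt0 : forall j, (0 < N j)%N := grid_size_gt0 m_pos h_pos fin.
have [Phi [PhiN PhiP]] := finite_normalized_class R N_gt0 SS_nonempty.
pose q := @cell_mass R d0 d m h SS P.
pose Z (y : {ffun sample SS n -> mass_coord N SS}) := index_max Phi (empirical_mass R y).
pose Y := sample_index m_pos h_pos fin SS n X.
have q_ge0 t : 0 <= q t by exact: cell_mass_ge0.
have q_mass S : mass q S = 1 by exact: mass_cell_mass.
have RhE w : Rh_hat w = (Z (Y w))%:E.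
  rewrite /Rh_hat (incompat_index_hE m_pos h_pos fin (emp1 w) PhiN PhiP); congr (index_max Phi _)%:E.
  by apply/funext; exact: cell_mass_empirical X_samples w.
have PrE (B : pred {ffun sample SS n -> mass_coord N SS}) :
    Pr [set w | B (Y w)] = (expectation (sample_law q) (fun y => (B y)%:R))%:E.
  exact: probability_sample_index.
have [ca CaE ca_cases] := crit_finiteP SS n alpha fin.
have [cb CbE cb_cases] := crit_finiteP SS n beta fin.
split=> [P_compatible|].
  have q_compatible := compatible_cell_mass m_pos h_pos fin P_compatible.
  rewrite (_ : [set w | _] = [set w | ca <= Z (Y w)]); last first.
    by apply/seteqP; split=> w /=; rewrite /C CaE RhE lee_fin.
  rewrite (PrE (fun y => ca <= Z y)) lee_fin.
  case: ca_cases => [->|[ov ->]].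
    exact: (tv_rejection N_gt0 SS_nonempty n_pos alpha_bounds q_ge0 q_mass PhiN q_compatible).
  exact: (facet_rejection N_gt0 SS_nonempty n_pos alpha_bounds q_ge0 q_mass PhiN ov q_compatible).
have r_ge0 (j : 'I_d) : (j < d0)%N -> 0 <= r j by move=> /r_bounds/andP[/ltW].
have qP (f : {ffun mass_coord N SS -> R}) : admissible f ->
    discrete_index q f <= index_max Phi q.
  move=> fA; apply: (PhiP _ _ 1) => // [g gP|]; first exact: index_max_ge.
  exact: index_max_ge0.
have biased := incompat_index_le m_pos h_pos fin SS_nonempty r_ge0 (ltW L_pos) P_smooth qP.
rewrite /C CaE CbE => /le_trans/(_ biased).
rewrite -!EFinD lee_fin /bias -addrA addrC lerD2r => separated.
rewrite (_ : [set w | _] = [set w | Z (Y w) < ca]); last first.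
  by apply/seteqP; split=> w /=; rewrite RhE lte_fin.
rewrite (PrE (fun y => Z y < ca)) lee_fin.
case: cb_cases => [cbE|[ov cbE]]; rewrite cbE in separated.
  exact: (tv_acceptance SS_nonempty n_pos beta_bounds q_ge0 q_mass PhiN separated).
exact: (facet_acceptance SS_nonempty n_pos beta_bounds q_ge0 q_mass PhiN ov separated).
Qed.
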